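(* Let $\mathbb F$ be a free group with standard (free) generating set $G$ satisfying $|G|\ge2$, and let $\mathcal L_{\mathbb F}$ be the group von Neumann algebra of $\mathbb F$ with its canonical trace. Then $\mathfrak K_3(\mathcal L_{\mathbb F})=\infty$.
   Context: $G$ may be infinite, even uncountable. Let $\mathcal M_k(\mathbb C)$ be the $k\times k$ complex matrices, $\tau_k=\frac1k\mathrm{Tr}$, $\mathcal U_k$ the unitary $k\times k$ matrices, and $\|(A_1,\dots,A_n)\|_2^2=\sum_i\tau_k(A_i^*A_i)$ on $\mathcal M_k(\mathbb C)^n$. For $\omega>0$ the $\omega$-orbit-ball $\mathcal U(B_1,\dots,B_n;\omega)$ is the set of $(A_1,\dots,A_n)\in\mathcal M_k(\mathbb C)^n$ for which there is $W\in\mathcal U_k$ with $\|(A_1,\dots,A_n)-(WB_1W^*,\dots,WB_nW^* )\|_2<\omega$. For $E\subseteq\mathcal M_k(\mathbb C)^n$, $\nu(E,\omega)$ is the minimal number of $\omega$-orbit-balls with centers in $E$ that cover $E$ (with $\log 0=-\infty$). For $x_1,\dots,x_n$ in a von Neumann algebra $\mathcal M$ with tracial state $\tau$, $R,\varepsilon>0$, $m,k\in\mathbb N$, let $\Gamma_R(x_1,\dots,x_n;m,k,\varepsilon)$ be the set of $(A_1,\dots,A_n)\in\mathcal M_k(\mathbb C)^n$ with $\|A_j\|\le R$ for all $j$ and $|\tau_k(A_{i_1}^{\eta_1}\cdots A_{i_q}^{\eta_q})-\tau(x_{i_1}^{\eta_1}\cdots x_{i_q}^{\eta_q})|<\varepsilon$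 for all $1\le q\le m$, $1\le i_1,\dots,i_q\le n$, $\eta_1,\dots,\eta_q\in\{1,*\}$. For $y_1,\dots,y_p\in\mathcal M$, let $\Gamma_R(x_1,\dots,x_n:y_1,\dots,y_p;m,k,\varepsilon)$ be the set of $(A_1,\dots,A_n)$ for which there exist $B_1,\dots,B_p\in\mathcal M_k(\mathbb C)$ with $(A_1,\dots,A_n,B_1,\dots,B_p)\in\Gamma_R(x_1,\dots,x_n,y_1,\dots,y_p;m,k,\varepsilon)$. Writing $x=(x_1,\dots,x_n)$, $y=(y_1,\dots,y_p)$, define $$\mathfrak K(x:y;\omega)=\sup_{R>0}\ \inf_{m\in\mathbb N,\varepsilon>0}\ \limsup_{k\to\infty}\frac{\log\nu(\Gamma_R(x:y;m,k,\varepsilon),\omega)}{-k^2\log\omega},\qquad \mathfrak K_2(x:y)=\sup_{0<\omega<1}\mathfrak K(x:y;\omega).$$ With the convention $\infty\cdot0=0$, for a subset $\mathcal G\subseteq\mathcal M$ define $$\mathfrak K_3(\mathcal G)=\sup_{E\subseteq\mathcal G\text{ finite}}\ \inf_{F\subseteq\mathcal G\text{ finite}}\ \infty\cdot\mathfrak K_2(E:F),$$ so $\mathfrak K_3$ takes only the values $0$ and $\infty$. *)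

(* Defs.v *)
From HB Require Import structures.
From mathcomp Require Import all_boot all_order all_algebra spectral finmap.
From mathcomp Require Import complex ring lra.
From mathcomp Require Import all_classical all_reals all_analysis.

Set Implicit Arguments.
Unset Strict Implicit.
Unset Printing Implicit Defensive.

Import Order.TTheory GRing.Theory Num.Theory.
Import Normc.

Local Open Scope classical_set_scope.
Local Open Scope ring_scope.
Local Open Scope complex_scope.

Section SquareSummable.
Context (R : realType) (I : choiceType).
Implicit Types f g : I -> R[i].

Definition sqnorm f : \bar R := (\esum_(i in [set: I]) (normc (f i) ^+ 2)%:E)%E.

Definition square_summable : {pred I -> R[i]} := [pred f | (sqnorm f < +oo)%E].

Lemma normc_ge0 (z : R[i]) : 0 <= normc z.
Proof. by case: z => ? ?; exact: sqrtr_ge0. Qed.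

Lemma normcDsq (x y : R[i]) :
  normc (x + y) ^+ 2 <= 2 * normc x ^+ 2 + 2 * normc y ^+ 2.
Proof.
have h : normc (x + y) <= normc x + normc y by exact: le_normcD.
apply: (@le_trans _ _ ((normc x + normc y) ^+ 2)).
  by rewrite lerXn2r// nnegrE ?addr_ge0// normc_ge0.
rewrite -subr_ge0 (_ : _ - _ = (normc x - normc y) ^+ 2) ?sqr_ge0//.
by ring.
Qed.

Lemma sqnorm_ge0 f : (0 <= sqnorm f)%E.
Proof. by apply: esum_ge0 => i _; rewrite lee_fin sqr_ge0. Qed.

Lemma square_summable_submod : submod_closed square_summable.
Proof.
split.
  by rewrite inE /sqnorm esum1 ?ltry// => i _; rewrite normc0 expr0n.
move=> a f g; rewrite !inE => ff gf.
have c0 : 0 <= 2 * normc a ^+ 2 by rewrite mulr_ge0// sqr_ge0.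
apply: (@le_lt_trans _ _ ((2 * normc a ^+ 2)%:E * sqnorm f + 2%:E * sqnorm g)%E).
  apply: ge_ereal_sup => _ [X [finX XI] <-].
  apply: (@le_trans _ _ ((2 * normc a ^+ 2)%:E
      * (\sum_(i \in X) (normc (f i) ^+ 2)%:E)
      + 2%:E * \sum_(i \in X) (normc (g i) ^+ 2)%:E)%E).
    rewrite !fsbig_finite//= !sumEFin -!EFinM -EFinD lee_fin !mulr_sumr -big_split/=.
    apply: ler_sum => i _; apply: le_trans (normcDsq _ _) _.
    by rewrite lerD2r normcM exprMn mulrA.
  by apply: leeD; apply: lee_wpmul2l; rewrite ?lee_fin//;
    apply: ereal_sup_ubound; exists X.
by apply: lte_add_pinfty; apply: lte_mul_pinfty; rewrite ?lee_fin.
Qed.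

HB.instance Definition _ := GRing.isSubmodClosed.Build _ _ square_summable
  square_summable_submod.

Record l2 := L2 { l2_val :> I -> R[i]; l2P : l2_val \in square_summable }.

HB.instance Definition _ := [isSub for l2_val].
HB.instance Definition _ := [Choice of l2 by <:].
HB.instance Definition _ := [SubChoice_isSubLmodule of l2 by <:].

Definition l2norm (f : l2) : R := Num.sqrt (fine (sqnorm f)).

(** Absolutely convergent sums over I: the library only sums nonnegative
    families ([esum]), so split into real/imaginary and positive/negative
    parts. *)
Definition rsum (a : I -> R) : R :=
  fine (esum [set: I] (EFin \o a)^\+ - esum [set: I] (EFin \o a)^\-)%E.

Definition csum (z : I -> R[i]) : R[i] :=
  rsum (fun i => complex.Re (z i)) +i* rsum (fun i => complex.Im (z i)).

Definition inner (f g : l2) : R[i] := csum (fun i => f i * (g i)^*).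

Lemma delta_subproof (j : I) :
  (fun i => (i == j)%:R : R[i]) \in square_summable.
Proof.
rewrite inE /sqnorm (esumID [set j])//; last first.
  by move=> i _; rewrite lee_fin sqr_ge0.
rewrite setTI esum_set1 ?lee_fin ?sqr_ge0// esum1 ?adde0 ?ltry//.
move=> i [_ /eqP/negPf ij]; rewrite ij normc0 expr0n//.
Qed.

Definition delta (j : I) : l2 := L2 (delta_subproof j).

End SquareSummable.
Arguments delta {R I}.

(** By the Riesz representation theorem every bounded operator has a unique
    adjoint, which is again bounded; the adjoint is carried along here. *)
Record bop (R : realType) (I : choiceType) := Bop {
  op :> {linear l2 R I -> l2 R I} ;
  adj : {linear l2 R I -> l2 R I} ;
  op_bounded : exists M : R, forall f, l2norm (op f) <= M * l2norm f ;
  adj_bounded : exists M : R, forall f, l2norm (adj f) <= M * l2norm f ;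
  adjP : forall f g, inner (op f) g = inner f (adj g) }.

HB.instance Definition _ R I := gen_eqMixin (bop R I).
HB.instance Definition _ R I := gen_choiceMixin (bop R I).

Section BopAlgebra.
Context (R : realType) (I : choiceType).
Implicit Types S T : bop R I.

Lemma rsumN (a : I -> R) : rsum (fun i => - a i) = - rsum a.
Proof.
rewrite /rsum.
have -> : EFin \o (fun i => - a i) = (\- (EFin \o a))%E by [].
rewrite funeposN funenegN.
by case: (esum _ _) => [x| |]; case: (esum _ _) => [y| |] //=;
  rewrite ?oppr0 ?opprB.
Qed.

Lemma inner_conj (f g : l2 R I) : inner g f = (inner f g)^*.
Proof.
rewrite /inner /csum /= -rsumN; congr (_ +i* _); congr rsum;
  by apply/funext => i; case: (f i) (g i) => [a b] [c d] /=; ring.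
Qed.

Lemma bounded_comp (s t : l2 R I -> l2 R I) :
  (exists M : R, forall f, l2norm (s f) <= M * l2norm f) ->
  (exists M : R, forall f, l2norm (t f) <= M * l2norm f) ->
  exists M : R, forall f, l2norm ((s \o t) f) <= M * l2norm f.
Proof.
move=> [M sM] [N tN]; exists (`|M| * N) => f /=.
apply: (le_trans (sM _)); apply: (@le_trans _ _ (`|M| * l2norm (t f))).
  by apply: ler_wpM2r; [exact: sqrtr_ge0|exact: ler_norm].
by rewrite -mulrA ler_wpM2l.
Qed.

Lemma id_bounded : exists M : R, forall f : l2 R I, l2norm (idfun f) <= M * l2norm f.
Proof. by exists 1 => f; rewrite mul1r. Qed.

Definition bone : bop R I :=
  @Bop R I idfun idfun id_bounded id_bounded (fun _ _ => erefl).

Lemma bmul_adjP S T f g :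
  inner ((op S \o op T) f) g = inner f ((adj T \o adj S) g).
Proof. by rewrite /= !adjP. Qed.

Definition bmul S T : bop R I :=
  @Bop R I (op S \o op T) (adj T \o adj S)
    (bounded_comp (op_bounded S) (op_bounded T))
    (bounded_comp (adj_bounded T) (adj_bounded S)) (bmul_adjP S T).

Lemma bstar_adjP T f g : inner (adj T f) g = inner f (op T g).
Proof. by rewrite inner_conj -adjP -inner_conj. Qed.

Definition bstar T : bop R I :=
  @Bop R I (adj T) (op T) (adj_bounded T) (op_bounded T) (bstar_adjP T).

Definition commutant (A : set (bop R I)) : set (bop R I) :=
  [set T | forall S, A S -> op T \o op S =1 op S \o op T].

End BopAlgebra.

Section GroupVonNeumann.
Context (R : realType) (F : groupType).
Implicit Types g : F.

Definition translate g (f : F -> R[i]) : F -> R[i] := fun h => f (g^-1 * h)%g.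

Lemma translate_bij g : set_bij [set: F] [set: F] (fun h => g^-1 * h)%g.
Proof.
split=> //; first by move=> ? ? _ _; exact: mulgI.
by move=> h _; exists (g * h)%g => //; rewrite mulKg.
Qed.

Lemma sqnorm_translate g f : sqnorm (translate g f) = sqnorm f.
Proof. by rewrite [RHS](reindex_esum _ _ _ _ (translate_bij g)). Qed.

Lemma translate_subproof g (f : l2 R F) : translate g f \in @square_summable R F.
Proof. by rewrite inE sqnorm_translate; exact: l2P. Qed.

Definition ltrans g (f : l2 R F) : l2 R F := L2 (translate_subproof g f).

Lemma ltrans_is_linear g : linear (ltrans g).
Proof. by move=> a u v; apply: val_inj. Qed.

HB.instance Definition _ g :=
  GRing.isLinear.Build R[i] (l2 R F) (l2 R F) _ (ltrans g) (ltrans_is_linear g).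

Lemma ltrans_bounded g : exists M : R, forall f, l2norm (ltrans g f) <= M * l2norm f.
Proof. by exists 1 => f; rewrite mul1r /l2norm sqnorm_translate. Qed.

Lemma rsum_translate g (a : F -> R) : rsum (fun h => a (g^-1 * h)%g) = rsum a.
Proof.
have E (b : F -> \bar R) := reindex_esum _ _ _ b (translate_bij g).
rewrite /rsum [in RHS]E [X in _ = fine (_ - X)%E]E.
by congr (fine (_ - _)%E); apply: eq_esum => i _;
  rewrite ?funeposE ?funenegE.
Qed.

Lemma ltrans_adjP g (u v : l2 R F) :
  inner (ltrans g u) v = inner u (ltrans g^-1%g v).
Proof.
rewrite /inner /csum -(rsum_translate g (fun h => complex.Re (u h * _)))
  -(rsum_translate g (fun h => complex.Im (u h * _))) /= /translate.
by congr (_ +i* _); congr rsum; apply/funext => h; rewrite invgK mulVKg.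
Qed.

(** The left regular representation, (lambda_g f)(h) = f (g^-1 h). *)
Definition regrep g : bop R F :=
  @Bop R F (ltrans g) (ltrans g^-1%g) (ltrans_bounded g) (ltrans_bounded _)
    (ltrans_adjP g).

(** The von Neumann algebra generated by the left regular representation, as
    the bicommutant of the self-adjoint set of the lambda_g. *)
Definition group_vN : set (bop R F) := commutant (commutant (range regrep)).

Definition group_trace (T : bop R F) : R[i] :=
  inner (T (delta 1%g)) (delta 1%g).

End GroupVonNeumann.
Arguments group_trace : clear implicits.
Arguments group_vN : clear implicits.

(** [G] is a free generating set of [F]: every map [G -> H] into a group
    extends uniquely to a homomorphism [F -> H]. (A map on [G] is given as the
    restriction of a map on [F].) *)
Definition free_generating_set (F : groupType) (G : set F) : Prop :=
  forall (H : groupType) (f : F -> H), exists! h : F -> H,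
    {morph h : x y / (x * y)%g} /\ {in G, h =1 f}.

(** Tuples are indexed by finite types [J], [L] ('I_n being the case of
    n-tuples); the concatenation of two tuples is indexed by [J + L]. *)

Definition join_family (J L T : Type) (x : J -> T) (y : L -> T) (s : J + L) : T :=
  match s with inl j => x j | inr l => y l end.

Section Matrices.
Context (R : realType) (k : nat).
Local Notation C := R[i].
Local Open Scope sesquilinear_scope.

Definition ntr (A : 'M[C]_k) : C := k%:R^-1 * \tr A.

Definition vnorm (v : 'cV[C]_k) : R := Num.sqrt (\sum_i normc (v i 0) ^+ 2).

Definition opnorm (A : 'M[C]_k) : \bar R :=
  ereal_sup [set (vnorm (A *m v))%:E | v in [set v | vnorm v <= 1]].

Context (J : finType).
Implicit Types A B : J -> 'M[C]_k.

Definition norm2 A : R :=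
  Num.sqrt (complex.Re (\sum_j ntr ((A j)^t* *m A j))).

Definition orbit_ball B (omega : R) : set (J -> 'M[C]_k) :=
  [set A | exists2 W : 'M[C]_k, W \is unitarymx &
    norm2 (fun j => A j - W *m B j *m W^t*) < omega].

Definition cover_num (E : set (J -> 'M[C]_k)) (omega : R) : \bar R :=
  ereal_inf [set N%:R%:E | N in [set N : nat |
    exists B : 'I_N -> J -> 'M[C]_k,
      (forall i, E (B i)) /\ E `<=` \bigcup_i orbit_ball (B i) omega]].

(** A word [(i_1,eta_1),...,(i_q,eta_q)]; the boolean [true] stands for the
    exponent [*], [false] for the exponent 1. *)
Definition mx_word A (w : seq (J * bool)) : 'M[C]_k :=
  foldr (fun s X => (if s.2 then (A s.1)^t* else A s.1) *m X) 1%:M w.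

End Matrices.

Section Microstates.
Context (R : realType) (I : choiceType) (tau : bop R I -> R[i]).
Local Notation C := R[i].

Definition bop_word (J : finType) (x : J -> bop R I) (w : seq (J * bool)) :
    bop R I :=
  foldr (fun s X => bmul (if s.2 then bstar (x s.1) else x s.1) X) (bone R I) w.

Definition Gamma (r : R) (J : finType) (x : J -> bop R I) (m k : nat) (eps : R) :
    set (J -> 'M[C]_k) :=
  [set A | (forall j, (opnorm (A j) <= r%:E)%E) /\
    forall w : seq (J * bool), (1 <= size w <= m)%N ->
      normc (ntr (mx_word A w) - tau (bop_word x w)) < eps].

Context (J L : finType) (x : J -> bop R I) (y : L -> bop R I).

Definition Gamma_rel (r : R) (m k : nat) (eps : R) : set (J -> 'M[C]_k) :=
  [set A | exists B : L -> 'M[C]_k,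
    Gamma r (join_family x y) m eps (join_family A B)].

Definition frakK (omega : R) : \bar R :=
  ereal_sup [set ereal_inf
      [set limn_esup (fun k : nat =>
          lne (cover_num (@Gamma_rel r p.1 k p.2) omega)
            * (- (k%:R ^+ 2 * ln omega))^-1%:E)%E
      | p in [set p : nat * R | (0 < p.1)%N /\ 0 < p.2]]
    | r in [set r : R | 0 < r]].

Definition frakK2 : \bar R :=
  ereal_sup [set frakK omega | omega in [set omega : R | 0 < omega < 1]].

End Microstates.

(** The invariant of a subset [M] of a von Neumann algebra acting on l^2(I)
    whose trace is the restriction of [tau].  A finite subset [E] is used as
    the family of its elements, indexed by itself; in the library
    [+oo * 0 = 0]. *)
Definition frakK3 (R : realType) (I : choiceType) (tau : bop R I -> R[i])
    (M : set (bop R I)) : \bar R :=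
  ereal_sup [set ereal_inf
      [set (+oo * frakK2 tau (fun e : E => val e) (fun f : F => val f))%E
      | F in [set F : {fset bop R I} | [set` F] `<=` M]]
    | E in [set E : {fset bop R I} | [set` E] `<=` M]].

(* Main.v *)
(** For distinct free generators [a] and [b] we show that already
    [E = {lambda_a, lambda_b}] satisfies [K_2(E : F) > 0] for all finite [F].

    Many microstates.  Let [h] be a real orthogonal k x k matrix with entries of
    modulus [k^(-1/2)], let [D_0, ..., D_5] be diagonal sign matrices, and let [U]
    be any unitary.  For a suitable choice of the signs, [a |-> D_3 h D_4 D_5] and
    [b |-> D_0 h D_1 U D_2] are approximately free: [D_1] makes the entries of
    [h D_1 U] of size [O(log k / sqrt k)], and averaging over the outer signs then
    bounds the second moment of the trace of each cyclically reduced word.  These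
    representations of the free group turn elements of the group algebra into
    matrices, and Kaplansky's density theorem approximates the elements of [F] by
    elements of the group algebra, so that every such pair is a relative
    microstate, whatever [U] is.

    Few of them per orbit.  [U] is taken to be a unitary whose real part is the
    clipped and scaled matrix [[0, X], [X^T, 0]] for a k/2 x k/2 sign matrix [X].
    If two pairs with the same signs lie in one small orbit-ball, the conjugating
    unitary almost commutes with the image of [a], whose eigenvalues are
    equidistributed since its moments almost vanish.  So in an eigenbasis this
    unitary is almost supported on a small proportion of the entries, and rounding
    them leaves only [2^(c k^2)] possibilities, each of which determines [X] up to
    a small Hamming distance.  Hence, for each of the [2^(6 k)] choices of signs,
    an orbit-ball accounts for at most [2^(8 r)] of the at least [2^(16 r - 1)]
    admissible [X], where [k^2 = 64 r], and a cover needs at least [2^(6 r)]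
    balls. *)

(* The finite set [F] is arbitrary, and its elements need matrix models under a norm cutoff that is
   fixed before [m] and the tolerance, because the supremum over cutoffs stands outside the infimum.
   The representations at hand are controlled only through normalized traces, which gives no hold on
   norms in the reduced C*-algebra. This forces approximants that are bounded in every unitary
   representation, at the price of a factor 2 in the norm. No uniformity in [F] is sought: any
   positive value of [K_2] is turned into infinity.

   Finite averages over signs replace Haar measure. The signs have to be adapted to [U], hence to
   [X], but they amount to O(k) bits against the order of [k^2] bits in [X], so a pigeonhole over
   them is harmless at the scale that matters. The flat matrix [h] is what makes so little
   randomness sufficient.

   The two generators have separate tasks. Once the signs are fixed, the image of [a] no longer
   depends on [X] and serves to pin down the conjugating unitary, while the image of [b] carries
   [X]. A single radius suffices, since [K_2] is a supremum over radii. *)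
From HB Require Import structures.
From mathcomp Require Import all_boot all_order all_algebra spectral finmap.
From mathcomp Require Import complex zify ring lra.
From mathcomp Require Import all_classical all_reals all_analysis.
Require Import Defs.

Set Implicit Arguments.
Unset Strict Implicit.
Unset Printing Implicit Defensive.

Import Order.TTheory GRing.Theory Num.Theory.
Import Normc.

Local Open Scope classical_set_scope.
Local Open Scope ring_scope.
Local Open Scope complex_scope.

(** * Complex matrices *)

Section ComplexNorm.
Context (R : realType).
Local Notation C := R[i].
Implicit Types z w : C.

Lemma normcE2 z : normc z ^+ 2 = complex.Re z ^+ 2 + complex.Im z ^+ 2.
Proof. by case: z => a b /=; rewrite sqr_sqrtr// addr_ge0 ?sqr_ge0. Qed.

Lemma conjc_mul_normc z : z^* * z = (normc z ^+ 2)%:C.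
Proof.
rewrite normcE2; case: z => a b; apply/eqP; rewrite eq_complex /=.
by apply/andP; split; apply/eqP; ring.
Qed.

Lemma normcJ2 z : normc z^* = normc z.
Proof. by case: z => a b /=; rewrite sqrrN. Qed.

Lemma normc_real (x : R) : normc x%:C = `|x|.
Proof. by rewrite /= expr0n addr0 sqrtr_sqr. Qed.

Lemma normc_triangle z w : normc (z + w) <= normc z + normc w.
Proof. exact: le_normcD. Qed.

Lemma normc_sum (I : Type) (s : seq I) (P : pred I) (f : I -> C) :
  normc (\sum_(i <- s | P i) f i) <= \sum_(i <- s | P i) normc (f i).
Proof.
elim/big_rec2: _ => [|i x y _ h]; first by rewrite normc0.
by apply: le_trans (normc_triangle _ _) _; rewrite lerD2l.
Qed.

Lemma normc_prod (I : Type) (s : seq I) (P : pred I) (f : I -> C) :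
  normc (\prod_(i <- s | P i) f i) = \prod_(i <- s | P i) normc (f i).
Proof. by elim/big_rec2: _ => [|i x y _ <-]; rewrite ?normc1 ?normcM. Qed.

Lemma normcX z n : normc (z ^+ n) = normc z ^+ n.
Proof. by elim: n => [|n IH]; rewrite ?expr0 ?normc1// !exprS normcM IH. Qed.

Lemma Re_le_normc z : `|complex.Re z| <= normc z.
Proof.
by rewrite -(@ler_pXn2r _ 2) ?nnegrE ?normc_ge0// normcE2 -normrX ger0_norm
  ?sqr_ge0// lerDl sqr_ge0.
Qed.

Lemma normc_le_ReIm z : normc z <= `|complex.Re z| + `|complex.Im z|.
Proof.
rewrite -(@ler_pXn2r _ 2) ?nnegrE ?normc_ge0 ?addr_ge0// normcE2 sqrrD.
rewrite !real_normK ?num_real//.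
have := mulr_ge0 (normr_ge0 (complex.Re z)) (normr_ge0 (complex.Im z)).
by rewrite mulr2n; lra.
Qed.

Lemma ReD z w : complex.Re (z + w) = complex.Re z + complex.Re w.
Proof. by case: z w => ? ? [? ?]. Qed.
Lemma ImD z w : complex.Im (z + w) = complex.Im z + complex.Im w.
Proof. by case: z w => ? ? [? ?]. Qed.
Lemma ReN z : complex.Re (- z) = - complex.Re z.
Proof. by case: z => ? ?. Qed.
Lemma ImN z : complex.Im (- z) = - complex.Im z.
Proof. by case: z => ? ?. Qed.
Lemma Re_sum (I : Type) (s : seq I) (P : pred I) (f : I -> C) :
  complex.Re (\sum_(i <- s | P i) f i) = \sum_(i <- s | P i) complex.Re (f i).
Proof. by elim/big_rec2: _ => [//|i x y _ <-]; rewrite ReD. Qed.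
Lemma Im_sum (I : Type) (s : seq I) (P : pred I) (f : I -> C) :
  complex.Im (\sum_(i <- s | P i) f i) = \sum_(i <- s | P i) complex.Im (f i).
Proof. by elim/big_rec2: _ => [//|i x y _ <-]; rewrite ImD. Qed.
Lemma ReZ (x : R) z : complex.Re (x%:C * z) = x * complex.Re z.
Proof. by case: z => a b /=; ring. Qed.
Lemma ImZ (x : R) z : complex.Im (x%:C * z) = x * complex.Im z.
Proof. by case: z => a b /=; ring. Qed.

Lemma natrC (n : nat) : n%:R = (n%:R : R)%:C :> C.
Proof. by rewrite rmorph_nat. Qed.

End ComplexNorm.

(** * The Frobenius norm, and operator norm bounds expressed through it *)

Section Frobenius.
Context (R : realType).
Local Notation C := R[i].
Local Open Scope sesquilinear_scope.

Lemma tmulmx m n p (A : 'M[C]_(m, n)) (B : 'M[C]_(n, p)) :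
  (A *m B)^t* = B^t* *m A^t*.
Proof. by rewrite trmx_mul map_mxM. Qed.

Lemma taddmx m n (A B : 'M[C]_(m, n)) : (A + B)^t* = A^t* + B^t*.
Proof. by rewrite linearD map_mxD. Qed.

Lemma toppmx m n (A : 'M[C]_(m, n)) : (- A)^t* = - A^t*.
Proof. by rewrite linearN map_mxN. Qed.

Lemma tscalemx m n (z : C) (A : 'M[C]_(m, n)) : (z *: A)^t* = z^* *: A^t*.
Proof. by rewrite linearZ map_mxZ. Qed.

Lemma tmxE m n (A : 'M[C]_(m, n)) i j : A^t* i j = (A j i)^*.
Proof. by rewrite !mxE. Qed.

Lemma unitary_left n (U : 'M[C]_n) : U \is unitarymx -> U *m U^t* = 1%:M.
Proof. by move/unitarymxP. Qed.

Lemma unitary_right n (U : 'M[C]_n) : U \is unitarymx -> U^t* *m U = 1%:M.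
Proof. by rewrite -trmxC_unitary => /unitarymxP; rewrite trmxCK. Qed.

Lemma unitary1 n : (1%:M : 'M[C]_n) \is unitarymx.
Proof. by apply/unitarymxP; rewrite mul1mx trmx1 map_mx1. Qed.

Definition frob2 m n (A : 'M[C]_(m, n)) : R := \sum_i \sum_j normc (A i j) ^+ 2.

Lemma frob2_ge0 m n (A : 'M[C]_(m, n)) : 0 <= frob2 A.
Proof. by apply: sumr_ge0 => i _; apply: sumr_ge0 => j _; rewrite sqr_ge0. Qed.

Lemma frob2E m n (A : 'M[C]_(m, n)) : \tr (A^t* *m A) = (frob2 A)%:C.
Proof.
rewrite /frob2 exchange_big /mxtrace rmorph_sum; apply: eq_bigr => j _.
rewrite mxE rmorph_sum; apply: eq_bigr => i _.
by rewrite tmxE conjc_mul_normc.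
Qed.

Lemma frob2_tr m n (A : 'M[C]_(m, n)) : frob2 (A^t*) = frob2 A.
Proof.
rewrite /frob2 exchange_big; apply: eq_bigr => i _; apply: eq_bigr => j _.
by rewrite tmxE normcJ2.
Qed.

Lemma frob2_unitaryl m n (U : 'M[C]_m) (A : 'M[C]_(m, n)) :
  U \is unitarymx -> frob2 (U *m A) = frob2 A.
Proof.
move=> uU; apply: complexI; rewrite -!frob2E tmulmx mulmxA -(mulmxA _ _ U).
by rewrite (unitary_right uU) mulmx1.
Qed.

Lemma frob2_unitaryr m n (U : 'M[C]_n) (A : 'M[C]_(m, n)) :
  U \is unitarymx -> frob2 (A *m U) = frob2 A.
Proof.
rewrite -trmxC_unitary => uU.
by rewrite -frob2_tr tmulmx (frob2_unitaryl _ uU) frob2_tr.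
Qed.

Lemma frob2N m n (A : 'M[C]_(m, n)) : frob2 (- A) = frob2 A.
Proof.
by apply: eq_bigr => i _; apply: eq_bigr => j _; rewrite mxE normcN.
Qed.

Lemma frob2Z m n (z : C) (A : 'M[C]_(m, n)) :
  frob2 (z *: A) = normc z ^+ 2 * frob2 A.
Proof.
rewrite /frob2 mulr_sumr; apply: eq_bigr => i _.
by rewrite mulr_sumr; apply: eq_bigr => j _; rewrite mxE normcM exprMn.
Qed.

Lemma frob2D m n (A B : 'M[C]_(m, n)) :
  frob2 (A + B) <= 2 * frob2 A + 2 * frob2 B.
Proof.
rewrite /frob2 !mulr_sumr -big_split /=; apply: ler_sum => i _.
rewrite !mulr_sumr -big_split /=; apply: ler_sum => j _.
by rewrite mxE normcDsq.
Qed.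

Lemma frob2_col m n (A : 'M[C]_(m, n)) : frob2 A = \sum_j frob2 (col j A).
Proof.
rewrite /frob2 exchange_big; apply: eq_bigr => j _; apply: eq_bigr => i _.
by rewrite big_ord1 mxE.
Qed.

Lemma frob2_eq0 m n (A : 'M[C]_(m, n)) : frob2 A = 0 -> A = 0.
Proof.
move/eqP; rewrite psumr_eq0; last by move=> i _; apply: sumr_ge0 => j _; exact: sqr_ge0.
move/allP => h; apply/matrixP => i j; rewrite mxE.
have := h i (mem_index_enum _); rewrite psumr_eq0; last by move=> ? _; exact: sqr_ge0.
by move/allP/(_ j (mem_index_enum _)); rewrite /= expf_eq0 /= => /eqP/eq0_normc.
Qed.

Lemma frob2_unitary k (U : 'M[C]_k) : U \is unitarymx -> frob2 U = k%:R.
Proof.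
by move=> uU; apply: complexI; rewrite -frob2E unitary_right// mxtrace1 natrC.
Qed.

(** Both sides are the quadratic form of the Gram matrix at [w]. This allows a matrix to be traded
    for the positive square root of its Gram matrix, in place of a polar decomposition. *)
Lemma frob2_gram m n p (Y : 'M[C]_(m, n)) (Z : 'M[C]_(m, p)) q (w : 'M[C]_(m, q)) :
  Y *m Y^t* = Z *m Z^t* -> frob2 (Y^t* *m w) = frob2 (Z^t* *m w).
Proof.
move=> e; have E r (A : 'M[C]_(m, r)) :
    (A^t* *m w)^t* *m (A^t* *m w) = w^t* *m (A *m A^t*) *m w.
  by rewrite tmulmx trmxCK !mulmxA.
by apply: complexI; rewrite -(frob2E (Y^t* *m w)) -(frob2E (Z^t* *m w)) !E e.
Qed.

(** [K] bounds the square of the operator norm of [A]. *)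
Definition nbound m n (A : 'M[C]_(m, n)) (K : R) :=
  forall v : 'cV_n, frob2 (A *m v) <= K * frob2 v.

Lemma nbound_mul m n p (A : 'M[C]_(m, n)) K (B : 'M[C]_(n, p)) :
  nbound A K -> frob2 (A *m B) <= K * frob2 B.
Proof.
move=> h; rewrite !(frob2_col (n := p)) mulr_sumr; apply: ler_sum => j _.
by rewrite colE -mulmxA -colE; exact: h.
Qed.

Lemma mxtraceN n (A : 'M[C]_n) : \tr (- A) = - \tr A.
Proof. by rewrite /mxtrace -sumrN; apply: eq_bigr => i _; rewrite mxE. Qed.

Lemma frob2_inner m n (A B : 'M[C]_(m, n)) :
  frob2 (A - B) = frob2 A + frob2 B - 2 * complex.Re (\tr (A^t* *m B)).
Proof.
apply: complexI; rewrite -frob2E taddmx toppmx mulmxDl !mulmxDr.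
rewrite !mxtraceD mulmxN mulNmx mulmxN mulNmx opprK !mxtraceN !frob2E.
have -> : \tr (B^t* *m A) = (\tr (A^t* *m B))^*.
  by rewrite -[B^t* *m A]trmxCK tmulmx trmxCK trace_map_mx mxtrace_tr.
rewrite rmorphB rmorphD; case: (\tr _) => a b; apply/eqP.
by rewrite eq_complex /=; apply/andP; split; apply/eqP; ring.
Qed.

(** Put [w = A A^* v] and [a = ||A^* v||^2]. Expanding [||w - K v||^2 >= 0] gives
    [2 K a <= ||w||^2 + K^2 ||v||^2], and [||w||^2 <= K a] by hypothesis. The final division by [K]
    forces the separate case [K = 0]. *)
Lemma nbound_adj m n (A : 'M[C]_(m, n)) K : 0 <= K ->
  nbound A K -> nbound (A^t*) K.
Proof.
move=> K0 h v.
have e : \tr ((A *m (A^t* *m v))^t* *m v) = (frob2 (A^t* *m v))%:C.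
  by rewrite -frob2E !tmulmx trmxCK !mulmxA.
have := h (A^t* *m v); set a := frob2 (A^t* *m v); set w := A *m _ => hw.
have [K1|K1] := eqVneq K 0.
  have w0 : w = 0.
    apply: frob2_eq0; apply/eqP; rewrite eq_le frob2_ge0 andbT.
    by move: hw; rewrite K1 mul0r.
  by rewrite -lecR -e -/w w0 trmx0 map_mx0 mul0mx mxtrace0 K1 mul0r.
have Kp : 0 < K by rewrite lt_neqAle eq_sym K1.
have := frob2_ge0 (w - K%:C *: v).
rewrite frob2_inner frob2Z normc_real -scalemxAr mxtraceZ e -/a.
rewrite ger0_norm// ReZ /= => h2.
have : K * a <= K * (K * frob2 v) by have := frob2_ge0 v; nra.
by rewrite ler_pM2l.
Qed.

Lemma opnorm_le k (A : 'M[C]_k) r : 0 <= r -> nbound A (r ^+ 2) ->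
  (opnorm A <= r%:E)%E.
Proof.
have vE (v : 'cV[C]_k) : vnorm v = Num.sqrt (frob2 v).
  by congr Num.sqrt; apply: eq_bigr => i _; rewrite big_ord1.
move=> r0 h; apply: ge_ereal_sup => _ [v /= v1 <-]; rewrite lee_fin vE.
rewrite -[r]ger0_norm// -sqrtr_sqr ler_wsqrtr//; apply: le_trans (h v) _.
rewrite ler_piMr ?sqr_ge0//; move: v1; rewrite vE => v1.
by rewrite -(sqr_sqrtr (frob2_ge0 v)) expr_le1// sqrtr_ge0.
Qed.

Lemma ntr_frob2 k (A : 'M[C]_k) : ntr (A^t* *m A) = (frob2 A / k%:R)%:C.
Proof. by rewrite /ntr frob2E mulrC rmorphM fmorphV natrC. Qed.

End Frobenius.

(** * Unitary diagonalization as a functional calculus *)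

Section Spectral.
Context (R : realType).
Local Notation C := R[i].
Local Open Scope sesquilinear_scope.

(** The matrix with eigenvalues [h] in the basis formed by the columns of [P^*]. For a fixed unitary
    [P] it is a *-homomorphism in [h], which turns matrix identities and norm bounds into statements
    about numbers. *)
Definition dmx k (P : 'M[C]_k) (h : 'I_k -> C) : 'M[C]_k :=
  P^t* *m diag_mx (\row_i h i) *m P.

Lemma diag_mul k (h g : 'I_k -> C) :
  diag_mx (\row_i h i) *m diag_mx (\row_i g i) = diag_mx (\row_i (h i * g i)).
Proof.
by rewrite mulmx_diag; congr diag_mx; apply/rowP => i; rewrite !mxE.
Qed.

Lemma dmxM k (P : 'M[C]_k) h g : P \is unitarymx ->
  dmx P h *m dmx P g = dmx P (fun i => h i * g i).
Proof.
move=> uP; rewrite /dmx -diag_mul !mulmxA -(mulmxA _ P) (unitary_left uP).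
by rewrite mulmx1.
Qed.

Lemma dmx1 k (P : 'M[C]_k) : P \is unitarymx -> dmx P (fun=> 1) = 1%:M.
Proof.
move=> uP; rewrite /dmx (_ : diag_mx _ = 1%:M) ?mulmx1 ?unitary_right//.
by apply/matrixP => i j; rewrite !mxE.
Qed.

Lemma eq_dmx k (P : 'M[C]_k) h g : h =1 g -> dmx P h = dmx P g.
Proof. by move=> /funext ->. Qed.

Lemma dmxD k (P : 'M[C]_k) h g :
  dmx P h + dmx P g = dmx P (fun i => h i + g i).
Proof.
rewrite /dmx -mulmxDl -mulmxDr; have <- // : diag_mx (\row_i h i)
  + diag_mx (\row_i g i) = diag_mx (\row_i (h i + g i)).
by apply/matrixP => i j; rewrite !mxE mulrnDl.
Qed.

Lemma dmxZ k (P : 'M[C]_k) (z : C) h :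
  z *: dmx P h = dmx P (fun i => z * h i).
Proof.
rewrite /dmx scalemxAl scalemxAr; have <- // : z *: diag_mx (\row_i h i)
   = diag_mx (\row_i (z * h i)).
by apply/matrixP => i j; rewrite !mxE mulrnAr.
Qed.

Lemma iter_dmx k (P : 'M[C]_k) h n : P \is unitarymx ->
  iter n (mulmx (dmx P h)) 1%:M = dmx P (fun i => h i ^+ n).
Proof.
move=> uP; elim: n => [|n IH]; first by rewrite -(dmx1 uP); exact: eq_dmx.
by rewrite iterS IH (dmxM _ _ uP); apply: eq_dmx => i; rewrite exprS.
Qed.

Lemma dmx_tr k (P : 'M[C]_k) h : (dmx P h)^t* = dmx P (fun i => (h i)^*).
Proof.
rewrite /dmx !tmulmx trmxCK mulmxA; have -> // : (diag_mx (\row_i h i))^t*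
   = diag_mx (\row_i (h i)^*).
apply/matrixP => i j; rewrite tmxE !mxE rmorphMn /= [j == i]eq_sym.
by have [->|] := eqVneq i j.
Qed.

Lemma dmx_unitary k (P : 'M[C]_k) h : P \is unitarymx ->
  (forall i, normc (h i) = 1) -> dmx P h \is unitarymx.
Proof.
move=> uP h1; apply/unitarymxP; rewrite dmx_tr dmxM// -[RHS](dmx1 uP).
by apply: eq_dmx => i; rewrite mulrC conjc_mul_normc h1 expr1n.
Qed.

Lemma frob2_diag_mul k n (h : 'I_k -> C) (A : 'M[C]_(k, n)) :
  frob2 (diag_mx (\row_i h i) *m A) =
  \sum_i normc (h i) ^+ 2 * \sum_j normc (A i j) ^+ 2.
Proof.
apply: eq_bigr => i _; rewrite mulr_sumr; apply: eq_bigr => j _.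
by rewrite mul_diag_mx !mxE normcM exprMn.
Qed.

Lemma nbound_dmx k (P : 'M[C]_k) h K : P \is unitarymx ->
  (forall i, normc (h i) ^+ 2 <= K) -> nbound (dmx P h) K.
Proof.
move=> uP hK v; rewrite /dmx -!mulmxA frob2_unitaryl ?trmxC_unitary//.
rewrite frob2_diag_mul -(frob2_unitaryl v uP) mulr_sumr.
by apply: ler_sum => i _; rewrite ler_wpM2r// sumr_ge0// => j _; rewrite sqr_ge0.
Qed.

Lemma frob2_dmx k (P : 'M[C]_k) h : P \is unitarymx ->
  frob2 (dmx P h) = \sum_i normc (h i) ^+ 2.
Proof.
move=> uP; rewrite /dmx frob2_unitaryr// frob2_unitaryl ?trmxC_unitary//.
apply: eq_bigr => i _; rewrite (bigD1 i)//= !mxE eqxx mulr1n big1 ?addr0//.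
by move=> j ji; rewrite !mxE eq_sym (negPf ji) mulr0n normc0 expr0n.
Qed.

Lemma normal_dmx k (A : 'M[C]_k) : A *m A^t* = A^t* *m A ->
  exists2 P : 'M[C]_k, P \is unitarymx & exists h, A = dmx P h.
Proof.
move=> /normalmxP /orthomx_spectralP; set P := spectralmx A => e.
exists P; first exact: spectral_unitarymx.
exists (fun i => spectral_diag A 0 i); rewrite /dmx.
have -> : \row_i spectral_diag A 0 i = spectral_diag A by apply/rowP => i; rewrite mxE.
by rewrite -invmx_unitary; [exact: e | exact: spectral_unitarymx].
Qed.

Lemma diag_dmx k (P : 'M[C]_k) h : P \is unitarymx ->
  P *m dmx P h *m P^t* = diag_mx (\row_i h i).
Proof.
move=> uP; rewrite /dmx !mulmxA (unitary_left uP) mul1mx -mulmxA.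
by rewrite (unitary_left uP) mulmx1.
Qed.

Lemma dmx_inj k (P : 'M[C]_k) h g : P \is unitarymx ->
  dmx P h = dmx P g -> h =1 g.
Proof.
move=> uP e i; have := diag_dmx h uP; rewrite e diag_dmx//.
by move/matrixP/(_ i i); rewrite !mxE eqxx !mulr1n.
Qed.

Lemma hermitian_dmx k (A : 'M[C]_k) : A^t* = A ->
  exists2 P : 'M[C]_k, P \is unitarymx & exists t : 'I_k -> R,
    A = dmx P (fun i => (t i)%:C).
Proof.
move=> hA; have [|P uP [h e]] := @normal_dmx k A; first by rewrite hA.
exists P => //; exists (fun i => complex.Re (h i)); rewrite e; apply: eq_dmx => i.
have : dmx P (fun i => (h i)^*) = dmx P h by rewrite -dmx_tr -e.
move/(dmx_inj uP)/(_ i); case: (h i) => a b [] /eqP.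
by rewrite eq_sym -addr_eq0 -mulr2n mulrn_eq0 /= => /eqP ->.
Qed.

Lemma gram_dmx k (Y : 'M[C]_k) K : nbound (Y^t*) K ->
  exists2 P : 'M[C]_k, P \is unitarymx & exists2 t : 'I_k -> R,
    forall i, 0 <= t i <= K & Y *m Y^t* = dmx P (fun i => (t i)%:C).
Proof.
move=> hY; have [|P uP [t e]] := @hermitian_dmx k (Y *m Y^t*).
  by rewrite tmulmx trmxCK.
exists P => //; exists t => // i.
(* An eigenvalue of [Y Y^*] equals [||Y^* v||^2] for its unit eigenvector [v], hence lies in
   [[0, K]]. *)
pose v : 'cV[C]_k := P^t* *m delta_mx i 0.
have v1 : frob2 v = 1.
  rewrite frob2_unitaryl ?trmxC_unitary// /frob2 (bigD1 i)//= big_ord1 !mxE !eqxx.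
  rewrite normc1 expr1n big1 ?addr0// => j ji.
  by rewrite big_ord1 !mxE (negPf ji) normc0 expr0n.
have : frob2 (Y^t* *m v) = t i.
  apply: complexI; rewrite -frob2E tmulmx trmxCK mulmxA -(mulmxA _ Y) e.
  rewrite /dmx /v tmulmx trmxCK !mulmxA -(mulmxA _ P) (unitary_left uP) mulmx1.
  rewrite -(mulmxA _ P) (unitary_left uP) mulmx1.
  rewrite /mxtrace big_ord1 mxE (bigD1 i)//= big1 ?addr0.
    by rewrite mul_mx_diag !mxE !eqxx rmorph1 mul1r mulr1.
  by move=> j ji; rewrite [X in _ * X]mxE (negPf ji) mulr0.
move=> <-; rewrite frob2_ge0 /=.
by have := hY v; rewrite v1 mulr1.
Qed.

End Spectral.

(** * Flat matrices and delocalization *)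

Section Averaging.
Context (R : realType).

Lemma eq_ler (x y : R) : x = y -> x <= y.
Proof. by move=> ->. Qed.

Lemma exists_le_average (T : finType) (f : T -> R) (M : R) :
  (0 < #|T|)%N -> \sum_e f e <= #|T|%:R * M -> exists e, f e <= M.
Proof.
move=> T0 h; apply/existsP; apply: contraT; rewrite negb_exists => /forallP hM.
move: h; rewrite leNgt -[X in _ < X]/(\sum_e f e); case/negP.
have /card_gt0P[e0 _] := T0.
have -> : #|T|%:R * M = \sum_(e : T) M by rewrite sumr_const mulr_natl.
rewrite (bigD1 e0)//= [X in _ < X](bigD1 e0)//= ltr_leD ?ltNge ?hM//.
by apply: ler_sum => e _; rewrite ltW// ltNge hM.
Qed.

Lemma prod_sum_signs (T : finType) (g : T -> bool -> R) :
  \sum_(e : {ffun T -> bool}) \prod_a g a (e a) =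
  \prod_a (g a true + g a false).
Proof.
rewrite -bigA_distr_bigA; apply: eq_bigr => a _.
by rewrite big_bool.
Qed.

(** A weak form of [cosh x <= exp (x^2 / 2)] obtained from [1 + y <= exp y] alone: it yields
    [exp y <= 1 / (1 - y)], the two bounds add up to [2 / (1 - x^2)], and [x^2 <= 1/4] finishes. *)
Lemma expR_pm (x : R) : `|x| <= 2^-1 -> expR x + expR (- x) <= 2 * expR (2 * x ^+ 2).
Proof.
move=> hx.
have hx2 : x ^+ 2 <= 4^-1.
  rewrite -real_normK ?num_real//; have := normr_ge0 x; nra.
move: hx; rewrite ler_norml => /andP[h1 h2].
have aux (y : R) : 0 < 1 - y -> expR y <= (1 - y)^-1.
  move=> y0; rewrite -[expR y]invrK lef_pV2 ?posrE ?invr_gt0 ?expR_gt0//.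
  by rewrite -expRN; exact: expR_ge1Dx.
have p1 : 0 < 1 - x by lra.
have p2 : 0 < 1 - - x by lra.
have e1 := aux _ p1; have e2 := aux _ p2.
have e3 := expR_ge1Dx (2 * x ^+ 2).
apply: (@le_trans _ _ ((1 - x)^-1 + (1 - - x)^-1)); first exact: lerD.
have -> : (1 - x)^-1 + (1 - - x)^-1 = 2 / (1 - x ^+ 2).
  by field; rewrite !gt_eqF//; nra.
rewrite ler_pdivrMr; last nra.
have := sqr_ge0 x; nra.
Qed.

Lemma expR_ge_X (y : R) n : 0 <= y -> (y / n.+1%:R) ^+ n.+1 <= expR y.
Proof.
move=> y0; have -> : expR y = expR (y / n.+1%:R) ^+ n.+1.
  by rewrite -expRM_natr -mulrA mulVf ?mulr1// pnatr_eq0.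
apply: lerXn2r; rewrite ?nnegrE ?divr_ge0 ?expR_ge0//.
by apply: le_trans (expR_ge1Dx _); rewrite lerDr.
Qed.

(** A Chernoff bound with the union bound built in: averaging the sum over [i] of
    [exp (t X_i) + exp (- t X_i)] treats all [i] and both signs at once. The value [t = sqrt k / 2]
    is the largest for which the hypothesis guarantees [|t * c i a| <= 1/2], as [expR_pm] requires.
    A bound with a logarithm, rather than its square root, is good enough later. *)
Lemma sqrt_sum_sign_bound k (I : finType) (c : I -> 'I_k -> R) :
  (0 < k)%N -> (0 < #|I|)%N ->
  (forall i, \sum_a c i a ^+ 2 <= k%:R^-1) ->
  exists e : {ffun 'I_k -> bool}, forall i,
    `|\sum_a (-1) ^+ e a * c i a| <= (2 * ln (2 * #|I|%:R) + 1) / Num.sqrt k%:R.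
Proof.
move=> k0 I0 hc; have k0R : 0 < k%:R :> R by rewrite ltr0n.
set q := Num.sqrt k%:R; have q0 : 0 < q by rewrite sqrtr_gt0.
have q2 : q ^+ 2 = k%:R by rewrite sqr_sqrtr// ltW.
pose t := q / 2; have t0 : 0 < t by rewrite divr_gt0.
pose X i (e : {ffun 'I_k -> bool}) := \sum_a (-1) ^+ e a * c i a.
have ca i a : `|t * c i a| <= 2^-1.
  have h : c i a ^+ 2 <= k%:R^-1.
    apply: le_trans (hc i); rewrite (bigD1 a)//= lerDl sumr_ge0// => ? _.
    exact: sqr_ge0.
  rewrite normrM gtr0_norm// /t mulrAC ler_pdivrMr// mulVf//.
  rewrite -(@ler_pXn2r _ 2) ?nnegrE ?mulr_ge0 ?(ltW q0)// exprMn real_normK ?num_real//.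
  by rewrite q2 expr1n -ler_pdivlMl// mulr1.
have E (s : R) i : s ^+ 2 = 1 ->
    \sum_e expR (s * t * X i e) <= 2 ^+ k * expR 2^-1.
  move=> s1.
  rewrite (eq_bigr (fun e : {ffun 'I_k -> bool} =>
    \prod_a (fun a b => expR (s * t * ((-1) ^+ (b : bool) * c i a))) a (e a))); last first.
    by move=> e _; rewrite -expR_sum -mulr_sumr.
  rewrite (prod_sum_signs (fun a (b : bool) => expR (s * t * ((-1) ^+ b * c i a)))).
  have sE : (s == 1) || (s == -1) by rewrite -eqf_sqr expr1n s1.
  apply: (@le_trans _ _ (\prod_(a < k) (2 * expR (2 * (t * c i a) ^+ 2)))).
    apply: ler_prod => a _; rewrite addr_ge0 ?expR_ge0//=.
    apply: le_trans (expR_pm (ca i a)).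
    by case/orP: sE => /eqP ->; rewrite expr0 expr1 ?mul1r !(mulN1r, mulNr, opprK, mulrN) ?mul1r// addrC.
  rewrite big_split /= prodr_const card_ord -expR_sum.
  rewrite ler_wpM2l ?exprn_ge0// ler_expR -mulr_sumr.
  under eq_bigr do rewrite exprMn.
  rewrite -mulr_sumr; apply: (@le_trans _ _ (2 * (t ^+ 2 * k%:R^-1))).
    by rewrite !ler_wpM2l// sqr_ge0.
  by rewrite /t expr_div_n q2; apply: eq_ler; field; rewrite gt_eqF.
have [e he] : exists e, \sum_i (expR (1 * t * X i e) + expR (-1 * t * X i e))
    <= #|I|%:R * (2 * expR 2^-1).
  apply: exists_le_average; first by rewrite card_ffun card_bool card_ord expn_gt0.
  rewrite exchange_big /=; apply: (@le_trans _ _ (\sum_(i : I) (2 ^+ k * (2 * expR 2^-1)))).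
    apply: ler_sum => i _; rewrite big_split /=.
    have := E 1 i (expr1n _ _); have := E (-1) i (etrans (sqrrN 1) (expr1n _ _)).
    lra.
  rewrite sumr_const card_ffun card_bool card_ord natrX -mulr_natl.
  by apply: eq_ler; ring.
exists e => i; rewrite -/(X i e).
have h (s : R) : `|s| = 1 -> s * X i e <= (2 * ln (2 * #|I|%:R) + 1) / q.
  move=> s1; have sE : (s == 1) || (s == -1).
    by rewrite -eqf_sqr expr1n -real_normK ?num_real// s1 expr1n.
  have : expR (s * t * X i e) <= #|I|%:R * (2 * expR 2^-1).
    apply: le_trans he; rewrite (bigD1 i)//=.
    have h0 : 0 <= \sum_(j | j != i) (expR (1 * t * X j e) + expR (-1 * t * X j e)).
      by apply: sumr_ge0 => j _; rewrite addr_ge0 ?expR_ge0.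
    have := expR_ge0 (1 * t * X i e); have := expR_ge0 (-1 * t * X i e).
    by case/orP: sE => /eqP ->; lra.
  have I0R : 0 < #|I|%:R :> R by rewrite ltr0n.
  have -> : #|I|%:R * (2 * expR 2^-1) = expR (ln (2 * #|I|%:R) + 2^-1) :> R.
    by rewrite expRD lnK ?posrE ?mulr_gt0//; ring.
  rewrite ler_expR => h; rewrite ler_pdivlMr//.
  by move: h; rewrite /t; lra.
rewrite ler_norml; have := h 1 (normr1 _); have := h (-1).
by rewrite normrN1 => /(_ erefl); rewrite mulN1r mul1r => h1 ->; rewrite andbT lerNl.
Qed.

End Averaging.

Section Flat.
Context (R : realType).
Local Notation C := R[i].
Local Open Scope sesquilinear_scope.

Definition flat k (h : 'M[R]_k) :=
  h *m h^T = 1%:M /\ forall i j, h i j ^+ 2 = k%:R^-1.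

(** Sylvester's doubling of Hadamard matrices. Divisibility by 4 makes [r = (N / 4)^2] an integer,
    so that [N^2 = 16 r] and the size [k = 2 N] satisfies [k^2 = 64 r]. *)
Lemma exists_flat (n : nat) :
  exists N, [/\ (n < N)%N, (4 %| N)%N & exists h : 'M[R]_(N + N), flat h].
Proof.
have dbl N (h : 'M[R]_N) : flat h -> exists h' : 'M[R]_(N + N), flat h'.
  case=> h1 h2; pose s := (Num.sqrt 2)^-1 : R.
  have s2 : s ^+ 2 = 2^-1 by rewrite exprVn sqr_sqrtr.
  have ss : s * s + s * s = 1 by rewrite -expr2 s2; field.
  exists (block_mx (s *: h) (s *: h) (s *: h) (- (s *: h))); split.
    have eZ : (s *: h)^T = s *: h^T by rewrite linearZ.
    have eN : (- (s *: h))^T = - (s *: h^T) by rewrite linearN linearZ.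
    have e : s *: h *m (s *: h^T) = (s * s) *: 1%:M.
      by rewrite -scalemxAl -scalemxAr h1 scalerA.
    rewrite tr_block_mx mulmx_block eZ eN !mulNmx !mulmxN opprK e subrr.
    by rewrite -scalerDl ss scale1r -scalar_mx_block.
  have e i j : (s * h i j) ^+ 2 = (N + N)%:R^-1.
    by rewrite exprMn s2 h2 addnn -muln2 natrM invfM mulrC.
  move=> i j; rewrite mxE; case: splitP => i' _; rewrite mxE; case: splitP => j' _;
    by rewrite !mxE ?sqrrN.
elim: n => [|n [N [nN N4 [h fh]]]].
  exists 4%N; split=> //.
  have [h1 f1] : exists h : 'M[R]_(1 + 1), flat h.
    apply: (dbl 1%N 1%:M); split; first by rewrite trmx1 mulmx1.
    by move=> i j; rewrite !ord1 mxE eqxx expr1n invr1.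
  by have [h2 f2] := dbl _ _ f1; have [h3 f3] := dbl _ _ f2; exists h3.
exists (N + N)%N; split; [lia | exact: dvdn_add | exact: (dbl _ h)].
Qed.

Definition signmx k (e : 'I_k -> bool) : 'M[C]_k := diag_mx (\row_i (-1) ^+ e i).

Lemma signmx_unitary k (e : 'I_k -> bool) : signmx e \is unitarymx.
Proof.
apply/unitarymxP; apply/matrixP => i j; rewrite /signmx mul_diag_mx mxE tmxE !mxE.
rewrite [j == i]eq_sym; have [->|ij] := eqVneq i j; last by rewrite mulr0n rmorph0 mulr0.
by rewrite mulr1n rmorphXn rmorphN1 /= -exprMn mulrNN mulr1 expr1n.
Qed.

Definition cmx k (h : 'M[R]_k) : 'M[C]_k := map_mx (real_complex R) h.

Lemma cmx_unitary k (h : 'M[R]_k) : h *m h^T = 1%:M -> cmx h \is unitarymx.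
Proof.
move=> hh; apply/unitarymxP.
have -> : (cmx h)^t* = cmx h^T.
  by apply/matrixP => i j; rewrite !mxE; apply: conjc_real.
by rewrite -map_mxM hh map_mx1.
Qed.

(** Twice the numerator in [sqrt_sum_sign_bound] for the [2 k^2] real and imaginary parts of the
    entries; the doubling comes from adding the two parts of an entry. *)
Definition spread k : R := 4 * ln (4 * (k * k)%:R) + 2.

(** The real and imaginary parts of an entry are signed sums whose coefficients are [h x a] times
    the parts of [U a y]. Their squares add up to at most [1 / k], because [h] is flat and the
    columns of [U] are unit vectors. *)
Lemma delocalize k (h : 'M[R]_k) (U : 'M[C]_k) : (0 < k)%N -> flat h ->
  U \is unitarymx ->
  exists e : {ffun 'I_k -> bool}, forall x y,
    normc ((cmx h *m signmx e *m U) x y) <= spread k / Num.sqrt k%:R.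
Proof.
move=> k0 [h1 h2] uU.
pose c (i : 'I_k * 'I_k * bool) (a : 'I_k) : R :=
  h i.1.1 a * (if i.2 then complex.Im (U a i.1.2) else complex.Re (U a i.1.2)).
have kR : 0 < k%:R :> R by rewrite ltr0n.
have colU y : \sum_a normc (U a y) ^+ 2 = 1.
  have := unitary_right uU => /matrixP/(_ y y); rewrite !mxE eqxx mulr1n => e.
  apply: complexI; rewrite rmorph1 -e rmorph_sum; apply: eq_bigr => a _.
  by rewrite tmxE conjc_mul_normc.
have cI (i : 'I_k * 'I_k * bool) : \sum_a c i a ^+ 2 <= k%:R^-1.
  rewrite -[k%:R^-1]mulr1 -{2}(colU i.1.2) mulr_sumr; apply: ler_sum => a _.
  rewrite exprMn h2 ler_wpM2l ?invr_ge0 ?ler0n// normcE2.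
  by case: i.2; rewrite ?lerDl ?lerDr sqr_ge0.
have [|e he] := sqrt_sum_sign_bound k0 _ cI.
  by rewrite !card_prod card_bool card_ord !muln_gt0 k0.
exists e => x y; apply: le_trans (normc_le_ReIm _) _.
have E : (cmx h *m signmx e *m U) x y = \sum_a ((-1) ^+ e a * h x a)%:C * U a y.
  rewrite !mxE; apply: eq_bigr => a _; rewrite mul_mx_diag !mxE; congr (_ * _).
  by rewrite rmorphM mulrC rmorphXn rmorphN1.
have hb b : `|if b then complex.Im ((cmx h *m signmx e *m U) x y)
      else complex.Re ((cmx h *m signmx e *m U) x y)|
    <= (2 * ln (4 * (k * k)%:R) + 1) / Num.sqrt k%:R.
  have := he (x, y, b); rewrite !card_prod card_bool card_ord.
  have -> : 2 * (k * k * 2)%:R = 4 * (k * k)%:R :> R by rewrite natrM; ring.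
  move=> hxy; apply: le_trans hxy; rewrite E; apply: eq_ler; congr `|_|.
  case: b; [rewrite Im_sum | rewrite Re_sum]; apply: eq_bigr => a _;
    by rewrite /c /= ?ImZ ?ReZ; ring.
have := hb true; have := hb false; rewrite /= /spread.
set z := (cmx h *m _ *m U) x y; set w := Num.sqrt _ => h3 h4.
apply: le_trans (lerD h3 h4) _; rewrite -mulrDl ler_wpM2r ?invr_ge0 ?sqrtr_ge0//.
by apply: eq_ler; ring.
Qed.

End Flat.

(** * Moments of words with random signs *)

Section Counting.

Lemma sum_count_mem (T : finType) (s : seq T) :
  (\sum_z count_mem z s = size s)%N.
Proof.
elim: s => [|x s IH] /=; first by rewrite big1.
rewrite big_split /= IH (bigD1 x)//= eqxx big1 ?addn0 ?add1n// => z.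
by rewrite eq_sym => /negPf ->.
Qed.

Lemma size_undup_double (T : finType) (s : seq T) :
  (forall z, count_mem z s != 1)%N -> (2 * size (undup s) <= size s)%N.
Proof.
move=> h; rewrite -(card_uniqP (undup_uniq s)) -sum_count_mem -sum1_card big_mkcond.
rewrite big_distrr; apply: leq_sum => z _ /=; rewrite mem_undup.
case: ifPn => zs; last by rewrite muln0.
have : (0 < count_mem z s)%N by rewrite -has_count has_pred1.
by move: (h z); move: (count_mem z s) => c; lia.
Qed.

Lemma perm_zip_rot1 (S T : eqType) (s : seq S) (t : seq T) :
  size s = size t -> perm_eq (zip (rot 1 s) (rot 1 t)) (zip s t).
Proof.
case: s t => [|x s] [|y t] //= [e].
by rewrite !rot1_cons zip_rcons// perm_rcons.
Qed.

Lemma count_zip_notin (S T : eqType) (s : seq S) (t : seq T) l z :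
  z \notin t -> count_mem (l, z) (zip s t) = 0%N.
Proof.
elim: s t => [|x s IH] [|y t] //=; rewrite inE negb_or => /andP[zy zt].
by rewrite IH// xpair_eqE [y == z]eq_sym (negPf zy) andbF.
Qed.

Lemma count_zip_once (S T : eqType) (s : seq S) (t : seq T) l z x0 :
  size s = size t -> count_mem z t = 1%N ->
  count_mem (l, z) (zip s t) = (nth x0 s (index z t) == l).
Proof.
elim: s t => [|x s IH] [|y t] //= [e].
have [->|yz] := eqVneq y z.
  rewrite add1n => -[/count_memPn zt].
  by rewrite count_zip_notin// addn0 xpair_eqE eqxx andbT.
by rewrite add0n => h; rewrite xpair_eqE (negPf yz) andbF add0n IH.
Qed.

(** Without singletons at most [q] distinct values occur. A tuple is therefore encoded by a list of
    [q] values, padded with [z0], and the position in that list of each of its entries. *)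
Lemma card_no_singleton k q : (0 < q)%N ->
  (#|[pred t : (q + q).-tuple 'I_k | [forall z, count_mem z t != 1%N]]|
    <= k ^ q * q ^ (q + q))%N.
Proof.
move=> q0; pose f (yf : q.-tuple 'I_k * (q + q).-tuple 'I_q) :=
  [tuple tnth yf.1 (tnth yf.2 i) | i < q + q].
have -> : (k ^ q * q ^ (q + q) = #|{: q.-tuple 'I_k * (q + q).-tuple 'I_q}|)%N.
  by rewrite card_prod !card_tuple !card_ord.
apply: leq_trans (leq_image_card f _); apply: subset_leq_card.
apply/fintype.subsetP => t; rewrite inE => /forallP ht.
have st : (size (undup t) <= q)%N.
  rewrite -(@leq_pmul2l 2)//; apply: leq_trans (size_undup_double ht) _.
  by rewrite size_tuple; lia.
have i0 : 'I_(q + q) by exists 0%N; lia.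
pose z0 := tnth t i0.
have sy : size (take q (undup t ++ nseq q z0)) == q.
  by rewrite size_take size_cat size_nseq; case: ltnP; lia.
have hi i : (index (tnth t i) (undup t) < q)%N.
  by apply: leq_trans st; rewrite index_mem mem_undup mem_tnth.
apply/fintype.imageP; exists (Tuple sy, [tuple Ordinal (hi i) | i < q + q]) => //.
apply: eq_from_tnth => i; rewrite [RHS]tnth_mktuple /= [X in tnth (Tuple sy) X]tnth_mktuple.
rewrite [RHS](tnth_nth z0) /=.
by rewrite nth_take// nth_cat index_mem mem_undup mem_tnth nth_index// mem_undup mem_tnth.
Qed.

End Counting.

Section SignProducts.
Context (A : numDomainType) (T : finType).

Definition sign_prod (eps : {ffun T -> bool}) (L : seq T) : A :=
  \prod_(v <- L) (-1) ^+ eps v.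

Lemma sum_signs_odd (L : seq T) v : odd (count_mem v L) ->
  \sum_(eps : {ffun T -> bool}) sign_prod eps L = 0.
Proof.
move=> ov; pose fl (eps : {ffun T -> bool}) :=
  [ffun w => eps w (+) (w == v)].
have flK : involutive fl.
  by move=> e; apply/ffunP => w; rewrite !ffunE -addbA addbb addbF.
have E : \sum_eps sign_prod eps L = - \sum_eps sign_prod eps L.
  rewrite -sumrN [LHS](reindex_inj (inv_inj flK)); apply: eq_bigr => e _.
  rewrite /sign_prod; have -> : \prod_(w <- L) (-1) ^+ fl e w =
      (\prod_(w <- L) (-1) ^+ e w) * (-1) ^+ count_mem v L :> A.
    elim: (L) => [|w L' IH]; rewrite ?big_nil ?expr0 ?mulr1// !big_cons IH /= ffunE.
    rewrite exprD signr_addb; ring.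
  by rewrite -signr_odd ov expr1 mulrN1.
have : (\sum_eps sign_prod eps L) *+ 2 == 0 by rewrite mulr2n {1}E addNr.
by rewrite mulrn_eq0 => /eqP.
Qed.

End SignProducts.

Section Words.
Context (R : realType) (J : finType) (k : nat).
Local Notation C := R[i].
Local Open Scope sesquilinear_scope.
Local Notation letter := (J * bool)%type.
Implicit Types (A : letter -> 'M[C]_k) (s : seq letter) (p : seq 'I_k).

Definition flipl (a : letter) : letter := (a.1, ~~ a.2).

Definition lettermx (U : J -> 'M[C]_k) (a : letter) : 'M[C]_k :=
  if a.2 then (U a.1)^t* else U a.1.

Fixpoint pathwt (A : letter -> 'I_k -> 'I_k -> C) s (i : 'I_k) p : C :=
  match s, p with
  | a :: s', x :: p' => A a i x * pathwt A s' x p'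
  | _, _ => 1
  end.

Lemma mx_word_entry (U : J -> 'M[C]_k) s i j :
  mx_word U s i j = \sum_(p : (size s).-tuple 'I_k)
    pathwt (lettermx U) s i p * (last i p == j)%:R.
Proof.
elim: s i => [|a s IH] i /=.
  rewrite (big_pred1 [tuple]); last first.
    by move=> t /=; apply/esym/eqP; apply: val_inj; case: t => -[].
  by rewrite !mxE mul1r.
rewrite mxE (reindex (fun q : 'I_k * (size s).-tuple 'I_k => cons_tuple q.1 q.2)); last first.
  exists (fun t => (thead t, behead_tuple t)) => [[x t] _|t _] /=.
    by congr (_, _); apply: val_inj.
  by rewrite [RHS]tuple_eta.
rewrite -(pair_bigA _ (fun x (t : (size s).-tuple 'I_k) =>
  lettermx U a i x * pathwt (lettermx U) s x t * (last x t == j)%:R)) /=.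
apply: eq_bigr => x _; rewrite -/(mx_word U s) IH mulr_sumr.
by apply: eq_bigr => t _; rewrite mulrA.
Qed.

Lemma mxtrace_word (U : J -> 'M[C]_k) a s : \tr (mx_word U (a :: s)) =
  \sum_(p : (size s).+1.-tuple 'I_k)
    pathwt (lettermx U) (a :: s) (last (thead p) p) p.
Proof.
rewrite /mxtrace; under eq_bigr do rewrite mx_word_entry.
rewrite exchange_big; apply: eq_bigr => p _.
have e i : last i p = last (thead p) p by case/tupleP: p => x t.
rewrite (bigD1 (last (thead p) p))// e eqxx mulr1 big1; first exact: addr0.
by move=> i ip; rewrite e eq_sym (negPf ip) mulr0.
Qed.

(** The row signs of a letter [a] at [x] are indexed by [(a, x)] and its column signs by
    [(flipl a, x)]; taking adjoints exchanges the two, so one rule serves both exponents. *)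
Fixpoint signvars s (i : 'I_k) p : seq (letter * 'I_k) :=
  match s, p with
  | a :: s', x :: p' => (a, i) :: (flipl a, x) :: signvars s' x p'
  | _, _ => [::]
  end.

Local Notation signs := (@sign_prod C (letter * 'I_k)%type).

Lemma pathwt_signs (eps : {ffun letter * 'I_k -> bool}) (A B : letter -> 'I_k -> 'I_k -> C) s i p :
  (forall a x y, A a x y = (-1) ^+ eps (a, x) * B a x y * (-1) ^+ eps (flipl a, y)) ->
  pathwt A s i p = pathwt B s i p * signs eps (signvars s i p).
Proof.
move=> h; elim: s i p => [|a s IH] i [|x p] /=; rewrite ?/sign_prod ?big_nil ?mulr1//.
by rewrite !big_cons h IH /sign_prod; ring.
Qed.

Lemma pathwt_le (B : letter -> 'I_k -> 'I_k -> C) (eta : R) s i p : 0 <= eta ->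
  (forall a x y, normc (B a x y) <= eta) -> size p = size s ->
  normc (pathwt B s i p) <= eta ^+ size s.
Proof.
move=> e0 h; elim: s i p => [|a s IH] i [|x p] //.
  by move=> _; rewrite expr0 -[X in X <= _]/(normc (1 : C)) normc1.
by move=> [sp]; rewrite [pathwt _ _ _ _]/= normcM exprS ler_pM ?normc_ge0 ?IH.
Qed.

Lemma signvars_perm s i p : size p = size s ->
  perm_eq (signvars s i p) (zip s (belast i p) ++ zip (map flipl s) p).
Proof.
elim: s i p => [|a s IH] i [|x p] //= [e].
rewrite perm_cons; apply/permP => z /=; move/permP: (IH x p e) => ->.
by rewrite !count_cat /=; lia.
Qed.

(** The sign variables regrouped by the vertices of the closed path: a vertex carries the column
    sign of the letter entering it and the row sign of the letter leaving it, which is the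
    cyclically next one. *)
Lemma signvars_cycle s p x0 : size p = size s ->
  perm_eq (signvars s (last x0 p) p) (zip (rot 1 s) p ++ zip (map flipl s) p).
Proof.
move=> e; apply: (perm_trans (signvars_perm _ e)); rewrite perm_cat2r.
case: p e => [|x p] e; first by case: s e.
have b : size (belast (last x p) (x :: p)) = size s by rewrite size_belast.
have e1 : x :: p = rot 1 (belast (last x p) (x :: p)).
  by rewrite /= rot1_cons -lastI.
by rewrite [X in zip (rot 1 s) X]e1 perm_sym perm_zip_rot1// b.
Qed.

Lemma normc_signs eps L : normc (signs eps L) = 1.
Proof.
rewrite /sign_prod normc_prod big1// => v _.
by rewrite normcX normcN normc1 expr1n.
Qed.

Definition cycred s := all (fun t => t.1 != t.2) (zip (rot 1 s) (map flipl s)).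

(** A vertex visited exactly once carries two sign variables, and these differ because no letter is
    followed cyclically by its inverse. So one of them occurs an odd number of times and the average
    vanishes. *)
Lemma sum_signs_cycles s p p' x0 x0' z : cycred s -> size p = size s -> size p' = size s ->
  count_mem z (p ++ p') = 1%N ->
  \sum_(eps : {ffun letter * 'I_k -> bool})
    signs eps (signvars s (last x0 p) p ++ signvars s (last x0' p') p') = 0.
Proof.
move=> cs sp sp'; rewrite count_cat => cz.
have key q r y0 y0' : size q = size s -> size r = size s ->
    count_mem z q = 1%N -> count_mem z r = 0%N ->
    exists v, odd (count_mem v (signvars s (last y0 q) q ++ signvars s (last y0' r) r)).
  move=> sq sr cq cr; pose t := index z q.
  have zq : z \in q by rewrite -has_pred1 has_count cq.
  have ts : (t < size s)%N by rewrite -sq index_mem.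
  have a0 : letter by case: (s) ts.
  have rs : size (rot 1 s) = size q by rewrite size_rot.
  have fs : size (map flipl s) = size q by rewrite size_map.
  exists (nth a0 (map flipl s) t, z); rewrite count_cat.
  rewrite (permP (signvars_cycle _ sq)) (permP (signvars_cycle _ sr)) !count_cat.
  rewrite !(@count_zip_notin _ _ _ r) ?(introT count_memPn)//.
  rewrite !(count_zip_once _ a0)// eqxx.
  have -> // : (nth a0 (rot 1 s) t == nth a0 (map flipl s) t) = false.
  apply/negbTE; move/all_nthP: cs => /(_ (a0, a0) t).
  by rewrite size_zip size_rot size_map minnn nth_zip ?size_rot ?size_map//; apply.
have [c1|c1] : count_mem z p = 1%N /\ count_mem z p' = 0%N \/
   count_mem z p' = 1%N /\ count_mem z p = 0%N by lia.
  by have [v /(sum_signs_odd C)] := key p p' x0 x0' sp sp' c1.1 c1.2.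
have [v ov] := key p' p x0' x0 sp' sp c1.1 c1.2.
by apply: (@sum_signs_odd C _ _ v); rewrite count_cat addnC -count_cat.
Qed.

Definition signed_family (V : J -> 'M[C]_k) (eps : {ffun letter * 'I_k -> bool}) (j : J) :
    'M[C]_k :=
  \matrix_(x, y) ((-1) ^+ eps ((j, false), x) * V j x y * (-1) ^+ eps ((j, true), y)).

Lemma lettermx_signed V eps a x y :
  lettermx (signed_family V eps) a x y =
  (-1) ^+ eps (a, x) * lettermx V a x y * (-1) ^+ eps (flipl a, y).
Proof.
case: a => j []; rewrite /lettermx /flipl /=; last by rewrite !mxE.
by rewrite !tmxE mxE !rmorphM /= !rmorphXn !rmorphN1; ring.
Qed.

(** The square is a sum over pairs of closed paths of length [q]. Averaging kills every pair with a
    vertex visited once; of the [k^(2 q)] pairs this leaves order [k^q], each of weight at most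
    [eta^(2 q)]. For [eta] of order [log k / sqrt k] the powers of [k] cancel, which leaves a
    polylogarithmic bound on a quantity that could be as large as [k^2]. *)
Lemma word_second_moment (V : J -> 'M[C]_k) (eta : R) s :
  0 <= eta -> (forall j x y, normc (V j x y) <= eta) ->
  (0 < size s)%N -> cycred s ->
  \sum_(eps : {ffun letter * 'I_k -> bool})
     normc (\tr (mx_word (signed_family V eps) s)) ^+ 2 <=
  #|{ffun letter * 'I_k -> bool}|%:R *
    ((k ^ size s * size s ^ (size s + size s))%:R * eta ^+ (size s + size s)).
Proof.
case: s => // a s' e0 hV _; set s := a :: s' => cs; set q := size s.
have hVl b x y : normc (lettermx V b x y) <= eta.
  by case: b => j []; rewrite /lettermx /= ?tmxE ?normcJ2.
pose lst (p : q.-tuple 'I_k) := last (thead p) p.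
pose W (p : q.-tuple 'I_k) := pathwt (lettermx V) s (lst p) p.
pose L (p : q.-tuple 'I_k) := signvars s (lst p) p.
have TE eps : \tr (mx_word (signed_family V eps) s) = \sum_p W p * signs eps (L p).
  rewrite mxtrace_word; apply: eq_bigr => p _.
  by apply: pathwt_signs; exact: lettermx_signed.
have sc eps M : (signs eps M : C)^* = signs eps M.
  by rewrite /sign_prod rmorph_prod; apply: eq_bigr => v _; rewrite rmorphXn rmorphN1.
have E : (\sum_(eps : {ffun letter * 'I_k -> bool})
     normc (\tr (mx_word (signed_family V eps) s)) ^+ 2)%:C =
  \sum_(pp : q.-tuple 'I_k * q.-tuple 'I_k) (W pp.1)^* * W pp.2 *
    \sum_(eps : {ffun letter * 'I_k -> bool}) signs eps (L pp.1 ++ L pp.2).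
  transitivity (\sum_(eps : {ffun letter * 'I_k -> bool})
     (\sum_p (W p)^* * signs eps (L p)) * \sum_p W p * signs eps (L p)).
    rewrite rmorph_sum; apply: eq_bigr => eps _.
    apply: etrans (esym (conjc_mul_normc _)) _; rewrite TE; congr (_ * _).
    by rewrite rmorph_sum; apply: eq_bigr => p _; rewrite rmorphM [X in _ * X]sc.
  under eq_bigr do rewrite big_distrlr /=.
  under [RHS]eq_bigr do rewrite mulr_sumr.
  rewrite [RHS]exchange_big; apply: eq_bigr => eps _.
  rewrite -(pair_bigA _ (fun p p' : q.-tuple 'I_k =>
     (W p)^* * W p' * signs eps (L p ++ L p'))) /=.
  apply: eq_bigr => p _; apply: eq_bigr => p' _.
  by rewrite /sign_prod big_cat /=; ring.
have := congr1 (@normc R) E; rewrite normc_real ger0_norm; last first.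
  by apply: sumr_ge0 => eps _; rewrite sqr_ge0.
move=> ->; apply: le_trans (normc_sum _ _ _) _.
pose good (t : (q + q).-tuple 'I_k) := [forall z, count_mem z t != 1%N].
pose N := #|{ffun letter * 'I_k -> bool}|.
apply: (@le_trans _ _ (\sum_(pp : q.-tuple 'I_k * q.-tuple 'I_k | good (cat_tuple pp.1 pp.2))
    eta ^+ (q + q) * N%:R)).
  rewrite [leRHS]big_mkcond; apply: ler_sum => -[p p'] _ /=.
  rewrite !normcM normcJ2; case: ifPn => [_|/forallPn[z]]; last first.
    rewrite negbK => /eqP cz; rewrite (@sum_signs_cycles s p p' _ _ z)// ?normc0 ?mulr0//;
    by rewrite size_tuple.
  rewrite exprD ler_pM ?mulr_ge0 ?normc_ge0 ?ler_pM ?normc_ge0//.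
  - by apply: pathwt_le; rewrite ?size_tuple.
  - by apply: pathwt_le; rewrite ?size_tuple.
  apply: le_trans (normc_sum _ _ _) _.
  by under eq_bigr do rewrite normc_signs; rewrite sumr_const.
rewrite sumr_const -[leLHS]mulr_natr.
rewrite [leRHS](_ : _ = eta ^+ (q + q) * N%:R * (k ^ q * q ^ (q + q))%:R); last by ring.
rewrite ler_wpM2l ?mulr_ge0 ?exprn_ge0 ?ler0n// ler_nat.
apply: leq_trans (card_no_singleton k (isT : (0 < q)%N)).
pose f (pp : q.-tuple 'I_k * q.-tuple 'I_k) := cat_tuple pp.1 pp.2.
have fI : injective f.
  move=> [p1 p2] [p3 p4] /(congr1 val) /= /eqP; rewrite eqseq_cat ?size_tuple//.
  by move=> /andP[/eqP/val_inj -> /eqP/val_inj ->].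
rewrite -(fintype.card_image fI); apply: subset_leq_card.
by apply/fintype.subsetP => t /fintype.imageP[pp gp ->].
Qed.

Lemma exists_small_words (V : J -> 'M[C]_k) (eta : R) m :
  0 <= eta -> (forall j x y, normc (V j x y) <= eta) ->
  exists eps, forall s, (0 < size s <= m)%N -> cycred s ->
    normc (\tr (mx_word (signed_family V eps) s)) ^+ 2 <=
    \sum_(q < m.+1) (#|{: letter}| ^ q)%:R *
      ((k ^ q * q ^ (q + q))%:R * eta ^+ (q + q)).
Proof.
move=> e0 hV.
pose P (q : nat) (t : q.-tuple letter) := (0 < q)%N && cycred t.
pose f (eps : {ffun letter * 'I_k -> bool}) := \sum_(q < m.+1) \sum_(t : q.-tuple letter | P q t)
  normc (\tr (mx_word (signed_family V eps) t)) ^+ 2.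
have f0 eps (q : nat) : 0 <= \sum_(t : q.-tuple letter | P q t)
  normc (\tr (mx_word (signed_family V eps) t)) ^+ 2.
  by apply: sumr_ge0 => t _; rewrite sqr_ge0.
have [eps heps] : exists eps, f eps <= \sum_(q < m.+1) (#|{: letter}| ^ q)%:R *
      ((k ^ q * q ^ (q + q))%:R * eta ^+ (q + q)).
  apply: exists_le_average; first by rewrite card_ffun card_bool expn_gt0.
  rewrite exchange_big mulr_sumr; apply: ler_sum => q _ /=; rewrite exchange_big /=.
  apply: (@le_trans _ _ (\sum_(t : q.-tuple letter)
     #|{ffun letter * 'I_k -> bool}|%:R * ((k ^ q * q ^ (q + q))%:R * eta ^+ (q + q)))).
    rewrite [leLHS]big_mkcond; apply: ler_sum => t _; case: ifPn => [/andP[q0 ct]|_].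
      by have := word_second_moment e0 hV _ ct; rewrite size_tuple; apply.
    by rewrite !mulr_ge0 ?ler0n ?exprn_ge0.
  by rewrite sumr_const card_tuple -mulr_natr; apply: eq_ler; ring.
exists eps => s /andP[s0 sm] cs; apply: le_trans heps.
have sm' : (size s < m.+1)%N by [].
rewrite /f (bigD1 (Ordinal sm'))//= -[leLHS]addr0; apply: lerD; last first.
  by apply: sumr_ge0 => q _; exact: f0.
rewrite (bigD1 (in_tuple s)) /P ?s0//= lerDl; apply: sumr_ge0 => t _.
exact: sqr_ge0.
Qed.

End Words.

Section SpreadAsymptotics.
Context (R : realType).

Lemma spread_ge2 k : (0 < k)%N -> 2 <= spread R k.
Proof.
move=> k0; rewrite /spread lerDr mulr_ge0// ln_ge0//.
by rewrite -[4]/(4%:R) -natrM ler1n muln_gt0 /= muln_gt0 k0.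
Qed.

Lemma spread_pow_le (N : nat) : exists2 c : R, 0 < c &
  forall k, (0 < k)%N -> spread R k ^+ N.+1 <= c * k%:R ^+ 2.
Proof.
exists ((4 * N.+1%:R) ^+ N.+1 * (4 * expR 2^-1)); first by rewrite !mulr_gt0 ?exprn_gt0 ?mulr_gt0 ?expR_gt0.
move=> k k0; have kR : 0 < k%:R :> R by rewrite ltr0n.
set y := ln (4 * (k * k)%:R) + 2^-1 : R.
have -> : spread R k = 4 * N.+1%:R * (y / N.+1%:R).
  by rewrite -mulrA [_ * (y / _)]mulrC divfK ?pnatr_eq0// /spread /y; field.
rewrite exprMn -mulrA ler_wpM2l ?exprn_ge0 ?mulr_ge0//.
have y0 : 0 <= y.
  by rewrite addr_ge0// ln_ge0// -[4]/(4%:R) -natrM ler1n muln_gt0 /= muln_gt0 k0.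
apply: le_trans (expR_ge_X _ y0) _; rewrite /y expRD lnK; last first.
  by rewrite posrE mulr_gt0// ltr0n muln_gt0 k0.
by rewrite natrM; apply: eq_ler; ring.
Qed.

Lemma spread_negligible (m : nat) (K tol : R) : 0 < K -> 0 < tol ->
  exists k0, forall k, (k0 < k)%N ->
    K * spread R k ^+ (m + m) <= tol * k%:R ^+ 2.
Proof.
(* The inequality is squared below; [4 m + 3] makes the resulting power of [spread] at most [c k^2],
   to be beaten by [k^4]. *)
move=> K0 t0; have [c c0 hc] := spread_pow_le (4 * m + 3)%N.
have [k0 hk0] : exists k0 : nat, K ^+ 2 * c / tol ^+ 2 < k0%:R.
  by exists (Num.bound (K ^+ 2 * c / tol ^+ 2)); rewrite archi_boundP// divr_ge0 ?mulr_ge0 ?sqr_ge0// ltW.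
exists k0 => k kk0; have kp : (0 < k)%N by apply: leq_ltn_trans kk0.
have s2 := spread_ge2 kp; have kR : 1 <= k%:R :> R by rewrite ler1n.
rewrite -(@ler_pXn2r _ 2)// ?nnegrE ?mulr_ge0 ?exprn_ge0 ?(ltW K0) ?(ltW t0) ?ler0n//; last lra.
have h1 : (spread R k ^+ (m + m)) ^+ 2 <= c * k%:R ^+ 2.
  apply: le_trans (hc k kp); rewrite -exprM ler_weXn2l//; [lra | lia].
rewrite exprMn [leRHS]exprMn; apply: (@le_trans _ _ (K ^+ 2 * (c * k%:R ^+ 2))).
  by rewrite ler_wpM2l ?sqr_ge0.
have h2 : K ^+ 2 * c <= tol ^+ 2 * k%:R.
  rewrite -ler_pdivrMl ?exprn_gt0// mulrC ltW//; apply: lt_trans hk0 _.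
  by rewrite ltr_nat.
have -> : tol ^+ 2 * (k%:R ^+ 2) ^+ 2 = tol ^+ 2 * k%:R * (k%:R * k%:R ^+ 2) by ring.
rewrite mulrA ler_pM ?mulr_ge0 ?sqr_ge0 ?(ltW c0) ?(ltW K0)//.
by rewrite ler_peMl ?sqr_ge0.
Qed.

End SpreadAsymptotics.

(** * Approximately free representations *)

Section UnitaryGroup.
Context (R : realType) (k : nat).
Local Notation C := R[i].
Local Open Scope sesquilinear_scope.

Record unitary_group := UnitaryGroup {
  ugval :> 'M[C]_k ; ugvalP : ugval \is unitarymx }.

HB.instance Definition _ := [isSub for ugval].
HB.instance Definition _ := [Choice of unitary_group by <:].

Definition ug_one := UnitaryGroup (unitary1 R k).
Definition ug_mul (x y : unitary_group) :=
  UnitaryGroup (mul_unitarymx (ugvalP x) (ugvalP y)).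
Lemma ug_inv_subproof (x : unitary_group) : (ugval x)^t* \is unitarymx.
Proof. by rewrite trmxC_unitary ugvalP. Qed.
Definition ug_inv (x : unitary_group) := UnitaryGroup (ug_inv_subproof x).

Lemma ug_mulA : associative ug_mul.
Proof. by move=> x y z; apply: val_inj; rewrite /= mulmxA. Qed.
Lemma ug_mul1 : left_id ug_one ug_mul.
Proof. by move=> x; apply: val_inj; rewrite /= mul1mx. Qed.
Lemma ug_mulr1 : right_id ug_one ug_mul.
Proof. by move=> x; apply: val_inj; rewrite /= mulmx1. Qed.
Lemma ug_mulV : left_inverse ug_one ug_inv ug_mul.
Proof. by move=> x; apply: val_inj; rewrite /= (unitary_right (ugvalP x)). Qed.
Lemma ug_mulrV : right_inverse ug_one ug_inv ug_mul.
Proof. by move=> x; apply: val_inj; rewrite /= (unitary_left (ugvalP x)). Qed.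

HB.instance Definition _ := isGroup.Build unitary_group
  ug_mulA ug_mul1 ug_mulr1 ug_mulV ug_mulrV.

End UnitaryGroup.

Section GroupWords.
Context (F : groupType).
Implicit Types (w : seq (F * bool)).

Definition gword w : F :=
  foldr (fun a x => ((if a.2 then a.1^-1 else a.1) * x)%g) 1%g w.

Lemma gword_cat w1 w2 : gword (w1 ++ w2) = (gword w1 * gword w2)%g.
Proof. by elim: w1 => [|a w1 IH] /=; rewrite ?mul1g// IH mulgA. Qed.

Definition winv w := rev [seq (a.1, ~~ a.2) | a <- w].

Lemma gword_inv w : gword (winv w) = (gword w)^-1%g.
Proof.
elim: w => [|[x b] w IH]; rewrite /winv /= ?invg1// rev_cons -cats1 gword_cat.
by rewrite -/(winv w) IH /= mulg1 invgM; case: b; rewrite /= ?invgK.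
Qed.

Definition generated (G : set F) : {pred F} :=
  [pred g | `[< exists2 w, all (fun a => a.1 \in G) w & gword w = g >]].

Lemma generatedP (G : set F) g :
  reflect (exists2 w, all (fun a => a.1 \in G) w & gword w = g) (g \in generated G).
Proof. by rewrite inE; exact: asboolP. Qed.

Record gensub (G : set F) := GenSub { genval : F ; genvalP : genval \in generated G }.

HB.instance Definition _ G := [isSub for @genval G].
HB.instance Definition _ G := [Choice of gensub G by <:].

Lemma generated_group_closed G : group_closed (generated G).
Proof.
split; first by apply/generatedP; exists [::].
move=> x y /generatedP[w Gw <-] /generatedP[v Gv <-].
apply/generatedP; exists (w ++ winv v); last by rewrite gword_cat gword_inv.
by rewrite all_cat Gw /winv all_rev all_map.
Qed.

HB.instance Definition _ G := SubChoice_isSubGroup.Build F (generated G) (gensub G)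
  (generated_group_closed G).

(** The inclusion of [G] extends to a homomorphism into the subgroup generated by [G]. Followed by
    the inclusion of that subgroup it agrees with the identity on [G], and uniqueness makes it the
    identity. *)
Lemma free_generated (G : set F) g : free_generating_set G -> g \in generated G.
Proof.
move=> hG.
have GG x : x \in G -> x \in generated G.
  by move=> xG; apply/generatedP; exists [:: (x, false)]; rewrite /= ?xG ?mulg1.
pose f x : gensub G := if insub x is Some y then y else 1%g.
have fE x : x \in G -> genval (f x) = x.
  by move=> xG; rewrite /f insubT ?GG// SubK.
have [h [[hM hf] _]] := hG _ f.
have [i [_ iU]] := hG _ (@id F).
have e1 := iU id (conj (fun _ _ => erefl) (fun _ _ => erefl)).
have e2 : i = (fun x => genval (h x)).
  apply: iU; split=> [x y|x xG]; first by rewrite hM.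
  by rewrite hf// fE.
have -> : g = genval (h g) by rewrite -[LHS]/(id g) -e1 e2.
exact: genvalP.
Qed.

End GroupWords.

Section UnitaryReps.
Context (R : realType) (F : groupType).
Local Notation C := R[i].
Local Open Scope sesquilinear_scope.

Definition urep k (pi : F -> 'M[C]_k) :=
  (forall x y, pi (x * y)%g = pi x *m pi y) /\ forall x, pi x \is unitarymx.

Lemma urep1 k (pi : F -> 'M[C]_k) : urep pi -> pi 1%g = 1%:M.
Proof.
move=> [pM pU]; have := pM 1%g 1%g; rewrite mulg1 => e.
have := unitary_right (pU 1%g); rewrite {2}e mulmxA (unitary_right (pU _)) mul1mx.
by [].
Qed.

Lemma urepV k (pi : F -> 'M[C]_k) x : urep pi -> pi x^-1%g = (pi x)^t*.
Proof.
move=> up; have [pM pU] := up; have := pM x^-1%g x; rewrite mulVg urep1// => e.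
by rewrite -[LHS]mulmx1 -(unitary_left (pU x)) mulmxA -e mul1mx.
Qed.

Lemma free_urep_extension (G : set F) k (f : F -> 'M[C]_k) :
  free_generating_set G -> (forall x, f x \is unitarymx) ->
  exists2 pi, urep pi & {in G, pi =1 f}.
Proof.
move=> hG fU; have [h [[hM hf] _]] := hG _ (fun x => UnitaryGroup (fU x)).
exists (fun x => ugval (h x)); last by move=> x /hf ->.
by split=> [x y|x]; [rewrite hM | exact: ugvalP].
Qed.

End UnitaryReps.

Section WordReduction.
Context (R : realType) (F : groupType) (J : finType) (v : J -> F) (k : nat).
Local Notation C := R[i].
Local Open Scope sesquilinear_scope.
Local Notation letter := (J * bool)%type.
Implicit Types (s : seq letter) (U : J -> 'M[C]_k).

Definition wmap s : seq (F * bool) := [seq (v a.1, a.2) | a <- s].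

Lemma zip_rot (S T : Type) i (s : seq S) (t : seq T) : size s = size t ->
  zip (rot i s) (rot i t) = rot i (zip s t).
Proof.
move=> e; elim: i => [|i IH]; first by rewrite !rot0.
have h1 (s' : seq S) (t' : seq T) : size s' = size t' ->
    zip (rot 1 s') (rot 1 t') = rot 1 (zip s' t').
  case: s' t' => [|x s'] [|y t'] //= [e'].
  by rewrite /zip !rot1_cons -/zip zip_rcons.
case: (ltnP i (size s)) => hi; last first.
  by rewrite !rot_oversize ?size_zip -?e ?minnn// ltnW// ltnS.
have hz : (i < size (zip s t))%N by rewrite size_zip -e minnn.
by rewrite (rotS hi) (rotS (_ : (i < size t)%N)) -?e// (rotS hz) h1 ?IH// !size_rot.
Qed.

Lemma not_cycred s : ~~ cycred s ->
  exists i x s', rot i s = x :: flipl x :: s'.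
Proof.
case/allPn => -[y z] yz0; have [t hi e] := nthP (y, z) yz0.
move: hi; rewrite size_zip size_rot size_map minnn => hi; rewrite negbK /= => yz; exists t.
have : head (y, z) (rot t (zip (rot 1 s) (map (@flipl J) s))) = (y, z).
  by rewrite -nth0 /rot nth_cat size_drop size_zip size_rot size_map minnn subn_gt0 hi
    nth_drop addn0.
rewrite -zip_rot ?size_rot ?size_map// rot_rot -map_rot.
have : size (rot t s) = size s by rewrite size_rot.
case: (rot t s) => [/esym e0|x [|x' r]] _; first by rewrite e0 in hi.
  by move=> /= [xy ez]; move: yz; rewrite -xy -ez; case: (x) => ? [] /eqP.
by rewrite rot1_cons /= => -[xy ez]; exists x, r; rewrite xy -(eqP yz) in ez *; rewrite ez.
Qed.

Lemma mx_word_cat U s1 s2 : mx_word U (s1 ++ s2) = mx_word U s1 *m mx_word U s2.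
Proof. by elim: s1 => [|a s1 IH] /=; rewrite ?mul1mx// IH mulmxA. Qed.

Lemma mxtrace_word_rot U s i : \tr (mx_word U (rot i s)) = \tr (mx_word U s).
Proof. by rewrite /rot mx_word_cat mxtrace_mulC -mx_word_cat cat_take_drop. Qed.

Lemma gword_rot_eq1 s i : (gword (wmap (rot i s)) == 1%g) = (gword (wmap s) == 1%g).
Proof.
rewrite /rot -[in RHS](cat_take_drop i s) /wmap !map_cat !gword_cat.
set x := gword _; set y := gword _.
apply/eqP/eqP => e.
  have -> : y = x^-1%g by rewrite -[y](mulKg x) e mulg1.
  by rewrite mulVg.
have -> : x = y^-1%g by rewrite -[x](mulKg y) e mulg1.
by rewrite mulVg.
Qed.

(** Cancelling a cyclic pair of inverse letters preserves both the trace and nontriviality in the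
    group, so the reduction ends at a nonempty cyclically reduced word. *)
Lemma small_nontrivial_words U (m : nat) (tol : R) :
  (forall j, U j \is unitarymx) ->
  (forall s, (0 < size s <= m)%N -> cycred s -> normc (\tr (mx_word U s)) < tol) ->
  forall s, (size s <= m)%N -> gword (wmap s) != 1%g ->
    normc (\tr (mx_word U s)) < tol.
Proof.
move=> uU h s; have [n] := ubnP (size s); elim: n s => // n IH s; rewrite ltnS => sn sm s1.
have s0 : (0 < size s)%N by case: (s) s1 => //=; rewrite eqxx.
have [cs|/not_cycred[i [x [s' e]]]] := boolP (cycred s); first by apply: h; rewrite ?s0.
have sE : size s = (size s').+2 by rewrite -(size_rot i) e.
rewrite -(mxtrace_word_rot U s i) e /=.
have -> : (if x.2 then U x.1 ^t* else U x.1) *m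
   ((if ~~ x.2 then U x.1 ^t* else U x.1) *m mx_word U s') = mx_word U s'.
  rewrite mulmxA; case: (x.2) => /=;
    by rewrite ?(unitary_left (uU _)) ?(unitary_right (uU _)) mul1mx.
apply: IH; [lia | lia |].
move: s1; rewrite -(gword_rot_eq1 s i) e /= mulgA.
by case: (x.2) => /=; rewrite ?mulVg ?mulgV mul1g.
Qed.

End WordReduction.

Section ApproximatelyFree.
Context (R : realType) (F : groupType).
Local Notation C := R[i].
Local Open Scope sesquilinear_scope.

Lemma eq_signmx k (e1 e2 : 'I_k -> bool) : e1 =1 e2 -> signmx R e1 = signmx R e2.
Proof. by move=> /funext ->. Qed.

Lemma signed_family_mul (J : finType) k (V : J -> 'M[C]_k)
    (eps : {ffun (J * bool) * 'I_k -> bool}) j :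
  signed_family V eps j = signmx R (fun x => eps ((j, false), x)) *m V j *m
    signmx R (fun x => eps ((j, true), x)).
Proof.
by apply/matrixP => x y; rewrite mul_mx_diag mul_diag_mx !mxE.
Qed.

Lemma free_words (G : set F) (S : seq F) : free_generating_set G ->
  exists2 gl : seq F, {subset gl <= G} &
    exists m : nat, forall g, g \in S -> exists2 w : seq (seq_sub gl * bool),
      (size w <= m)%N & gword (wmap val w) = g.
Proof.
move=> hG; elim: S => [|g S [gl glG [m hm]]]; first by exists [::] => //; exists 0%N.
have /generatedP[w Gw wg] := free_generated g hG.
pose gl' := map fst w ++ gl.
have lift (w' : seq (F * bool)) : {subset map fst w' <= gl'} ->
    exists w2 : seq (seq_sub gl' * bool), wmap val w2 = w'.
  elim: w' => [|[x b] w' IH] h; first by exists [::].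
  have [|w2 <-] := IH; first by move=> y yw; apply: h; rewrite inE yw orbT.
  have xgl : x \in gl' by apply: h; rewrite inE eqxx.
  by exists ((SeqSub xgl, b) :: w2).
exists gl'.
  move=> x; rewrite mem_cat => /orP[/mapP[a aw ->]|/glG//].
  exact: (allP Gw).
exists (maxn (size w) m) => h; rewrite inE => /orP[/eqP ->|/hm[w1 sw1 <-]].
  have [|w2 e] := lift w; first by move=> x; rewrite mem_cat => ->.
  exists w2; last by rewrite e.
  by rewrite -(size_map (fun a : seq_sub gl' * bool => (val a.1, a.2)) w2) -/(wmap _ _) e leq_maxl.
have [|w2 e] := lift (wmap val w1).
  move=> x /mapP[a /mapP[b _ ->] ->] /=.
  by rewrite mem_cat; apply/orP; right; exact: ssvalP.
exists w2; last by rewrite e.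
have -> : size w2 = size w1.
  by have := congr1 size e; rewrite !size_map.
by apply: leq_trans sw1 _; rewrite leq_maxr.
Qed.

Lemma approximately_free_urep (G : set F) (a b : F) (S : seq F) (m : nat) (tol : R) :
  free_generating_set G -> a \in G -> b \in G -> a != b -> 0 < tol ->
  exists k0, forall k (h : 'M[R]_k) (U : 'M[C]_k), (k0 < k)%N -> flat h ->
    U \is unitarymx ->
    exists e : nat -> {ffun 'I_k -> bool}, exists2 pi : F -> 'M[C]_k, urep pi &
    [/\ pi b = signmx R (e 0%N) *m (cmx h *m signmx R (e 1%N) *m U) *m
          signmx R (e 2%N),
        pi a = signmx R (e 3%N) *m (cmx h *m signmx R (e 4%N) *m 1%:M) *m
          signmx R (e 5%N),
        forall g, g \in S -> g != 1%g -> normc (ntr (pi g)) < tol &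
        forall n, (0 < n <= m)%N -> normc (ntr (pi (a ^+ n)%g)) < tol].
Proof.
move=> hG aG bG ab t0.
have [gl0 gl0G [m1 hm1]] := free_words S hG.
pose gl := a :: b :: gl0; pose J := seq_sub gl; pose mm := maxn m m1.
(* [K] collects the combinatorial factors of [exists_small_words]; the powers of [k] cancel against
   those of [sqrt k], which leaves [K * spread^(2 mm)]. *)
pose K : R := \sum_(q < mm.+1) (#|{: J * bool}| ^ q)%:R * (q ^ (q + q))%:R + 1.
have Kp : 0 < K.
  by rewrite ltr_wpDl// sumr_ge0// => q _; rewrite mulr_ge0.
have t4 : 0 < tol ^+ 2 / 2 by rewrite divr_gt0// exprn_gt0.
have [k0 hk0] := spread_negligible mm Kp t4.
exists k0 => k h U kk0 fh uU.
have kp : (0 < k)%N by apply: leq_ltn_trans kk0.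
have kR : 0 < k%:R :> R by rewrite ltr0n.
have s2 := spread_ge2 R kp.
have ha : a \in gl by rewrite inE eqxx.
have hb : b \in gl by rewrite !inE eqxx orbT.
pose ja : J := SeqSub ha; pose jb : J := SeqSub hb.
pose Uj (j : J) : 'M[C]_k := if j == jb then U else 1%:M.
have uUj j : Uj j \is unitarymx by rewrite /Uj; case: ifP => _; [exact: uU|exact: unitary1].
have /fin_all_exists[d hd] : forall j : J, exists e : {ffun 'I_k -> bool}, forall x y,
    normc ((cmx h *m signmx R e *m Uj j) x y) <= spread R k / Num.sqrt k%:R.
  by move=> j; exact: delocalize.
pose V j := cmx h *m signmx R (d j) *m Uj j.
have eta0 : 0 <= spread R k / Num.sqrt k%:R by rewrite divr_ge0 ?sqrtr_ge0//; lra.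
have [eps heps] := exists_small_words mm eta0 hd.
pose W := signed_family V eps.
have uW j : W j \is unitarymx.
  rewrite /W signed_family_mul; apply: mul_unitarymx; last exact: signmx_unitary.
  apply: mul_unitarymx; first exact: signmx_unitary.
  apply: mul_unitarymx; last exact: uUj.
  by apply: mul_unitarymx; [exact: cmx_unitary fh.1 | exact: signmx_unitary].
(* Only words in the finitely many generators from [gl] have to be controlled; the other generators
   may act trivially. *)
pose f (g : F) : 'M[C]_k := if insub g is Some j then W j else 1%:M.
have uf g : f g \is unitarymx by rewrite /f; case: insubP => [j _ _|_]; [exact: uW|exact: unitary1].
have [pi up pif] := free_urep_extension hG uf.
have glG : {subset gl <= G} by move=> x; rewrite in_cons in_cons => /or3P[/eqP->|/eqP->|/gl0G].
have piW (j : J) : pi (val j) = W j.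
  rewrite pif ?glG ?ssvalP//; rewrite /f insubT ?ssvalP// => hj.
  by congr W; apply: val_inj.
have piw (w : seq (J * bool)) : pi (gword (wmap val w)) = mx_word W w.
  elim: w => [|[j c] w IH] /=; first exact: urep1.
  rewrite (proj1 up) IH; congr (_ *m _); case: c => /=; last exact: piW.
  by rewrite (urepV _ up) piW.
have small s : (0 < size s <= mm)%N -> cycred s -> normc (\tr (mx_word W s)) < tol * k%:R.
  move=> ss cs; rewrite -(@ltr_pXn2r _ 2) ?nnegrE ?normc_ge0 ?mulr_ge0 ?ltW//.
  apply: le_lt_trans (heps s ss cs) _.
  apply: (@le_lt_trans _ _ (K * spread R k ^+ (mm + mm))); last first.
    apply: le_lt_trans (hk0 k kk0) _; rewrite exprMn ltr_pM2r ?exprn_gt0//.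
    by rewrite ltr_pdivrMr// ltr_pMr ?exprn_gt0//; lra.
  rewrite /K [leRHS]mulrDl mul1r; apply: ler_wpDr; first by rewrite exprn_ge0//; lra.
  rewrite mulr_suml; apply: ler_sum => q _; rewrite -mulrA ler_wpM2l//.
  have hq : Num.sqrt k%:R ^+ (q + q) = k%:R ^+ q :> R.
    by rewrite addnn -mul2n exprM sqr_sqrtr ?ltW.
  have -> : (k ^ q * q ^ (q + q))%:R * (spread R k / Num.sqrt k%:R) ^+ (q + q) =
      (q ^ (q + q))%:R * spread R k ^+ (q + q).
    rewrite expr_div_n hq natrM natrX.
    by field; rewrite expf_neq0// gt_eqF.
  rewrite ler_wpM2l// ler_weXn2l//; first by lra.
  by apply: leq_add; rewrite -ltnS.
have small2 g (w : seq (J * bool)) : (size w <= mm)%N -> gword (wmap val w) = g -> g != 1%g ->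
    normc (ntr (pi g)) < tol.
  move=> sw <- g1; rewrite piw /ntr normcM normcV natrC normc_real normr_nat.
  by rewrite mulrC ltr_pdivrMr//; apply: (small_nontrivial_words uW small sw g1).
have [gj hgj] : exists gj : seq_sub gl0 -> J, forall j, val (gj j) = val j.
  have hg (j : seq_sub gl0) : ssval j \in gl by rewrite !inE ssvalP !orbT.
  by exists (fun j => SeqSub (hg j)).
pose e0 : {ffun 'I_k -> bool} := [ffun=> false].
exists (nth e0 [:: [ffun x => eps ((jb, false), x)]; d jb; [ffun x => eps ((jb, true), x)];
   [ffun x => eps ((ja, false), x)]; d ja; [ffun x => eps ((ja, true), x)]]).
exists pi => //; split.
- by rewrite -[b]/(val jb) piW /W signed_family_mul /V /Uj eqxx /=;
    congr (_ *m _ *m _); apply: eq_signmx => x; rewrite ffunE.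
- have ajb : (ja == jb) = false by apply/negbTE.
  by rewrite -[a]/(val ja) piW /W signed_family_mul /V /Uj ajb /=;
    congr (_ *m _ *m _); apply: eq_signmx => x; rewrite ffunE.
- move=> g gS g1; have [w sw wg] := hm1 g gS.
  apply: (small2 _ (map (fun x => (gj x.1, x.2)) w)) => //.
    by rewrite size_map; apply: leq_trans sw _; rewrite leq_maxr.
  rewrite -wg; congr gword; rewrite /wmap -map_comp; apply: eq_map => x /=.
  by rewrite hgj.
- move=> n /andP[n0 nm].
  have -> : pi (a ^+ n)%g = mx_word W (nseq n (ja, false)).
    rewrite -piw; congr pi; elim: (n) => [|n' IH] //=; by rewrite -IH expgS.
  rewrite /ntr normcM normcV natrC normc_real normr_nat mulrC ltr_pdivrMr//.
  apply: small; first by rewrite size_nseq n0 /= (leq_trans nm)// leq_maxl.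
  rewrite /cycred map_nseq.
  have -> : rot 1 (nseq n (ja, false)) = nseq n (ja, false).
    by case: (n) => [|n'] //=; rewrite rot1_cons -cats1 -[[:: _]]/(nseq 1 _) -nseqD addn1.
  by elim: (n) => //= n' ->; rewrite andbT; apply/eqP => -[].
Qed.

End ApproximatelyFree.

(** * The group algebra acting on square-summable functions *)

Section L2Norm.
Context (R : realType) (I : choiceType).
Local Notation C := R[i].
Implicit Types f g : l2 R I.

Definition nsq f : R := fine (sqnorm f).

Lemma sqnormE f : sqnorm f = (nsq f)%:E.
Proof.
have h : (sqnorm f < +oo)%E by have := l2P f; rewrite inE.
by rewrite /nsq fineK// ge0_fin_numE// sqnorm_ge0.
Qed.

Lemma nsq_ge0 f : 0 <= nsq f.
Proof. by rewrite -lee_fin -sqnormE sqnorm_ge0. Qed.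

Lemma l2norm_ge0 f : 0 <= l2norm f.
Proof. exact: sqrtr_ge0. Qed.

Lemma l2norm2 f : l2norm f ^+ 2 = nsq f.
Proof. by rewrite sqr_sqrtr// nsq_ge0. Qed.

Lemma sum_le_nsq f (s : seq I) : uniq s -> \sum_(x <- s) normc (f x) ^+ 2 <= nsq f.
Proof.
move=> us; rewrite -lee_fin -sqnormE -sumEFin; apply: esum_ge.
by exists [set` s]; [split=> //; exact: finite_seq | rewrite -fsbig_seq].
Qed.

Lemma nsq_le f M :
  (forall s : seq I, uniq s -> \sum_(x <- s) normc (f x) ^+ 2 <= M) -> nsq f <= M.
Proof.
move=> h; rewrite -lee_fin -sqnormE; apply: ge_ereal_sup => _ [X [finX _] <-].
rewrite fsbig_finite//= sumEFin lee_fin; exact: h (fset_uniq _).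
Qed.

Lemma nsq_approx f (d : R) : 0 < d ->
  exists2 s : seq I, uniq s & nsq f - d < \sum_(x <- s) normc (f x) ^+ 2.
Proof.
move=> d0; apply/not_exists2P => h.
have : nsq f <= nsq f - d.
  by apply: nsq_le => s us; case: (h s) => // /negP; rewrite -leNgt.
by move=> h2; move: d0; rewrite ltNge; case/negP; lra.
Qed.

Lemma l2D f g x : (f + g) x = f x + g x.
Proof. by []. Qed.
Lemma l2N f x : (- f) x = - f x.
Proof. by []. Qed.
Lemma l2Z (c : C) f x : (c *: f) x = c * f x.
Proof. by []. Qed.
Lemma l2_sum (T : Type) (s : seq T) (F : T -> l2 R I) x :
  (\sum_(t <- s) F t) x = \sum_(t <- s) F t x.
Proof. by elim: s => [|t s IH]; rewrite ?big_nil// !big_cons l2D IH. Qed.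

Lemma l2_ext f g : f =1 g -> f = g.
Proof. by move=> fg; apply: val_inj; apply/funext. Qed.

Lemma l2norm_le f M : 0 <= M -> nsq f <= M ^+ 2 -> l2norm f <= M.
Proof. by move=> M0; rewrite -l2norm2 ler_pXn2r ?nnegrE ?l2norm_ge0. Qed.

(** Minkowski's inequality without Cauchy-Schwarz for infinite sums: the pointwise bound [(u + v)^2
    <= (1 + b'/a') u^2 + (1 + a'/b') v^2] is summed over finite sets. Adding [e / 2] to both norms
    keeps the weights finite. *)
Lemma l2_triangle f g : l2norm (f + g) <= l2norm f + l2norm g.
Proof.
apply/ler_addgt0Pr => e e0; set a := l2norm f; set b := l2norm g.
have a0 : 0 <= a := l2norm_ge0 _; have b0 : 0 <= b := l2norm_ge0 _.
pose a' := a + e / 2; pose b' := b + e / 2.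
have a'0 : 0 < a' by rewrite ltr_wpDl// divr_gt0.
have b'0 : 0 < b' by rewrite ltr_wpDl// divr_gt0.
have -> : a + b + e = a' + b' by rewrite /a' /b'; field.
apply: l2norm_le; first by rewrite addr_ge0// ltW.
apply: nsq_le => s us.
have fa : nsq f <= a' ^+ 2 by rewrite -l2norm2 ler_pXn2r ?nnegrE// ?lerDl ltW// divr_gt0.
have gb : nsq g <= b' ^+ 2 by rewrite -l2norm2 ler_pXn2r ?nnegrE// ?lerDl ltW// divr_gt0.
have p x : normc ((f + g) x) ^+ 2 <=
    (1 + b' / a') * normc (f x) ^+ 2 + (1 + a' / b') * normc (g x) ^+ 2.
  have h := normc_triangle (f x) (g x).
  apply: (@le_trans _ _ ((normc (f x) + normc (g x)) ^+ 2)).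
    by rewrite ler_pXn2r ?nnegrE ?addr_ge0 ?normc_ge0.
  set u := normc (f x); set v := normc (g x).
  rewrite -subr_ge0 (_ : _ - _ = (b' * u - a' * v) ^+ 2 / (a' * b')).
    by rewrite divr_ge0 ?sqr_ge0 ?mulr_ge0 ?ltW.
  by field; rewrite !gt_eqF.
apply: le_trans (ler_sum _ (fun x _ => p x)) _.
rewrite big_split /= -!mulr_sumr.
have h1 : \sum_(x <- s) normc (f x) ^+ 2 <= a' ^+ 2 by apply: le_trans fa; exact: sum_le_nsq.
have h2 : \sum_(x <- s) normc (g x) ^+ 2 <= b' ^+ 2 by apply: le_trans gb; exact: sum_le_nsq.
have -> : (a' + b') ^+ 2 = (1 + b' / a') * a' ^+ 2 + (1 + a' / b') * b' ^+ 2.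
  by field; rewrite !gt_eqF.
by apply: lerD; rewrite ler_wpM2l// addr_ge0// divr_ge0// ltW.
Qed.

Lemma l2normZ (c : C) f : l2norm (c *: f) <= normc c * l2norm f.
Proof.
apply: l2norm_le; first by rewrite mulr_ge0 ?normc_ge0 ?l2norm_ge0.
apply: nsq_le => s us; rewrite exprMn l2norm2.
apply: (@le_trans _ _ (normc c ^+ 2 * \sum_(x <- s) normc (f x) ^+ 2)).
  by rewrite mulr_sumr; apply: ler_sum => x _; rewrite l2Z normcM exprMn.
by rewrite ler_wpM2l ?sqr_ge0// sum_le_nsq.
Qed.

Lemma l2normN f : l2norm (- f) = l2norm f.
Proof.
suff h g : l2norm (- g) <= l2norm g by apply: le_anti; rewrite h -{1}[f]opprK h.
by have := l2normZ (-1) g; rewrite scaleN1r normcN normc1 mul1r.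
Qed.

Lemma l2norm0 : l2norm (0 : l2 R I) = 0.
Proof.
apply: le_anti; rewrite l2norm_ge0 andbT -[0 : l2 R I](scale0r (0 : l2 R I)).
by apply: le_trans (l2normZ _ _) _; rewrite normc0 mul0r.
Qed.

Lemma normc_le_l2norm f x : normc (f x) <= l2norm f.
Proof.
rewrite -(@ler_pXn2r _ 2) ?nnegrE ?normc_ge0 ?l2norm_ge0// l2norm2.
by have := @sum_le_nsq f [:: x]; rewrite big_seq1; apply.
Qed.

Lemma rsum_single (a : I -> R) j : (forall i, i != j -> a i = 0) -> rsum a = a j.
Proof.
move=> h; rewrite /rsum.
have E (b : I -> \bar R) : (forall i, 0 <= b i)%E -> (forall i, i != j -> b i = 0%E) ->
    esum [set: I] b = b j.
  move=> b0 hb; rewrite (esumID [set j])// setTI esum_set1// esum1 ?adde0//.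
  by move=> i [_ /eqP ij]; exact: hb.
rewrite !E.
- by rewrite -[X in fine X]/(((EFin \o a)^\+ \- (EFin \o a)^\-)%E j) -funeposneg.
- by move=> i; exact: funeneg_ge0.
- by move=> i ij; rewrite funenegE /= h// oppr0 maxxx.
- by move=> i; exact: funepos_ge0.
- by move=> i ij; rewrite funeposE /= h// maxxx.
Qed.

Lemma deltaE (j x : I) : (delta j : l2 R I) x = (x == j)%:R.
Proof. by []. Qed.

Lemma inner_delta f j : inner f (delta j) = f j.
Proof.
rewrite /inner /csum.
have h0 i : i != j -> f i * (delta j i)^* = 0 :> C.
  by move=> /negPf ij; rewrite deltaE ij mulr0n rmorph0 mulr0.
rewrite !(@rsum_single _ j).
- by rewrite deltaE eqxx mulr1n rmorph1 mulr1; case: (f j).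
- by move=> i /h0 ->.
- by move=> i /h0 ->.
Qed.

Lemma l2norm_delta j : l2norm (delta j : l2 R I) <= 1.
Proof.
apply: l2norm_le => //; apply: nsq_le => s us; rewrite expr1n.
have [js|js] := boolP (j \in s); last first.
  rewrite big1_seq ?ler01// => x /andP[_ xs]; rewrite deltaE.
  by have [xj|] := eqVneq x j; [rewrite xj (negPf js) in xs | rewrite normc0 expr0n].
rewrite (bigD1_seq j)//= eqxx normc1 expr1n big1 ?addr0// => x /negPf xj.
by rewrite xj normc0 expr0n.
Qed.

End L2Norm.

Section GroupAlgebra.
Context (R : realType) (F : groupType).
Local Notation C := R[i].
Local Open Scope sesquilinear_scope.
Local Notation galg := (seq (C * F)).
Implicit Types (s t : galg) (f : l2 R F).

(** A list of pairs (c, g) stands for the element [\sum c g] of the group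
    algebra; concatenation is addition. *)
Definition gmul s t : galg := [seq (x.1 * y.1, (x.2 * y.2)%g) | x <- s, y <- t].
Definition gstar s : galg := [seq (x.1^*, x.2^-1%g) | x <- s].
Definition gscale (c : C) s : galg := [seq (c * x.1, x.2) | x <- s].
Definition gone : galg := [:: (1, 1%g)].

Definition gcoef s (g : F) : C := \sum_(x <- s) x.1 * (x.2 == g)%:R.
Definition l1norm s : R := \sum_(x <- s) normc x.1.

Lemma l1norm_ge0 s : 0 <= l1norm s.
Proof. by apply: sumr_ge0 => x _; exact: normc_ge0. Qed.

Definition mxev k (pi : F -> 'M[C]_k) s : 'M[C]_k := \sum_(x <- s) x.1 *: pi x.2.

Lemma mxev_cat k (pi : F -> 'M[C]_k) s t : mxev pi (s ++ t) = mxev pi s + mxev pi t.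
Proof. by rewrite /mxev big_cat. Qed.

Lemma mxev_mul k (pi : F -> 'M[C]_k) s t : urep pi ->
  mxev pi (gmul s t) = mxev pi s *m mxev pi t.
Proof.
move=> [pM _]; rewrite /mxev big_allpairs_dep mulmx_suml; apply: eq_bigr => x _.
rewrite mulmx_sumr; apply: eq_bigr => y _.
by rewrite -scalemxAl -scalemxAr scalerA pM.
Qed.

Lemma tsummx m n (T : Type) (r : seq T) (G : T -> 'M[C]_(m, n)) :
  (\sum_(x <- r) G x)^t* = \sum_(x <- r) (G x)^t*.
Proof.
elim: r => [|x r IH]; first by rewrite !big_nil trmx0 map_mx0.
by rewrite !big_cons taddmx IH.
Qed.

Lemma mxev_star k (pi : F -> 'M[C]_k) s : urep pi ->
  mxev pi (gstar s) = (mxev pi s)^t*.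
Proof.
move=> up; rewrite /mxev big_map tsummx; apply: eq_bigr => x _.
by rewrite tscalemx (urepV _ up).
Qed.

Lemma mxev_scale k (pi : F -> 'M[C]_k) c s : mxev pi (gscale c s) = c *: mxev pi s.
Proof.
by rewrite /mxev big_map scaler_sumr; apply: eq_bigr => x _; rewrite scalerA.
Qed.

Lemma mxev_one k (pi : F -> 'M[C]_k) : urep pi -> mxev pi gone = 1%:M.
Proof. by move=> up; rewrite /mxev big_seq1 /= (urep1 up) scale1r. Qed.

Definition lev s f : l2 R F := \sum_(x <- s) x.1 *: ltrans x.2 f.

Lemma levE s f g : lev s f g = \sum_(x <- s) x.1 * f (x.2^-1 * g)%g.
Proof. by rewrite /lev l2_sum. Qed.

Lemma levD s f1 f2 : lev s (f1 + f2) = lev s f1 + lev s f2.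
Proof.
by apply: l2_ext => g; rewrite l2D !levE -big_split; apply: eq_bigr => x _; rewrite l2D mulrDr.
Qed.

Lemma levZ s c f : lev s (c *: f) = c *: lev s f.
Proof.
by apply: l2_ext => g; rewrite l2Z !levE mulr_sumr; apply: eq_bigr => x _; rewrite l2Z; ring.
Qed.

Lemma levN s f : lev s (- f) = - lev s f.
Proof. by rewrite -scaleN1r levZ scaleN1r. Qed.

Lemma levB s f1 f2 : lev s (f1 - f2) = lev s f1 - lev s f2.
Proof. by rewrite levD levN. Qed.

Lemma lev_cat s t f : lev (s ++ t) f = lev s f + lev t f.
Proof. by rewrite /lev big_cat. Qed.

Lemma lev_mul s t f : lev (gmul s t) f = lev s (lev t f).
Proof.
apply: l2_ext => g; rewrite !levE big_allpairs_dep; apply: eq_bigr => x _.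
rewrite levE mulr_sumr; apply: eq_bigr => y _ /=.
by rewrite invgM mulrA mulgA.
Qed.

Lemma lev_scale c s f : lev (gscale c s) f = c *: lev s f.
Proof.
by apply: l2_ext => g; rewrite l2Z !levE big_map mulr_sumr; apply: eq_bigr => x _ /=; rewrite mulrA.
Qed.

Lemma lev_one f : lev gone f = f.
Proof. by apply: l2_ext => g; rewrite levE big_seq1 invg1 mul1g mul1r. Qed.

Lemma lev_delta s g : lev s (delta 1%g) g = gcoef s g.
Proof.
rewrite levE; apply: eq_bigr => x _; rewrite deltaE; congr (_ * (_ : bool)%:R).
by apply/eqP/eqP => [e|->]; [rewrite -[g](mulVKg x.2) e mulg1 | rewrite mulVg].
Qed.

Lemma gcoef_star_mul s (D : seq F) : uniq D -> {subset [seq x.2 | x <- s] <= D} ->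
  gcoef (gmul (gstar s) s) 1%g = (\sum_(g <- D) normc (gcoef s g) ^+ 2)%:C.
Proof.
move=> uD sD; rewrite rmorph_sum /=.
under [RHS]eq_bigr do rewrite -conjc_mul_normc /gcoef rmorph_sum /= big_distrlr /=.
rewrite exchange_big /= /gcoef big_allpairs_dep big_map; apply: eq_big_seq => x xs.
rewrite exchange_big /=; apply: eq_bigr => y _.
rewrite (bigD1_seq x.2)//=; last by apply: sD; exact: map_f.
rewrite eqxx mulr1 big1 ?addr0; last first.
  by move=> g gx; rewrite [x.2 == g]eq_sym (negPf gx) mulr0 rmorph0 mul0r.
rewrite -mulrA; congr (_ * (_ * (_ : bool)%:R)).
by rewrite -(inj_eq (mulgI x.2)) mulVKg mulg1.
Qed.

(** The square of a full C*-norm, taken over finite-dimensional representations. A bound on the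
    reduced norm would not carry over to [mxev pi s], since the representations used are controlled
    only through traces. *)
Definition ubound s (K : R) := forall k (pi : F -> 'M[C]_k), urep pi -> nbound (mxev pi s) K.

(** The canonical trace is a limit of normalized traces of finite-dimensional unitary
    representations. The density argument uses freeness only in this form. *)
Definition approx_reps := forall (S : seq F) (tol : R), 0 < tol ->
  exists k (pi : F -> 'M[C]_k), [/\ (0 < k)%N, urep pi &
    forall g, g \in S -> g != 1%g -> normc (ntr (pi g)) < tol].

Lemma ntr_sum k (T : Type) (r : seq T) (G : T -> 'M[C]_k) :
  ntr (\sum_(x <- r) G x) = \sum_(x <- r) ntr (G x).
Proof. by rewrite /ntr raddf_sum mulr_sumr. Qed.

Lemma ntr_scale k c (X : 'M[C]_k) : ntr (c *: X) = c * ntr X.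
Proof. by rewrite /ntr mxtraceZ mulrCA. Qed.

Lemma ntr1 k : (0 < k)%N -> ntr (1%:M : 'M[C]_k) = 1.
Proof. by move=> k0; rewrite /ntr mxtrace1 mulVf// pnatr_eq0 -lt0n. Qed.

Lemma ntr_mxev k (pi : F -> 'M[C]_k) s tol : (0 < k)%N -> urep pi -> 0 < tol ->
  (forall g, g \in [seq x.2 | x <- s] -> g != 1%g -> normc (ntr (pi g)) < tol) ->
  normc (ntr (mxev pi s) - gcoef s 1%g) <= tol * l1norm s.
Proof.
move=> k0 up t0 h; rewrite /mxev ntr_sum /gcoef -sumrB.
apply: le_trans (normc_sum _ _ _) _; rewrite /l1norm mulr_sumr big_seq [leRHS]big_seq.
apply: ler_sum => x xs; rewrite ntr_scale -mulrBr normcM mulrC ler_wpM2r ?normc_ge0//.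
have [->|x1] := eqVneq x.2 1%g.
  by rewrite (urep1 up) ntr1// subrr normc0 ltW.
by rewrite subr0 ltW// h// map_f.
Qed.

(** In each matrix model [||s t||_2^2 <= K ||t||_2^2] for the normalized trace, and [approx_reps]
    carries this over to the canonical trace. The constant [c] makes the two trace errors add up to
    less than [e]. *)
Lemma lev_finite_bound s t K : approx_reps -> 0 <= K -> ubound s K ->
  complex.Re (gcoef (gmul (gstar (gmul s t)) (gmul s t)) 1%g) <=
  K * complex.Re (gcoef (gmul (gstar t) t) 1%g).
Proof.
move=> AR K0 hs; set u := gmul (gstar (gmul s t)) _; set v := gmul (gstar t) t.
pose c := l1norm u + K * l1norm v + 1.
have c0 : 0 < c by rewrite ltr_wpDl// addr_ge0 ?mulr_ge0 ?l1norm_ge0.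
apply/ler_addgt0Pr => e e0.
have t0 : 0 < e / c by rewrite divr_gt0.
have [k [pi [k0 up hpi]]] := AR ([seq x.2 | x <- u] ++ [seq x.2 | x <- v]) _ t0.
have hu : normc (ntr (mxev pi u) - gcoef u 1%g) <= e / c * l1norm u.
  by apply: ntr_mxev => // g gu; apply: hpi; rewrite mem_cat gu.
have hv : normc (ntr (mxev pi v) - gcoef v 1%g) <= e / c * l1norm v.
  by apply: ntr_mxev => // g gu; apply: hpi; rewrite mem_cat gu orbT.
have := le_trans (Re_le_normc _) hu; have := le_trans (Re_le_normc _) hv.
rewrite /u /v !mxev_mul ?mxev_star ?mxev_mul// !ntr_frob2 !ReD !ReN /=.
rewrite -/u -/v !ler_norml => /andP[_ h1] /andP[h2 _].
have kR : 0 < k%:R :> R by rewrite ltr0n.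
have h3 : frob2 (mxev pi s *m mxev pi t) / k%:R <= K * (frob2 (mxev pi t) / k%:R).
  by rewrite mulrA ler_wpM2r ?invr_ge0 ?ler0n//; apply: nbound_mul; exact: hs.
have h4 : K * (frob2 (mxev pi t) / k%:R) <= K * (complex.Re (gcoef v 1%g) + e / c * l1norm v).
  by rewrite ler_wpM2l//; lra.
have -> : e = e / c * l1norm u + K * (e / c * l1norm v) + e / c.
  have -> : e / c * l1norm u + K * (e / c * l1norm v) + e / c = e / c * c.
    by rewrite /c; ring.
  by rewrite divfK// gt_eqF.
lra.
Qed.

(** The full norm dominates the norm on [l2]. Finitely many coordinates of [lev s f] see only
    finitely many coordinates of [f], so [f] may be replaced by the group algebra element [t] with
    the same values on [X']. *)
Lemma lev_bound s K f : approx_reps -> 0 <= K -> ubound s K ->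
  nsq (lev s f) <= K * nsq f.
Proof.
move=> AR K0 hs; apply: nsq_le => X uX.
pose X' := undup [seq (x.2^-1 * g)%g | x <- s, g <- X].
pose t : galg := [seq (f h, h) | h <- X'].
have tc h : h \in X' -> gcoef t h = f h.
  move=> hX; rewrite /gcoef big_map (bigD1_seq h) ?undup_uniq//= eqxx mulr1 big1 ?addr0//.
  by move=> h' /negPf ->; rewrite mulr0.
have stc g : g \in X -> gcoef (gmul s t) g = lev s f g.
  move=> gX; rewrite levE /gcoef big_allpairs_dep; apply: eq_big_seq => x xs.
  have xg : (x.2^-1 * g)%g \in X' by rewrite mem_undup; apply/allpairsP; exists (x, g).
  rewrite -(tc _ xg) /gcoef mulr_sumr; apply: eq_bigr => y _ /=.
  rewrite -mulrA; congr (_ * (_ * (_ : bool)%:R)).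
  by apply/eqP/eqP => [<-|->]; rewrite ?mulKg ?mulVKg.
pose D := undup (X ++ [seq x.2 | x <- gmul s t]).
have hD := @gcoef_star_mul (gmul s t) D (undup_uniq _).
have hT := @gcoef_star_mul t X' (undup_uniq _).
have := lev_finite_bound t AR K0 hs; rewrite hD; last first.
  by move=> g gs; rewrite mem_undup mem_cat gs orbT.
rewrite hT; last by rewrite -map_comp map_id.
rewrite /= => h.
have h1 : \sum_(x <- X) normc (lev s f x) ^+ 2 <= \sum_(g <- D) normc (gcoef (gmul s t) g) ^+ 2.
  have -> : \sum_(x <- X) normc (lev s f x) ^+ 2 = \sum_(x <- X) normc (gcoef (gmul s t) x) ^+ 2.
    by apply: eq_big_seq => x xX; rewrite stc.
  rewrite [leRHS](bigID (mem X)) /= ler_wpDr//.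
    by apply: sumr_ge0 => i _; exact: sqr_ge0.
  rewrite -[leRHS]big_filter; apply: eq_ler; apply: perm_big; apply: uniq_perm => //.
    by rewrite filter_uniq// undup_uniq.
  by move=> x; rewrite mem_filter mem_undup mem_cat; case: (x \in X).
apply: le_trans h1 _; apply: le_trans h _; rewrite ler_wpM2l//.
have -> : \sum_(g <- X') normc (gcoef t g) ^+ 2 = \sum_(g <- X') normc (f g) ^+ 2.
  by apply: eq_big_seq => g gX; rewrite tc.
by apply: sum_le_nsq; exact: undup_uniq.
Qed.

Lemma lev_l2norm s N f : approx_reps -> 0 <= N -> ubound s (N ^+ 2) ->
  l2norm (lev s f) <= N * l2norm f.
Proof.
move=> AR N0 hs; apply: l2norm_le; first by rewrite mulr_ge0 ?l2norm_ge0.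
by rewrite exprMn l2norm2; apply: lev_bound; rewrite ?sqr_ge0.
Qed.

Lemma ubound_star s K : 0 <= K -> ubound s K -> ubound (gstar s) K.
Proof. by move=> K0 h k pi up; rewrite mxev_star//; apply: nbound_adj => //; exact: h. Qed.

Lemma ubound_exists s : exists2 M : R, 0 <= M & ubound s M.
Proof.
elim: s => [|x s [M M0 hM]].
  by exists 0 => // k pi _ v; rewrite /mxev big_nil !mul0mx mul0r -[frob2 _]subr0 subr_le0
    /frob2 big1// => i _; rewrite big1// => j _; rewrite mxE normc0 expr0n.
exists (2 * normc x.1 ^+ 2 + 2 * M).
  by have := sqr_ge0 (normc x.1); lra.
move=> k pi up v; rewrite /mxev big_cons mulmxDl mulrDl.
apply: le_trans (frob2D _ _) _; rewrite -scalemxAl frob2Z frob2_unitaryl ?(proj2 up)//.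
by rewrite !mulrA lerD2l -mulrA ler_wpM2l//; exact: hM.
Qed.

End GroupAlgebra.

(** * Density in the group von Neumann algebra *)

Section RightRegular.
Context (R : realType) (F : groupType).
Local Notation C := R[i].
Implicit Types (f : l2 R F) (T : bop R F).

Lemma sqnorm_reindex (e : F -> F) (f : F -> C) : set_bij [set: F] [set: F] e ->
  sqnorm (fun h => f (e h)) = sqnorm f.
Proof. by move=> be; rewrite [RHS](reindex_esum _ _ _ _ be). Qed.

Lemma rsum_reindex (e : F -> F) (a : F -> R) : set_bij [set: F] [set: F] e ->
  rsum (fun h => a (e h)) = rsum a.
Proof.
move=> be; have E (b : F -> \bar R) := reindex_esum _ _ _ b be.
rewrite /rsum [in RHS]E [X in _ = fine (_ - X)%E]E.
by congr (fine (_ - _)%E); apply: eq_esum => x _; rewrite ?funeposE ?funenegE.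
Qed.

Lemma mulr_bij g : set_bij [set: F] [set: F] (fun h => h * g)%g.
Proof.
split=> //; first by move=> ? ? _ _; exact: mulIg.
by move=> h _; exists (h * g^-1)%g => //; rewrite mulgVK.
Qed.

Lemma invg_bij : set_bij [set: F] [set: F] (fun h => h^-1)%g.
Proof.
split=> //; first by move=> ? ? _ _; exact: invg_inj.
by move=> h _; exists h^-1%g => //; rewrite invgK.
Qed.

Lemma rtrans_subproof g f : (fun h => f (h * g)%g) \in @square_summable R F.
Proof. by rewrite inE (sqnorm_reindex f (mulr_bij g)); exact: l2P. Qed.

Definition rtrans g f : l2 R F := L2 (rtrans_subproof g f).

Lemma rtrans_is_linear g : linear (rtrans g).
Proof. by move=> a u v; apply: val_inj. Qed.

HB.instance Definition _ g :=
  GRing.isLinear.Build R[i] (l2 R F) (l2 R F) _ (rtrans g) (rtrans_is_linear g).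

Lemma rtrans_bounded g : exists M : R, forall f, l2norm (rtrans g f) <= M * l2norm f.
Proof. by exists 1 => f; rewrite mul1r /l2norm (sqnorm_reindex f (mulr_bij g)). Qed.

Lemma rtrans_adjP g f f' : inner (rtrans g f) f' = inner f (rtrans g^-1%g f').
Proof.
rewrite /inner /csum -(rsum_reindex (fun h => complex.Re (f h * _)) (mulr_bij g))
  -(rsum_reindex (fun h => complex.Im (f h * _)) (mulr_bij g)) /=.
by congr (_ +i* _); congr rsum; apply/funext => h; rewrite mulgK.
Qed.

Definition rregrep g : bop R F :=
  @Bop R F (rtrans g) (rtrans g^-1%g) (rtrans_bounded g) (rtrans_bounded _)
    (rtrans_adjP g).

(** The bicommutant enters only through this commutation with the right regular representation, a
    property stable under adjoints and products. *)
Definition right_invariant T := forall g f, op T (rtrans g f) = rtrans g (op T f).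

Lemma group_vN_right_invariant T : group_vN R F T -> right_invariant T.
Proof.
move=> hT g f; apply: (hT (rregrep g)) => _ [h _ <-] f' /=.
by apply: l2_ext => x /=; rewrite /translate /= mulgA.
Qed.

Lemma delta_rtrans g : delta g = rtrans g^-1%g (delta 1%g) :> l2 R F.
Proof.
apply: l2_ext => x; rewrite deltaE /= .
by congr ((_ : bool)%:R); apply/eqP/eqP => [->|e]; [rewrite mulgV | rewrite -[x](mulgVK g) e mul1g].
Qed.

Lemma adj_coord T f g : (adj T f) g = inner f (op T (delta g)).
Proof. by rewrite -(inner_delta (adj T f) g) bstar_adjP. Qed.

Lemma right_invariant_star T : right_invariant T -> right_invariant (bstar T).
Proof.
move=> hT g f; apply: l2_ext => x /=.
rewrite !adj_coord rtrans_adjP -hT; congr (inner f (op T _)).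
apply: l2_ext => y; rewrite !deltaE /=; congr ((_ : bool)%:R).
by apply/eqP/eqP => [<-|->]; rewrite ?mulgVK ?mulgK.
Qed.

Lemma right_invariant_mul S T :
  right_invariant S -> right_invariant T -> right_invariant (bmul S T).
Proof. by move=> hS hT g f /=; rewrite hT hS. Qed.

Lemma right_invariant_one : right_invariant (bone R F).
Proof. by []. Qed.

Lemma right_invariant_regrep g : right_invariant (regrep R g).
Proof. by move=> h f; apply: l2_ext => x /=; rewrite /translate /= mulgA. Qed.

Lemma flip_subproof f : (fun h => (f h^-1%g)^*) \in @square_summable R F.
Proof.
rewrite inE; have -> : sqnorm (fun h => (f h^-1%g)^*) = sqnorm (fun h => f h^-1%g).
  by apply: eq_esum => h _; rewrite normcJ2.
by rewrite (sqnorm_reindex f invg_bij); exact: l2P.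
Qed.

(** The modular conjugation: it maps [x delta] to [x^* delta]. *)
Definition flip f : l2 R F := L2 (flip_subproof f).

Lemma flipE f g : flip f g = (f g^-1%g)^*.
Proof. by []. Qed.

Lemma flipK f : flip (flip f) = f.
Proof. by apply: l2_ext => g; rewrite !flipE conjcK invgK. Qed.

Lemma flipB f f' : flip (f - f') = flip f - flip f'.
Proof. by apply: l2_ext => g; rewrite l2D l2N !flipE l2D l2N rmorphB. Qed.

Lemma l2norm_flip f : l2norm (flip f) = l2norm f.
Proof.
rewrite /l2norm; congr (Num.sqrt (fine _)).
have -> : sqnorm (flip f) = sqnorm (fun h => f h^-1%g).
  by apply: eq_esum => h _; rewrite flipE normcJ2.
exact: sqnorm_reindex invg_bij.
Qed.

Lemma right_invariant_flip T : right_invariant T ->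
  adj T (delta 1%g) = flip (op T (delta 1%g)).
Proof.
move=> hT; apply: l2_ext => g; rewrite flipE adj_coord inner_conj inner_delta.
by rewrite delta_rtrans hT /= mul1g.
Qed.

(** The modular conjugation reverses products: a right factor becomes a left one, whose operator
    norm can then be used. *)
Lemma mul_flip S T : right_invariant S -> right_invariant T ->
  op S (op T (delta 1%g)) = flip (adj T (adj S (delta 1%g))).
Proof.
move=> hS hT; have := right_invariant_flip (right_invariant_mul hS hT).
by move=> /= ->; rewrite flipK.
Qed.

Lemma flip_sum (X : Type) (r : seq X) (c : X -> C) (G : X -> l2 R F) :
  flip (\sum_(x <- r) c x *: G x) = \sum_(x <- r) (c x)^* *: flip (G x).
Proof.
apply: l2_ext => g; rewrite flipE !l2_sum rmorph_sum; apply: eq_bigr => x _.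
by rewrite !l2Z flipE rmorphM.
Qed.

Lemma lev_flip (s : seq (C * F)) T : right_invariant T ->
  lev s (op T (delta 1%g)) = flip (adj T (lev (gstar s) (delta 1%g))).
Proof.
move=> hT.
have -> : adj T (lev (gstar s) (delta 1%g)) =
    \sum_(x <- gstar s) x.1 *: adj T (ltrans x.2 (delta 1%g)).
  by rewrite /lev raddf_sum; apply: eq_bigr => x _; exact: linearZ.
have E x : ltrans x (op T (delta 1%g)) = flip (adj T (ltrans x^-1%g (delta 1%g))).
  exact: (mul_flip (right_invariant_regrep x) hT).
by rewrite flip_sum big_map; apply: eq_bigr => x _; rewrite E; congr (_ *: _); exact: esym (conjcK _).
Qed.

Lemma lev_star_delta (s : seq (C * F)) :
  lev (gstar s) (delta 1%g) = flip (lev s (delta 1%g)).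
Proof. by have := lev_flip s right_invariant_one => /= ->; rewrite flipK. Qed.

Definition bounded_by T (N : R) :=
  (forall f, l2norm (op T f) <= N * l2norm f) /\
  (forall f, l2norm (adj T f) <= N * l2norm f).

Lemma bounded_by_star T N : bounded_by T N -> bounded_by (bstar T) N.
Proof. by case. Qed.

Lemma bounded_by_mul S T M N : 0 <= M -> 0 <= N ->
  bounded_by S M -> bounded_by T N -> bounded_by (bmul S T) (M * N).
Proof.
move=> M0 N0 [hS hS'] [hT hT']; split=> f /=.
  by apply: le_trans (hS _) _; rewrite -mulrA ler_wpM2l.
by apply: le_trans (hT' _) _; rewrite [M * N]mulrC -mulrA ler_wpM2l.
Qed.

Lemma bounded_by_exists T : exists2 N, 0 < N & bounded_by T N.
Proof.
have [M hM] := op_bounded T; have [M' hM'] := adj_bounded T.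
exists (`|M| + `|M'| + 1); first by rewrite ltr_wpDl// addr_ge0.
by split=> f; [apply: le_trans (hM f) _ | apply: le_trans (hM' f) _];
  rewrite ler_wpM2r ?l2norm_ge0//; have := ler_norm M; have := ler_norm M';
  have := normr_ge0 M; have := normr_ge0 M'; lra.
Qed.

(** The trace inequality [||x z||_2 <= ||z|| ||x||_2] for [x = S - s]. *)
Lemma diff_mul_bound S (s : seq (C * F)) T N :
  right_invariant S -> right_invariant T -> bounded_by T N -> 0 <= N ->
  l2norm (op S (op T (delta 1%g)) - lev s (op T (delta 1%g))) <=
  N * l2norm (op S (delta 1%g) - lev s (delta 1%g)).
Proof.
move=> hS hT [_ bT] N0; rewrite (mul_flip hS hT) (lev_flip _ hT) -flipB l2norm_flip.
rewrite -raddfB; apply: le_trans (bT _) _; rewrite ler_wpM2l//.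
by rewrite (right_invariant_flip hS) lev_star_delta -flipB l2norm_flip.
Qed.

Lemma diff_star S (s : seq (C * F)) : right_invariant S ->
  l2norm (adj S (delta 1%g) - lev (gstar s) (delta 1%g)) =
  l2norm (op S (delta 1%g) - lev s (delta 1%g)).
Proof. by move=> hS; rewrite (right_invariant_flip hS) lev_star_delta -flipB l2norm_flip. Qed.

End RightRegular.

Section Moments.
Context (R : realType) (F : groupType) (J : finType).
Local Notation C := R[i].
Context (z : J -> bop R F) (s : J -> seq (C * F)) (N d : R).

Definition gletter (a : J * bool) : seq (C * F) := if a.2 then gstar (s a.1) else s a.1.
Definition galg_word (w : seq (J * bool)) : seq (C * F) :=
  foldr (fun a X => gmul (gletter a) X) (gone R F) w.
Definition bletter (a : J * bool) : bop R F := if a.2 then bstar (z a.1) else z a.1.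

Hypothesis AR : approx_reps R F.
Hypothesis N1 : 1 <= N.
Hypothesis d0 : 0 <= d.
Hypothesis zinv : forall j, right_invariant (z j).
Hypothesis zbd : forall j, bounded_by (z j) N.
Hypothesis sbd : forall j, ubound (s j) (N ^+ 2).
Hypothesis zs : forall j, l2norm (op (z j) (delta 1%g) - lev (s j) (delta 1%g)) <= d.

Lemma bop_word_cons a w : bop_word z (a :: w) = bmul (bletter a) (bop_word z w).
Proof. by []. Qed.

Lemma bletter_inv a : right_invariant (bletter a).
Proof. by case: a => j []; rewrite /bletter /=; [apply: right_invariant_star|]; exact: zinv. Qed.

Lemma bop_word_inv w : right_invariant (bop_word z w).
Proof. by elim: w => // a w IH; rewrite bop_word_cons; apply: right_invariant_mul => //; exact: bletter_inv. Qed.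

Let N0 : 0 <= N. Proof. by apply: le_trans N1. Qed.

Lemma bop_word_bounded w : bounded_by (bop_word z w) (N ^+ size w).
Proof.
elim: w => [|a w IH]; first by split=> f /=; rewrite mul1r.
rewrite bop_word_cons exprS; apply: bounded_by_mul => //; first exact: exprn_ge0.
by case: a => j []; rewrite /bletter /=; [apply: bounded_by_star|]; exact: zbd.
Qed.

(** Letters are replaced one at a time. The error of the first letter stands to the left of the
    bounded operator [W], where [diff_mul_bound] applies; the error of the tail stands to the right
    of [gletter a], which [ubound] controls. So 2-norm closeness of the letters suffices once their
    operator norms are under control. *)
Lemma word_approx w :
  l2norm (op (bop_word z w) (delta 1%g) - lev (galg_word w) (delta 1%g)) <=
  (size w)%:R * N ^+ size w * d.
Proof.
elim: w => [|a w IH]; first by rewrite /= lev_one subrr l2norm0 !mul0r.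
rewrite bop_word_cons /= lev_mul.
set W := bop_word z w; set S := galg_word w.
have -> : bletter a (W (delta 1%g)) - lev (gletter a) (lev S (delta 1%g)) =
   (op (bletter a) (op W (delta 1%g)) - lev (gletter a) (op W (delta 1%g))) +
   lev (gletter a) (op W (delta 1%g) - lev S (delta 1%g)).
  by rewrite levB addrA subrK.
apply: le_trans (l2_triangle _ _) _.
have h1 := diff_mul_bound (gletter a) (bletter_inv a) (bop_word_inv w) (bop_word_bounded w)
   (exprn_ge0 _ N0).
have h2 : l2norm (op (bletter a) (delta 1%g) - lev (gletter a) (delta 1%g)) <= d.
  by case: (a) => j []; rewrite /bletter /gletter /= ?diff_star.
have h3 : ubound (gletter a) (N ^+ 2).
  by case: (a) => j []; rewrite /gletter /=; [apply: ubound_star; first exact: sqr_ge0|]; exact: sbd.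
have h4 := lev_l2norm (op W (delta 1%g) - lev S (delta 1%g)) AR N0 h3.
have n0 : 0 <= N ^+ size w := exprn_ge0 _ N0.
have h5 : N ^+ size w * l2norm (op (bletter a) (delta 1%g) - lev (gletter a) (delta 1%g))
   <= N * N ^+ size w * d.
  apply: (@le_trans _ _ (N ^+ size w * d)); first exact: ler_wpM2l.
  by rewrite ler_wpM2r// ler_peMl.
have h6 : N * l2norm (op W (delta 1%g) - lev S (delta 1%g)) <=
    N * ((size w)%:R * N ^+ size w * d) by exact: ler_wpM2l.
rewrite -natr1 exprS.
apply: le_trans (lerD (le_trans h1 h5) (le_trans h4 h6)) _.
by apply: eq_ler; ring.
Qed.

Lemma trace_word_approx w :
  normc (group_trace R F (bop_word z w) - gcoef (galg_word w) 1%g) <=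
  (size w)%:R * N ^+ size w * d.
Proof.
apply: le_trans (word_approx w); rewrite /group_trace inner_delta -lev_delta.
exact: normc_le_l2norm (op _ _ - lev _ _) 1%g.
Qed.

Lemma mxev_word k (pi : F -> 'M[C]_k) w : urep pi ->
  mxev pi (galg_word w) = mx_word (fun j => mxev pi (s j)) w.
Proof.
move=> up; elim: w => [|[j b] w IH] /=; first by rewrite mxev_one.
by rewrite mxev_mul// IH /gletter; case: b => //=; rewrite mxev_star.
Qed.

End Moments.

(** * Kaplansky density by damping with a rational function of [t t^*] *)

Section Kaplansky.
Context (R : realType) (F : groupType).
Local Notation C := R[i].
Local Open Scope sesquilinear_scope.
Implicit Types (s t : seq (C * F)).

(** The alternating product [t t^* t ...] with [m] factors; for [m = 2 j] it is the [j]-th power of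
    [t t^*]. *)
Fixpoint galt t m := if m is m'.+1 then gmul (galt t m') (if odd m' then gstar t else t)
  else gone R F.

Fixpoint geom s l := if l is l'.+1 then gone R F ++ gmul s (geom s l') else [::].

Lemma lev_geom s l f :
  lev (geom s l) (f - lev s f) = f - iter l (lev s) f.
Proof.
elim: l => [|l IH]; first by rewrite subrr /lev big_nil.
rewrite -[geom s l.+1]/(gone R F ++ gmul s (geom s l)) iterS.
by rewrite lev_cat lev_one lev_mul IH levB addrA subrK.
Qed.

Fixpoint rgeom (x : R) l := if l is l'.+1 then 1 + x * rgeom x l' else 0.

Lemma rgeom_bound (x : R) l : 0 <= x < 1 -> 0 <= rgeom x l <= (1 - x)^-1.
Proof.
move=> /andP[x0 x1]; have p : 0 < 1 - x by lra.
elim: l => [|l /andP[h1 h2]] /=; first by rewrite lexx invr_ge0 ltW.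
rewrite addr_ge0 ?mulr_ge0//=; apply: (@le_trans _ _ (1 + x * (1 - x)^-1)).
  by rewrite lerD2l ler_wpM2l.
by apply: eq_ler; field; rewrite gt_eqF.
Qed.

Lemma mxev_geom k (pi : F -> 'M[C]_k) (P : 'M[C]_k) s (h : 'I_k -> R) l :
  urep pi -> P \is unitarymx -> mxev pi s = dmx P (fun i => (h i)%:C) ->
  mxev pi (geom s l) = dmx P (fun i => (rgeom (h i) l)%:C).
Proof.
move=> up uP e; elim: l => [|l IH].
  rewrite /mxev big_nil /= -(scale0r (dmx P (fun=> 0))) dmxZ.
  by apply: eq_dmx => i; rewrite mul0r.
rewrite -[geom s l.+1]/(gone R F ++ gmul s (geom s l)).
rewrite mxev_cat (mxev_one up) (mxev_mul _ _ up) e IH (dmxM _ _ uP) -(dmx1 uP) dmxD.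
by apply: eq_dmx => i /=; rewrite rmorphD rmorphM rmorph1.
Qed.

Lemma galt_even k (pi : F -> 'M[C]_k) t j : urep pi ->
  mxev pi (galt t j.*2) = iter j (mulmx (mxev pi t *m (mxev pi t)^t*)) 1%:M.
Proof.
move=> up; elim: j => [|j IH] /=; first by rewrite mxev_one.
rewrite odd_double /= !mxev_mul// mxev_star// IH -mulmxA.
elim: (j) => [|j' IH'] /=; first by rewrite mul1mx mulmx1.
by rewrite -mulmxA IH'.
Qed.

Lemma iter_mul_dmx k (P : 'M[C]_k) (h : 'I_k -> R) j : P \is unitarymx ->
  iter j (mulmx (dmx P (fun i => (h i)%:C))) 1%:M = dmx P (fun i => (h i ^+ j)%:C).
Proof.
by move=> uP; rewrite (iter_dmx _ _ uP); apply: eq_dmx => i; rewrite rmorphXn.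
Qed.

(** With [x = t / c^2], the weight [p = 1 / (1 + x^n)] satisfies
    [p^2 x^m <= 1] as long as [m <= 2 n]. *)
Lemma damped_power_le (x p : R) n m : 0 <= x -> 0 <= p <= (1 + x ^+ n)^-1 ->
  (m <= n.*2)%N -> p ^+ 2 * x ^+ m <= 1.
Proof.
move=> x0 /andP[p0 p1] mn; have q0 : 0 < 1 + x ^+ n by rewrite ltr_pwDl// exprn_ge0.
have h1 : p * (1 + x ^+ n) <= 1 by rewrite -ler_pdivlMr// div1r.
have h2 : x ^+ m <= (1 + x ^+ n) ^+ 2.
  have xn := exprn_ge0 n x0.
  have [x1|x1] := leP x 1.
    apply: (@le_trans _ _ 1); first exact: exprn_ile1.
    by rewrite expr2; nra.
  apply: (@le_trans _ _ (x ^+ n.*2)); first by rewrite ler_weXn2l// ltW.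
  by rewrite -muln2 exprM ler_pXn2r ?nnegrE ?lerDr// addr_ge0.
apply: (@le_trans _ _ (p ^+ 2 * (1 + x ^+ n) ^+ 2)).
  by rewrite ler_wpM2l ?sqr_ge0.
by rewrite -exprMn exprn_ile1// mulr_ge0// ltW.
Qed.

Section Construction.
Context (t : seq (C * F)) (c M : R) (n l : nat).
Hypothesis c0 : 0 < c.
Hypothesis M0 : 0 <= M.
Hypothesis tM : ubound (gstar t) M.

Let U : R := (M / c ^+ 2) ^+ n.
Let U0 : 0 <= U. Proof. by rewrite exprn_ge0// divr_ge0// sqr_ge0. Qed.

(** [kv] is the [n]-th power of [t t^* / c^2], with spectrum in [[0, U]]. The wanted damping factor
    is the inverse of [1 + kv], which need not lie in the group algebra. Since [1 - krho] is
    [(1 + kv) / (1 + U)] and [krho] has norm below 1, a partial Neumann sum [kp] takes its place. *)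
Definition kv := gscale ((c ^+ n.*2)^-1)%:C (galt t n.*2).
Definition krho := gscale (U / (1 + U))%:C (gone R F) ++ gscale (- (1 + U)^-1)%:C kv.
Definition kp := gscale ((1 + U)^-1)%:C (geom krho l).

Lemma kaplansky_diag k (pi : F -> 'M[C]_k) : urep pi ->
  exists2 P : 'M[C]_k, P \is unitarymx & exists x r p : 'I_k -> R,
  [/\ forall i, [/\ 0 <= x i, 0 <= r i <= U / (1 + U) & 0 <= p i <= (1 + x i ^+ n)^-1],
      mxev pi t *m (mxev pi t)^t* = dmx P (fun i => (c ^+ 2 * x i)%:C),
      mxev pi krho = dmx P (fun i => (r i)%:C) &
      mxev pi kp = dmx P (fun i => (p i)%:C)].
Proof.
move=> up; have hY : nbound ((mxev pi t)^t*) M by rewrite -mxev_star//; exact: tM.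
have [P uP [h hh e]] := gram_dmx hY.
exists P => //; pose x i := h i / c ^+ 2.
have c2 : 0 < c ^+ 2 by rewrite exprn_gt0.
have hx i : h i = c ^+ 2 * x i by rewrite /x mulrC divfK// gt_eqF.
have x0 i : 0 <= x i by rewrite divr_ge0 ?(ltW c2)//; case/andP: (hh i).
have xU i : x i ^+ n <= U.
  apply: lerXn2r; rewrite ?nnegrE// ?divr_ge0 ?(ltW c2)//.
  by rewrite ler_wpM2r ?invr_ge0 ?(ltW c2)//; case/andP: (hh i).
pose r i := U / (1 + U) - (1 + U)^-1 * x i ^+ n.
have U1 : 0 < 1 + U by rewrite ltr_pwDl.
have rE i : 1 - r i = (1 + x i ^+ n) / (1 + U) by rewrite /r; field; rewrite gt_eqF.
have hr i : 0 <= r i <= U / (1 + U).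
  apply/andP; split; last by rewrite gerBl mulr_ge0 ?exprn_ge0// invr_ge0 ltW.
  have -> : r i = (U - x i ^+ n) / (1 + U) by rewrite /r; field; rewrite gt_eqF.
  by rewrite divr_ge0 ?subr_ge0// ltW.
pose p i := (1 + U)^-1 * rgeom (r i) l.
have e2 : mxev pi kv = dmx P (fun i => (x i ^+ n)%:C).
  rewrite /kv mxev_scale (galt_even _ _ up) e (iter_mul_dmx _ _ uP) dmxZ; apply: eq_dmx => i.
  rewrite -rmorphM hx exprMn -exprM mul2n mulKf//.
  by rewrite expf_neq0// gt_eqF.
have e3 : mxev pi krho = dmx P (fun i => (r i)%:C).
  rewrite /krho mxev_cat mxev_scale (mxev_one up) mxev_scale e2 -(dmx1 uP) !dmxZ dmxD.
  by apply: eq_dmx => i; rewrite mulr1 -rmorphM -rmorphD mulNr.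
exists x, r, p; split; [| | exact: e3 |].
- move=> i; split; [exact: x0 | exact: hr |]; have /andP[r0 r1] := hr i.
  have xn := exprn_ge0 n (x0 i).
  have rl : r i < 1 by rewrite -subr_gt0 rE divr_gt0// ltr_pwDl.
  have /andP[g0 g1] : 0 <= rgeom (r i) l <= (1 - r i)^-1.
    by apply: rgeom_bound; rewrite r0.
  rewrite /p mulr_ge0 ?invr_ge0 ?(ltW U1) //=.
  apply: (@le_trans _ _ ((1 + U)^-1 * (1 - r i)^-1)).
    by rewrite ler_wpM2l// invr_ge0 ltW.
  rewrite rE; apply: eq_ler; field.
  by rewrite !gt_eqF// ltr_pwDl.
- by rewrite e; apply: eq_dmx => i; rewrite hx.
rewrite /kp mxev_scale (mxev_geom l up uP e3) dmxZ.
by apply: eq_dmx => i; rewrite -rmorphM.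
Qed.

Lemma ubound_krho : ubound krho ((U / (1 + U)) ^+ 2).
Proof.
move=> k pi up; have [P uP [x [r [p [h _ -> _]]]]] := kaplansky_diag up.
apply: nbound_dmx => // i; have [_ /andP[r0 r1] _] := h i.
by rewrite normc_real ger0_norm// ler_pXn2r ?nnegrE// (le_trans r0).
Qed.

Lemma galt_odd k (pi : F -> 'M[C]_k) j : urep pi ->
  mxev pi (galt t j.*2.+1) = mxev pi (galt t j.*2) *m mxev pi t.
Proof. by move=> up; rewrite [galt _ _]/= odd_double mxev_mul. Qed.

(** In an eigenbasis of [t t^*] this is [damped_power_le]. For odd [m] the leftover factor [t] is
    not diagonal; passing to the adjoint and applying [frob2_gram] replaces it by the square root of
    [t t^*]. *)
Lemma ubound_kp_galt m : (m <= n.*2)%N -> ubound (gmul kp (galt t m)) ((c ^+ m) ^+ 2).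
Proof.
move=> mn k pi up; have [P uP [x [r [p [h e1 _ e2]]]]] := kaplansky_diag up.
rewrite mxev_mul// e2.
have eE j : mxev pi (galt t j.*2) = dmx P (fun i => ((c ^+ 2 * x i) ^+ j)%:C).
  by rewrite (galt_even _ _ up) e1 iter_mul_dmx.
have key i : p i ^+ 2 * (c ^+ 2 * x i) ^+ m <= (c ^+ m) ^+ 2.
  have [x0 _ hp] := h i; rewrite exprMn -exprM mulnC exprM mulrCA.
  apply: ler_piMr; first by rewrite exprn_ge0 ?sqr_ge0.
  exact: damped_power_le x0 hp mn.
case: (boolP (odd m)) => om; last first.
  have mE : m = m./2.*2 by rewrite -[LHS]odd_double_half (negPf om).
  rewrite {1}mE eE (dmxM _ _ uP); apply: nbound_dmx => // i.
  rewrite -rmorphM normc_real real_normK ?num_real// exprMn.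
  by rewrite -[(_ ^+ m./2) ^+ 2]exprM muln2 -mE.
have mE : m = m./2.*2.+1 by rewrite -[LHS]odd_double_half om.
rewrite {1}mE galt_odd// eE mulmxA (dmxM _ _ uP); set D := dmx _ _; set Y := mxev pi t.
rewrite -[D *m Y]trmxCK; apply: nbound_adj; first exact: sqr_ge0.
rewrite tmulmx => v; rewrite -mulmxA.
pose q i := Num.sqrt (c ^+ 2 * x i).
have hq i : q i ^+ 2 = c ^+ 2 * x i.
  by rewrite sqr_sqrtr// mulr_ge0 ?sqr_ge0//; case: (h i).
have eg : Y *m Y^t* = dmx P (fun i => (q i)%:C) *m (dmx P (fun i => (q i)%:C))^t*.
  rewrite e1 dmx_tr (dmxM _ _ uP); apply: eq_dmx => i.
  by rewrite conjc_real -rmorphM -expr2 hq.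
rewrite (frob2_gram _ eg) dmx_tr.
rewrite mulmxA /D dmx_tr (dmxM _ _ uP).
apply: (nbound_dmx uP _ v) => i; rewrite normcM !normcJ2 -normcM -!rmorphM normc_real real_normK ?num_real//.
apply: le_trans (key i); apply: eq_ler.
rewrite 2!exprMn hq; set z := c ^+ 2 * x i.
have -> : z ^+ m = (z ^+ m./2) ^+ 2 * z by rewrite -exprM muln2 -exprSr -mE.
by ring.
Qed.

End Construction.


Lemma truncate_l2 (xi : l2 R F) (d : R) : 0 < d ->
  exists t, l2norm (lev t (delta 1%g) - xi) <= d.
Proof.
move=> d0; have [|X uX hX] := @nsq_approx _ _ xi (d ^+ 2); first exact: exprn_gt0.
pose t : seq (C * F) := [seq (xi h, h) | h <- X].
have tc g : lev t (delta 1%g) g = if g \in X then xi g else 0.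
  rewrite lev_delta /gcoef big_map /=; case: ifPn => gX.
    rewrite (bigD1_seq g)//= eqxx mulr1 big1 ?addr0//.
    by move=> h /negPf ->; rewrite mulr0.
  rewrite big1_seq// => h /andP[_ hX']; have [hg|] := eqVneq h g; last by rewrite mulr0.
  by rewrite hg (negPf gX) in hX'.
exists t; apply: l2norm_le; first exact: ltW.
apply: nsq_le => s us; pose s' := [seq g <- s | g \notin X].
have -> : \sum_(g <- s) normc ((lev t (delta 1%g) - xi) g) ^+ 2 =
    \sum_(g <- s') normc (xi g) ^+ 2.
  rewrite big_filter [RHS]big_mkcond; apply: eq_bigr => g _.
  rewrite l2D l2N tc; case: (g \in X) => /=; first by rewrite subrr normc0 expr0n.
  by rewrite sub0r normcN.
have : \sum_(g <- X ++ s') normc (xi g) ^+ 2 <= nsq xi.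
  apply: sum_le_nsq; rewrite cat_uniq uX filter_uniq// andbT.
  by apply/hasPn => g; rewrite mem_filter => /andP[].
by rewrite big_cat /=; lra.
Qed.

(** Reading [galt t (n.*2)] from the right, the factor multiplied to [bgalt y i]
    to obtain [bgalt y i.+1] is the one matching the parity of [i]. *)
Fixpoint bgalt (y : bop R F) i := if i is i'.+1 then
  bmul (if odd i' then y else bstar y) (bgalt y i') else y.

Lemma bgalt_inv y i : right_invariant y -> right_invariant (bgalt y i).
Proof.
move=> hy; elim: i => //= i IH; apply: right_invariant_mul => //.
by case: (odd i) => //; exact: right_invariant_star.
Qed.

Lemma bgalt_bounded y N i : 0 <= N -> bounded_by y N -> bounded_by (bgalt y i) (N ^+ i.+1).
Proof.
move=> N0 hy; elim: i => [|i IH] /=; first by rewrite expr1.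
rewrite exprS; apply: bounded_by_mul => //; first exact: exprn_ge0.
by case: (odd i) => //; exact: bounded_by_star.
Qed.

(** The norm of [t] depends on the quality of the approximation, so exchanging [t] for [y] factor by
    factor is out of control by itself. The damping factor [q] on the left cures this: every
    remaining prefix [gmul q (galt t m)] has norm at most [c^m], however large [t] is, and the
    suffix consists of copies of [y] and its adjoint. *)
Lemma galt_telescope y t q N c n (d : R) :
  approx_reps R F -> right_invariant y -> 0 < N -> c = 2 * N -> bounded_by y N -> 0 <= d ->
  (forall m, (m <= n.*2)%N -> ubound (gmul q (galt t m)) ((c ^+ m) ^+ 2)) ->
  l2norm (lev t (delta 1%g) - op y (delta 1%g)) <= d ->
  forall i, (i <= n.*2)%N ->
  l2norm (lev (gmul q (galt t n.*2)) (op y (delta 1%g))) <=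
  i%:R * c ^+ n.*2 * d +
    l2norm (lev (gmul q (galt t (n.*2 - i))) (op (bgalt y i) (delta 1%g))).
Proof.
move=> AR hy N0 cE yN d0 hq hd; have c0 : 0 < c by rewrite cE mulr_gt0.
elim=> [|i IH] hi; first by rewrite subn0 !mul0r add0r.
apply: le_trans (IH (ltnW hi)) _.
rewrite -natr1 2!mulrDl -addrA lerD2l mul1r.
have e : (n.*2 - i = (n.*2 - i.+1).+1)%N by rewrite subnSK.
set m := (n.*2 - i.+1)%N in e *.
have om : odd m = ~~ odd i.
  have : odd (m + i.+1) = false by rewrite /m subnK// odd_double.
  by rewrite oddD /=; case: (odd m); case: (odd i).
rewrite e /= om; set L := gmul q (galt t m).
set xl := if ~~ odd i then _ else _; set xy := if odd i then y else _.
set zi := op (bgalt y i) (delta 1%g).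
have -> : lev (gmul q (gmul (galt t m) xl)) zi =
    lev L (lev xl zi - op xy zi) + lev L (op xy zi).
  by rewrite levB subrK /L !lev_mul.
apply: le_trans (l2_triangle _ _) _; rewrite lerD2r.
have hm : (m <= n.*2)%N by rewrite leq_subr.
apply: le_trans (lev_l2norm _ AR (exprn_ge0 m (ltW c0)) (hq m hm)) _.
have hxy : right_invariant xy.
  by rewrite /xy; case: (odd i) => //; exact: right_invariant_star.
have hx : l2norm (op xy (delta 1%g) - lev xl (delta 1%g)) <= d.
  rewrite /xy /xl; case: (odd i) => /=; last rewrite (diff_star _ hy);
  by rewrite -l2normN opprB.
have h1 := diff_mul_bound xl hxy (bgalt_inv i hy) (bgalt_bounded i (ltW N0) yN)
  (exprn_ge0 _ (ltW N0)).
rewrite -[leLHS]mulr1 -[X in _ * X * _]l2normN opprB mulr1.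
apply: (@le_trans _ _ (c ^+ m * (N ^+ i.+1 * d))).
  rewrite ler_wpM2l ?exprn_ge0 ?(ltW c0)//; apply: le_trans h1 _.
  by rewrite ler_wpM2l ?exprn_ge0 ?(ltW N0).
rewrite mulrA ler_wpM2r//.
have -> : c ^+ n.*2 = c ^+ m * c ^+ i.+1 by rewrite -exprD /m subnK.
rewrite ler_wpM2l ?exprn_ge0 ?(ltW c0)//.
by apply: lerXn2r; rewrite ?nnegrE ?(ltW c0) ?(ltW N0)// cE; lra.
Qed.

(** Kaplansky's density theorem, with norms in the universal C*-algebra of [F]
    rather than in the reduced one. *)
Lemma kaplansky_density y N d : approx_reps R F -> right_invariant y ->
  0 < N -> bounded_by y N -> 0 < d ->
  exists2 s : seq (C * F), ubound s ((2 * N) ^+ 2) &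
    l2norm (op y (delta 1%g) - lev s (delta 1%g)) <= d.
Proof.
move=> AR hy N0 yN d0; pose c := 2 * N; have c0 : 0 < c by rewrite mulr_gt0.
have geo (q A e : R) : 0 <= q < 1 -> 0 < A -> 0 < e -> exists l, q ^+ l * A <= e.
  move=> /andP[q0 q1] A0 e0.
  have := @cvg_geometric R A q; rewrite ger0_norm// => /(_ q1) /cvgrPdist_le /(_ _ e0) [l _ hl].
  exists l; have := hl l (leqnn l); rewrite sub0r normrN /geometric /= mulrC.
  by rewrite ger0_norm// mulr_ge0 ?exprn_ge0// ltW.
have d4 : 0 < d / 4 by rewrite divr_gt0.
(* The choices are made in the order [n], [d1], [t], [M], [l]: the bound [M] is known only after
   [t], and [l] is the one parameter still free to absorb it. *)
have [n n1 hn] : exists2 n, (0 < n)%N & (4^-1) ^+ n * N <= d / 4.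
  have [|n hn] := geo 4^-1 N (d / 4) _ N0 d4; first by apply/andP; split; lra.
  exists n.+1 => //; apply: le_trans hn; rewrite ler_wpM2r ?(ltW N0)// exprS.
  by rewrite ler_piMl ?exprn_ge0//; lra.
pose d1 := d / 4 / (n.*2.+1)%:R; have d10 : 0 < d1 by rewrite divr_gt0.
have [t ht] := truncate_l2 (op y (delta 1%g)) d10.
have [M M0 hM] := ubound_exists (gstar t).
pose U := (M / c ^+ 2) ^+ n; have U0 : 0 <= U by rewrite exprn_ge0// divr_ge0// sqr_ge0.
have U1 : 0 < 1 + U by rewrite ltr_pwDl.
pose q := U / (1 + U); have q01 : 0 <= q < 1.
  by rewrite divr_ge0 ?(ltW U1)//= ltr_pdivrMr// mul1r ltrDr.
have [l hl] := geo q N (d / 4) q01 N0 d4.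
pose p := kp t c M n l; pose r := krho t c M n; pose v := kv t c n.
have pg m : (m <= n.*2)%N -> ubound (gmul p (galt t m)) ((c ^+ m) ^+ 2).
  exact: ubound_kp_galt.
have rb : ubound r (q ^+ 2) by exact: ubound_krho.
exists (gmul p t).
  move=> k pi up; have n12 : (1 <= n.*2)%N by rewrite -addnn ltn_addr.
  have := pg 1%N n12 k pi up; rewrite expr1 [galt t 1]/= !(mxev_mul _ _ up).
  by rewrite (mxev_one up) mul1mx.
set xi := op y (delta 1%g).
have xiN : l2norm xi <= N.
  by apply: le_trans (proj1 yN _) _; rewrite -[leRHS]mulr1 ler_wpM2l ?(ltW N0)// l2norm_delta.
(* The partial geometric sum: [kp (1 + kv) = 1 - krho^l], applied to [xi]. *)
have pv : lev p (xi + lev v xi) = xi - iter l (lev r) xi.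
  have <- := lev_geom r l xi.
  rewrite /p /kp lev_scale -levZ; congr lev.
  rewrite /r /krho lev_cat (lev_scale _ (gone R F)) lev_one (lev_scale _ (kv t c n)) -/v -/U.
  have E : (U / (1 + U))%:C = 1 - ((1 + U)^-1)%:C.
    by rewrite -(rmorph1 (real_complex R)) -rmorphB; congr (_%:C); field; rewrite gt_eqF.
  by apply: l2_ext => g; rewrite !(l2D, l2N, l2Z) E rmorphN; ring.
have -> : xi - lev (gmul p t) (delta 1%g) =
   lev p (xi - lev t (delta 1%g)) + (lev p (lev v xi) + iter l (lev r) xi).
  rewrite lev_mul levB.
  have -> : lev p (lev v xi) = xi - iter l (lev r) xi - lev p xi.
    by rewrite -pv levD addrC addKr.
  by apply: l2_ext => g; rewrite !(l2D, l2N); ring.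
have pb f : l2norm (lev p f) <= l2norm f.
  have := pg 0%N (leq0n _); rewrite expr0 => p0.
  have := lev_l2norm f AR ler01 p0.
  by rewrite lev_mul lev_one mul1r.
have b1 : l2norm (lev p (xi - lev t (delta 1%g))) <= d / 4.
  apply: le_trans (pb _) _; rewrite -l2normN opprB; apply: le_trans ht _.
  by rewrite /d1 ler_piMr ?(ltW d4)// invf_le1 ?ler1n ?ltr0n.
have b3 : l2norm (iter l (lev r) xi) <= d / 4.
  apply: le_trans hl; elim: (l) => [|l' IH] /=; first by rewrite mul1r.
  have /andP[q0 _] := q01.
  apply: le_trans (lev_l2norm _ AR q0 rb) _; rewrite exprS -mulrA.
  by rewrite ler_wpM2l.
(* With [y] in place of [t] the vector has norm at most [N^(2 n + 1)], and division by [c^(2 n)]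
   with [c = 2 N] leaves [4^(-n) N]. This is where the factor 2 is spent. *)
have b2 : l2norm (lev p (lev v xi)) <= d / 4 + d / 4.
  have c2n : 0 < c ^+ n.*2 by rewrite exprn_gt0.
  rewrite /v /kv lev_scale levZ -lev_mul; apply: le_trans (l2normZ _ _) _.
  rewrite normc_real ger0_norm ?invr_ge0 ?(ltW c2n)// ler_pdivrMl//.
  apply: le_trans (galt_telescope AR hy N0 (erefl c) yN (ltW d10) pg ht (leqnn _)) _.
  rewrite subnn lev_mul lev_one mulrDr; apply: lerD.
    rewrite -mulrA mulrCA ler_wpM2l ?(ltW c2n)// /d1 mulrCA ler_piMr ?(ltW d4)//.
    by rewrite ler_pdivrMr// mul1r ler_nat.
  apply: le_trans (pb _) _; apply: le_trans (proj1 (bgalt_bounded _ (ltW N0) yN) _) _.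
  apply: (@le_trans _ _ (N ^+ n.*2.+1)).
    by rewrite -[leRHS]mulr1 ler_wpM2l ?exprn_ge0 ?(ltW N0)// l2norm_delta.
  apply: (@le_trans _ _ (c ^+ n.*2 * (4^-1 ^+ n * N))); last by rewrite ler_wpM2l ?(ltW c2n).
  apply: eq_ler; rewrite /c exprMn -{2}mul2n exprM exprSr mulrA; congr (_ * _).
  rewrite mulrAC -exprMn (_ : 2 ^+ 2 / 4 = 1) ?expr1n ?mul1r//.
  by field.
apply: le_trans (l2_triangle _ _) _.
apply: le_trans (lerD b1 (le_trans (l2_triangle _ _) (lerD b2 b3))) _.
lra.
Qed.

End Kaplansky.

(** * Sign matrices and unitaries *)

Section SignMatrices.
Context (R : realType) (N : nat).
Local Notation C := R[i].
Local Open Scope sesquilinear_scope.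
Local Notation sgnmx := {ffun 'I_N * 'I_N -> bool}.
Implicit Types X Y : sgnmx.

Definition smx X : 'M[C]_N := \matrix_(i, j) (-1) ^+ X (i, j).

Definition hamming X Y := #|[pred p | X p != Y p]|.

Lemma smx_sub X Y : frob2 (smx X - smx Y) = 4 * (hamming X Y)%:R.
Proof.
rewrite /frob2 pair_bigA /= /hamming -sum1_card natr_sum mulr_sumr [RHS]big_mkcond.
apply: eq_bigr => -[i j] _; rewrite !mxE inE /=.
have -> : (-1) ^+ X (i, j) - (-1) ^+ Y (i, j) = ((-1) ^+ X (i, j) - (-1) ^+ Y (i, j))%:C :> C.
  by rewrite rmorphB !rmorphXn !rmorphN1.
rewrite normc_real real_normK ?num_real//.
by case: (X (i, j)); case: (Y (i, j)); rewrite /= ?expr0 ?expr1; ring.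
Qed.

(** The Gram matrix has [N] diagonal entries equal to [N]; an off-diagonal entry is a sum of [N]
    uncorrelated signs and has mean square [N]. *)
Lemma smx_gram_moment :
  \sum_X frob2 (smx X *m (smx X)^t*) <= #|{: sgnmx}|%:R * (2 * N%:R ^+ 3).
Proof.
pose a X i j : R := \sum_l (-1) ^+ X (i, l) * (-1) ^+ X (j, l).
have aE X i j : normc ((smx X *m (smx X)^t*) i j) ^+ 2 = a X i j ^+ 2.
  have -> : (smx X *m (smx X)^t*) i j = (a X i j)%:C.
    rewrite mxE rmorph_sum; apply: eq_bigr => l _; rewrite tmxE !mxE !rmorphM /=.
    by rewrite !rmorphXn !rmorphN1.
  by rewrite normc_real real_normK ?num_real.
have aS i j : \sum_X a X i j ^+ 2 <= #|{: sgnmx}|%:R * (if i == j then N%:R ^+ 2 else N%:R).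
  case: eqVneq => [->|ij].
    rewrite mulr_natl -sumr_const; apply: ler_sum => X _; apply: eq_ler; congr (_ ^+ 2).
    rewrite /a (eq_bigr (fun=> 1)) ?sumr_const ?card_ord// => l _.
    by rewrite -expr2 sqrr_sign.
  have -> : \sum_X a X i j ^+ 2 = \sum_(l < N) \sum_(l' < N) \sum_(X : sgnmx) sign_prod R X
      [:: (i, l); (j, l); (i, l'); (j, l')].
    under eq_bigr do rewrite expr2 /a big_distrlr /=.
    rewrite exchange_big; apply: eq_bigr => l _; rewrite exchange_big; apply: eq_bigr => l' _.
    by apply: eq_bigr => X _; rewrite /sign_prod !big_cons big_nil mulr1 !mulrA.
  have -> : #|{: sgnmx}|%:R * N%:R = \sum_(l < N) #|{: sgnmx}|%:R :> R.
    by rewrite sumr_const card_ord mulr_natr.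
  apply: ler_sum => l _; rewrite (bigD1 l)//= [X in _ + X]big1 ?addr0; last first.
    move=> l' ll'; apply: (@sum_signs_odd R _ _ (i, l)) => /=.
    rewrite !xpair_eqE !eqxx (negPf ll') andbF [j == i]eq_sym (negPf ij) /=.
    by [].
  rewrite -sum1_card natr_sum; apply: ler_sum => X _; apply: eq_ler.
  rewrite /sign_prod !big_cons big_nil mulr1 mulrA mulrACA -!expr2 !sqrr_sign.
  by rewrite mulr1.
apply: (@le_trans _ _ (\sum_i \sum_j #|{: sgnmx}|%:R * (if i == j then N%:R ^+ 2 else N%:R))).
  rewrite exchange_big; apply: ler_sum => i _; rewrite exchange_big; apply: ler_sum => j _ /=.
  by under eq_bigr do rewrite aE.
under eq_bigr do rewrite -mulr_sumr; rewrite -mulr_sumr ler_wpM2l//.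
have -> : 2 * N%:R ^+ 3 = \sum_(i < N) (2 * N%:R ^+ 2) :> R.
  by rewrite sumr_const card_ord -mulr_natl; ring.
apply: ler_sum => i _; rewrite (bigD1 i)//= eqxx.
have -> : 2 * N%:R ^+ 2 = N%:R ^+ 2 + \sum_(j < N) N%:R :> R.
  by rewrite sumr_const card_ord -mulr_natl; ring.
rewrite lerD2l [leLHS]big_mkcond; apply: ler_sum => j _ /=.
by case: eqVneq => //= ji; rewrite eq_sym (negPf ji).
Qed.

(** The threshold is twice the bound on the average, so by Markov's inequality at least half of the
    sign matrices qualify. This fourth moment controls the loss from clipping without any bound on
    the operator norm. *)
Definition tame : pred sgnmx := [pred X | frob2 (smx X *m (smx X)^t*) <= 4 * N%:R ^+ 3].

Lemma card_tame : (0 < N)%N -> (#|{: sgnmx}| <= 2 * #|tame|)%N.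
Proof.
move=> N0; have NR : 0 < N%:R ^+ 3 :> R by rewrite exprn_gt0// ltr0n.
have h := smx_gram_moment.
have : \sum_(X | ~~ tame X) 4 * N%:R ^+ 3 <= #|{: sgnmx}|%:R * (2 * N%:R ^+ 3) :> R.
  apply: le_trans h; rewrite [leRHS](bigID tame) /=.
  rewrite -[leLHS]add0r lerD ?sumr_ge0//; first by move=> X _; exact: frob2_ge0.
  by apply: ler_sum => X; rewrite /tame /= -ltNge => /ltW.
rewrite sumr_const -[leLHS]mulr_natl.
have -> : #|fun X => ~~ tame X| = #|[pred X | ~~ tame X]| by apply: eq_card.
have e : (#|{: sgnmx}| = #|tame| + #|[pred X | ~~ tame X]|)%N.
  by rewrite -(cardC tame); congr (_ + _)%N.
rewrite e natrD -(ler_nat R) natrD natrM.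
set u := #|[pred X | ~~ tame X]|%:R; set v := #|tame|%:R => h2.
have : u * 2 * (2 * N%:R ^+ 3) <= (v + u) * (2 * N%:R ^+ 3).
  by apply: le_trans h2; apply: eq_ler; ring.
rewrite ler_pM2r; last by apply: mulr_gt0.
by move=> h3; lra.
Qed.

(** Weigh [Y] by [8^(- hamming X Y)]: the total weight is [(9/8)^(16 r)] and a point of the ball
    weighs at least [8^(-r)]. Hence there are at most [(8 (9/8)^16)^r] points, and
    [8 (9/8)^16 < 64]. *)
Lemma card_hamming_ball r X : (N * N = 16 * r)%N ->
  (#|[pred Y | hamming X Y <= r]| <= 2 ^ (6 * r))%N.
Proof.
move=> Nr; rewrite -(ler_nat R).
pose w (b : bool) : R := if b then 8^-1 else 1.
have wE Y : \prod_p w (X p != Y p) = 8^-1 ^+ hamming X Y.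
  rewrite /hamming -prodr_const [RHS]big_mkcond; apply: eq_bigr => p _.
  by rewrite /w inE.
have tot : \sum_(Y : sgnmx) \prod_p w (X p != Y p) = (9 / 8) ^+ (16 * r).
  rewrite (prod_sum_signs (fun p b => w (X p != b))).
  rewrite (eq_bigr (fun=> 9 / 8)) ?prodr_const ?card_prod ?card_ord ?Nr//.
  by move=> p _; case: (X p); rewrite /w /=; field.
have : \sum_(Y in [pred Y | hamming X Y <= r]%N) 8^-1 ^+ r <= (9 / 8) ^+ (16 * r) :> R.
  rewrite -tot [leLHS]big_mkcond; apply: ler_sum => Y _; rewrite wE inE.
  case: ifP => h; last by rewrite exprn_ge0.
  by rewrite ler_wiXn2l//; lra.
rewrite sumr_const -[X in X <= _ -> _]mulr_natl exprVn ler_pdivrMr ?exprn_gt0// => /le_trans -> //.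
rewrite natrX exprM [leRHS]exprM -exprMn; apply: lerXn2r; rewrite ?nnegrE ?mulr_ge0 ?exprn_ge0//.
lra.
Qed.

(** The Hermitian dilation makes clipping of eigenvalues available; the scaling brings the typical
    singular value of [smx X] to order 1. *)
Definition hmx X : 'M[C]_(N + N) :=
  ((Num.sqrt N%:R)^-1)%:C *: block_mx 0 (smx X) ((smx X)^t*) 0.

Lemma tblock m1 m2 n1 n2 (P : 'M[C]_(m1, n1)) (Q : 'M[C]_(m1, n2)) 
    (S : 'M[C]_(m2, n1)) (T : 'M[C]_(m2, n2)) :
  (block_mx P Q S T)^t* = block_mx (P^t*) (S^t*) (Q^t*) (T^t*).
Proof. by rewrite tr_block_mx map_block_mx. Qed.

Lemma hmx_herm X : (hmx X)^t* = hmx X.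
Proof.
rewrite /hmx tscalemx tblock trmxCK !trmx0 !map_mx0; congr (_ *: _).
exact: conjc_real.
Qed.

Lemma frob2_block m1 m2 n1 n2 (P : 'M[C]_(m1, n1)) (Q : 'M[C]_(m1, n2)) 
    (S : 'M[C]_(m2, n1)) (T : 'M[C]_(m2, n2)) :
  frob2 (block_mx P Q S T) = frob2 P + frob2 Q + frob2 S + frob2 T.
Proof.
rewrite /frob2 big_split_ord /= -addrA; congr (_ + _); rewrite -big_split /=; apply: eq_bigr => i _;
  rewrite big_split_ord /=; congr (_ + _); apply: eq_bigr => j _;
  by rewrite ?block_mxEul ?block_mxEur ?block_mxEdl ?block_mxEdr.
Qed.

Lemma frob20 m n : frob2 (0 : 'M[C]_(m, n)) = 0.
Proof. by rewrite /frob2 big1// => i _; rewrite big1// => j _; rewrite mxE normc0 expr0n. Qed.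

Lemma hmx_sub X Y : (0 < N)%N -> frob2 (hmx X - hmx Y) = 8 * (hamming X Y)%:R / N%:R.
Proof.
move=> N0; rewrite /hmx -scalerBr opp_block_mx add_block_mx !oppr0 !addr0 -toppmx -taddmx.
rewrite frob2Z frob2_block !frob20 frob2_tr smx_sub normc_real.
rewrite real_normK ?num_real// exprVn sqr_sqrtr ?ler0n//.
by rewrite add0r addr0 mulrC; congr (_ / _); ring.
Qed.

Lemma frob2_gramC m n (S : 'M[C]_(m, n)) : frob2 (S^t* *m S) = frob2 (S *m S^t*).
Proof.
apply: complexI; rewrite -(frob2E (S^t* *m S)) -(frob2E (S *m S^t*)).
rewrite (tmulmx (S^t*) S) (tmulmx S (S^t*)) trmxCK.
by rewrite -(mulmxA (S^t*)) mxtrace_mulC -!mulmxA.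
Qed.

Lemma hmx_sq X : (0 < N)%N -> tame X -> frob2 (hmx X *m hmx X) <= 8 * N%:R.
Proof.
move=> N0 tX; rewrite /hmx -scalemxAl -scalemxAr scalerA mulmx_block.
rewrite !mul0mx !mulmx0 !add0r !addr0 frob2Z frob2_block !frob20 !addr0.
set S := smx X in tX *.
rewrite frob2_gramC.
have NR : 0 < N%:R :> R by rewrite ltr0n.
have -> : normc (((Num.sqrt N%:R)^-1)%:C * ((Num.sqrt N%:R)^-1)%:C : C) ^+ 2 = (N%:R ^+ 2)^-1.
  rewrite -rmorphM normc_real real_normK ?num_real// exprMn exprVn sqr_sqrtr ?ler0n//.
  by rewrite -expr2 exprVn.
rewrite ler_pdivrMl ?exprn_gt0//.
by move: tX; rewrite /tame /= -/S; set f := frob2 _; rewrite !exprS expr0; lra.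
Qed.

End SignMatrices.

Section ClippedUnitary.
Context (R : realType) (k : nat).
Local Notation C := R[i].
Local Open Scope sesquilinear_scope.

(** [U] has real part the clipping of [H / c] to the interval [-1, 1]. *)
Lemma unitary_of_hermitian (H : 'M[C]_k) (c : R) : H^t* = H -> 0 < c ->
  exists2 U : 'M[C]_k, U \is unitarymx &
    frob2 (H - (c / 2)%:C *: (U + U^t*)) <= frob2 (H *m H) / c ^+ 2.
Proof.
move=> hH c0; have [P uP [t ->]] := hermitian_dmx hH.
pose cl i := Num.max (-1) (Num.min 1 (t i / c)).
have hcl i : -1 <= cl i <= 1.
  by rewrite /cl le_max lexx /= ge_max ge_min lexx /= lerNl; lra.
have cl2 i : 0 <= 1 - cl i ^+ 2 by have /andP[h1 h2] := hcl i; nra.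
pose u i : C := cl i +i* Num.sqrt (1 - cl i ^+ 2).
exists (dmx P u).
  apply: dmx_unitary => // i; apply/eqP.
  by rewrite -(@eqrXn2 _ 2) ?normc_ge0// normcE2 /= sqr_sqrtr// expr1n; apply/eqP; ring.
rewrite dmx_tr dmxD dmxZ (dmxM _ _ uP) -[- dmx _ _]scaleN1r dmxZ dmxD !frob2_dmx//.
rewrite mulr_suml; apply: ler_sum => i _.
have -> : (t i)%:C + -1 * ((c / 2)%:C * (u i + (u i)^*)) = (t i - c * cl i)%:C.
  by apply/eqP; rewrite eq_complex /=; apply/andP; split; apply/eqP; field.
rewrite -rmorphM !normc_real !real_normK ?num_real// -expr2.
set a := t i / c in cl hcl cl2 u *.
have -> : t i = c * a by rewrite /a mulrC divfK// gt_eqF.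
have -> : ((c * a) ^+ 2) ^+ 2 / c ^+ 2 = c ^+ 2 * a ^+ 4 by field; rewrite gt_eqF.
rewrite -mulrBr exprMn ler_wpM2l ?sqr_ge0// /cl -/a.
have [a1|a1] := ltP a (-1).
  have -> : Num.max (-1) (Num.min 1 a) = -1.
    by apply/max_idPl; rewrite ge_min (ltW a1) orbT.
  by rewrite !exprS expr0; nra.
have [a2|a2] := leP a 1.
  have -> : Num.max (-1) a = a by apply/max_idPr.
  by rewrite subrr expr0n exprn_even_ge0.
have -> : Num.max (-1) 1 = 1 :> R by apply/max_idPr; lra.
by rewrite !exprS expr0; nra.
Qed.

End ClippedUnitary.

Section TameSeparation.
Context (R : realType) (N : nat).
Local Notation C := R[i].
Local Open Scope sesquilinear_scope.
Local Notation sgnmx := {ffun 'I_N * 'I_N -> bool}.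

Lemma frob2B m n (X Y : 'M[C]_(m, n)) : frob2 (X - Y) <= 2 * frob2 X + 2 * frob2 Y.
Proof. by apply: le_trans (frob2D _ _) _; rewrite frob2N. Qed.

Lemma exists_clipped_unitaries : (0 < N)%N ->
  exists Q : sgnmx -> 'M[C]_(N + N), (forall X, Q X \is unitarymx) /\
    forall X Y, tame R X -> tame R Y ->
      frob2 (Q X - Q Y) <= (2 ^+ 12)^-1 * (N + N)%:R -> (16 * hamming X Y <= N * N)%N.
Proof.
move=> N0; have NR : 0 < N%:R :> R by rewrite ltr0n.
(* Clipping at 16 turns [hmx_sq] into an error of [8 N / 16^2 = N / 32] per matrix. The two errors
   together, and the distance of the unitaries, then contribute at most [N / 4] each to
   [||hmx X - hmx Y||^2]. *)
have c0 : 0 < 16 :> R by [].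
have Q_ex (X : sgnmx) := cid2 (unitary_of_hermitian (hmx_herm R X) c0).
exists (fun X => sval (Q_ex X)); split=> [X|X Y tX tY]; first by case: (Q_ex X).
case: (Q_ex X) => U uU /= hU; case: (Q_ex Y) => V uV /= hV hUV.
have {}hU : frob2 (hmx R X - (16 / 2)%:C *: (U + U^t*)) <= N%:R / 32.
  by apply: le_trans hU _; have := hmx_sq N0 tX; set f := frob2 _; lra.
have {}hV : frob2 (hmx R Y - (16 / 2)%:C *: (V + V^t*)) <= N%:R / 32.
  by apply: le_trans hV _; have := hmx_sq N0 tY; set f := frob2 _; lra.
set EX := hmx R X - _ in hU; set EY := hmx R Y - _ in hV.
have e : hmx R X - hmx R Y = (EX - EY) + (16 / 2)%:C *: ((U - V) + (U - V)^t*).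
  have gen (A B P Q : 'M[C]_(N + N)) (z : C) : A - B = ((A - z *: P) - (B - z *: Q)) + z *: (P - Q).
    by apply/matrixP => i j; rewrite !mxE; ring.
  rewrite taddmx toppmx (gen _ _ (U + U^t*) (V + V^t*) (16 / 2)%:C); congr (_ + _ *: _).
  by rewrite opprD addrACA.
rewrite natrD in hUV.
have : frob2 (hmx R X - hmx R Y) <= N%:R / 2.
  rewrite e; apply: le_trans (frob2D _ _) _; rewrite frob2Z normc_real.
  rewrite real_normK ?num_real//.
  have := frob2D (U - V) ((U - V)^t*); rewrite frob2_tr; have := frob2B EX EY.
  move: (frob2 (EX - EY)) (frob2 EX) (frob2 EY) (frob2 (U - V + _)) (frob2 (U - V)) hU hV hUV.
  by clear; move=> *; lra.
rewrite (hmx_sub R X Y N0) ler_pdivrMr// -(ler_nat R) !natrM.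
by move: (hamming X Y) (N%:R); clear; move=> *; lra.
Qed.

End TameSeparation.

(** * Equidistribution of eigenvalues from small power sums *)

Section PowerTraces.
Context (R : realType) (k : nat).
Local Notation C := R[i].
Local Open Scope sesquilinear_scope.

Lemma normcB1X (z : C) n : normc z = 1 -> normc (z ^+ n - 1) <= n%:R * normc (z - 1).
Proof.
move=> z1; elim: n => [|n IH]; first by rewrite expr0 subrr normc0 mul0r.
have -> : z ^+ n.+1 - 1 = z * (z ^+ n - 1) + (z - 1) by rewrite exprS; ring.
by apply: le_trans (normc_triangle _ _) _; rewrite normcM z1 mul1r -natr1 mulrDl mul1r lerD2r.
Qed.

Lemma geometric_sum_large (z : C) L : normc z = 1 -> (0 < L)%N -> normc (z - 1) < L%:R^-1 ->
  L%:R / 2 <= normc (\sum_(n < L) z ^+ n).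
Proof.
move=> z1 L0 hz; have LR : 0 < L%:R :> R by rewrite ltr0n.
have h : normc (\sum_(n < L) (z ^+ n - 1)) <= L%:R / 2.
  apply: le_trans (normc_sum _ _ _) _.
  apply: (@le_trans _ _ (\sum_(n < L) n%:R * L%:R^-1)).
    by apply: ler_sum => n _; apply: le_trans (normcB1X _ z1) _; rewrite ler_wpM2l// ltW.
  rewrite -mulr_suml -natr_sum ler_pdivrMr// -(big_mkord xpredT (fun i => i)) bigop.big_mkord.
  have -> : (\sum_(i < L) i)%N = 'C(L, 2) by rewrite -bin2_sum big_mkord.
  have : ('C(L, 2) * 2 <= L * L)%N by rewrite muln2 bin2 -[leqRHS](odd_double_half) ; lia.
  by rewrite -(ler_nat R) !natrM; lra.
have e : \sum_(n < L) (z ^+ n - 1) = \sum_(n < L) z ^+ n - L%:R.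
  by rewrite sumrB sumr_const card_ord.
rewrite e in h.
have : normc (L%:R : C) <= normc (\sum_(n < L) z ^+ n) + normc (\sum_(n < L) z ^+ n - L%:R).
  have {1}-> : (L%:R : C) = \sum_(n < L) z ^+ n + - (\sum_(n < L) z ^+ n - L%:R) by ring.
  by apply: le_trans (normc_triangle _ _) _; rewrite normcN.
rewrite [X in normc X <= _ -> _]natrC normc_real ger0_norm ?ler0n// => /le_trans/(_ (lerD (lexx _) h)).
set u := normc _ => ?; lra.
Qed.

(** For the Vandermonde matrix [M], the entries of [M^* M] are power sums, small off the diagonal,
    while those of [M M^*] are geometric sums in [l i / l j], of modulus at least [L / 2] when the
    two eigenvalues are closer than [1 / L]. Both products have the same Frobenius norm. *)
Lemma card_close_pairs (l : 'I_k -> C) L (tol : R) : (0 < L)%N -> 0 <= tol ->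
  (forall i, normc (l i) = 1) ->
  (forall n, (0 < n < L)%N -> normc (\sum_i l i ^+ n) <= tol * k%:R) ->
  #|[pred p : 'I_k * 'I_k | normc (l p.1 - l p.2) < L%:R^-1]|%:R
    <= 4 * k%:R ^+ 2 * (L%:R^-1 + tol ^+ 2).
Proof.
move=> L0 tol0 l1 lt; have LR : 0 < L%:R :> R by rewrite ltr0n.
pose M : 'M[C]_(k, L) := \matrix_(i, n) l i ^+ n.
have lconj i : l i * (l i)^* = 1 by rewrite mulrC conjc_mul_normc l1 expr1n.
have h1 : frob2 (M^t* *m M) <= L%:R * k%:R ^+ 2 + L%:R ^+ 2 * (tol ^+ 2 * k%:R ^+ 2).
  have ent n n' : normc ((M^t* *m M) n n') ^+ 2 <=
      (if n == n' then k%:R ^+ 2 else 0) + tol ^+ 2 * k%:R ^+ 2.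
    have -> : (M^t* *m M) n n' = \sum_i (l i ^+ n)^* * l i ^+ n'.
      by rewrite mxE; apply: eq_bigr => i _; rewrite tmxE !mxE.
    have small (d : nat) : (0 < d < L)%N -> normc (\sum_i l i ^+ d) ^+ 2 <= tol ^+ 2 * k%:R ^+ 2.
      move=> dL; rewrite -exprMn; apply: lerXn2r; rewrite ?nnegrE ?normc_ge0 ?mulr_ge0//.
      exact: lt.
    case: eqVneq => [->|nn].
      rewrite -[leLHS]addr0 lerD ?mulr_ge0 ?exprn_ge0//.
      rewrite (eq_bigr (fun=> 1)).
        by rewrite sumr_const card_ord natrC normc_real ger0_norm ?ler0n.
      by move=> i _; rewrite rmorphXn -exprMn [_^* * _]mulrC lconj expr1n.
    rewrite add0r; have [nle|nlt] := leqP n n'.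
      have d0 : (0 < n' - n < L)%N.
        by rewrite subn_gt0 ltn_neqAle nn nle /= (leq_ltn_trans (leq_subr _ _)).
      rewrite (eq_bigr (fun i => l i ^+ (n' - n))); first exact: small d0.
      move=> i _; rewrite -{1}(subnK nle) exprD mulrCA rmorphXn -exprMn [_^* * _]mulrC lconj.
      by rewrite expr1n mulr1.
    have d0 : (0 < n - n' < L)%N.
      by rewrite subn_gt0 nlt /= (leq_ltn_trans (leq_subr _ _)).
    rewrite (eq_bigr (fun i => (l i ^+ (n - n'))^*)).
      by rewrite -rmorph_sum normcJ2; exact: small d0.
    move=> i _; rewrite -{1}(subnK (ltnW nlt)) exprD rmorphM -mulrA !rmorphXn -exprMn [_^* * _]mulrC.
    by rewrite lconj expr1n mulr1.
  apply: (@le_trans _ _ (\sum_(n < L) \sum_(n' < L)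
      ((if n == n' then k%:R ^+ 2 else 0) + tol ^+ 2 * k%:R ^+ 2))).
    by apply: ler_sum => n _; apply: ler_sum => n' _; exact: ent.
  apply: eq_ler; rewrite (eq_bigr (fun=> k%:R ^+ 2 + L%:R * (tol ^+ 2 * k%:R ^+ 2))).
    by rewrite sumr_const card_ord -[LHS]mulr_natl mulrDr mulrA -expr2.
  move=> n _; rewrite big_split /= sumr_const card_ord mulr_natl; congr (_ + _).
  by rewrite -big_mkcond (big_pred1 n)// => i; rewrite eq_sym.
rewrite frob2_gramC in h1.
have h2 : #|[pred p : 'I_k * 'I_k | normc (l p.1 - l p.2) < L%:R^-1]|%:R * (L%:R ^+ 2 / 4)
    <= frob2 (M *m M^t*).
  rewrite /frob2 pair_bigA /= mulr_natl -sumr_const [leLHS]big_mkcond.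
  apply: ler_sum => -[i j] _ /=; rewrite inE /=; case: ifP => [lij|_]; last exact: sqr_ge0.
  have -> : (M *m M^t*) i j = \sum_(n < L) (l i * (l j)^*) ^+ n.
    by rewrite mxE; apply: eq_bigr => n _; rewrite tmxE !mxE exprMn rmorphXn.
  have -> : L%:R ^+ 2 / 4 = (L%:R / 2) ^+ 2 :> R by field.
  apply: lerXn2r; rewrite ?nnegrE ?normc_ge0 ?divr_ge0//; apply: geometric_sum_large => //.
    by rewrite normcM normcJ2 !l1 mulr1.
  by rewrite -(lconj j) -mulrBl normcM normcJ2 l1 mulr1.
have {h1 h2} := le_trans h2 h1; set n := #|_|%:R => h.
rewrite -(ler_pM2r (_ : 0 < L%:R ^+ 2 / 4)); last by rewrite divr_gt0// exprn_gt0.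
apply: le_trans h _; apply: eq_ler; field; rewrite gt_eqF//.
Qed.

End PowerTraces.

(** * Counting orbit classes *)

Section Counting.

Lemma card_le_fibers (T U : finType) (f : T -> U) (A : pred T) (B : pred U) m :
  (forall x, A x -> B (f x)) ->
  (forall y, #|[pred x | A x && (f x == y)]| <= m)%N -> (#|A| <= #|B| * m)%N.
Proof.
move=> AB fm; rewrite -sum1_card (partition_big f B)//=.
rewrite -sum_nat_const; apply: leq_sum => y _.
apply: leq_trans (fm y); rewrite -sum1_card; apply: eq_leq; apply: eq_bigl => x.
by rewrite !inE.
Qed.

(** Weight [f] by [2 ^- \sum_t f t]: the total weight is at most [2 ^ #|S|]. *)
Lemma card_bounded_sum (T : finType) (S : pred T) K :
  (#|[pred f : {ffun T -> 'I_K.+1} | (\sum_t f t <= K)%N && [forall t, S t || (f t == ord0)]]|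
    <= 2 ^ (K + #|S|))%N.
Proof.
pose w (t : T) (n : 'I_K.+1) : rat := if S t || (n == ord0) then 2^-1 ^+ n else 0.
have w0 t n : 0 <= w t n by rewrite /w; case: ifP => // _; exact: exprn_ge0.
have geom m : \sum_(n < m) (2^-1 : rat) ^+ n <= 2.
  suff -> : \sum_(n < m) (2^-1 : rat) ^+ n = 2 - 2 * 2^-1 ^+ m.
    by rewrite lerBlDr lerDl mulr_ge0 ?exprn_ge0.
  elim: m => [|m IH]; first by rewrite big_ord0 expr0 mulr1 subrr.
  by rewrite big_ord_recr IH /= exprS; field.
have hw t : \sum_n w t n <= if S t then 2 else 1.
  rewrite /w; case: (S t) => /=; first exact: geom.
  by rewrite -big_mkcond (big_pred1 ord0)// expr0.
set D := [pred f : {ffun _ -> _} | _].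
have h : \sum_(f in D) (2^-1 : rat) ^+ K <= 2 ^+ #|S|.
  apply: (@le_trans _ _ (\sum_(f : {ffun T -> 'I_K.+1}) \prod_t w t (f t))).
    rewrite [leLHS]big_mkcond; apply: ler_sum => f _; case: ifP => [|_]; last first.
      by apply: prodr_ge0 => t _.
    rewrite inE => /andP[fK /forallP fS].
    have -> : \prod_t w t (f t) = 2^-1 ^+ (\sum_t f t)%N.
      rewrite -prodrXr; apply: eq_bigr => t _; by rewrite /w fS.
    by rewrite ler_wiXn2l.
  rewrite -(bigA_distr_bigA w).
  rewrite -prodr_const [leRHS]big_mkcond; apply: ler_prod => t _.
  by rewrite sumr_ge0//=; exact: hw.
move: h; rewrite sumr_const -[leLHS]mulr_natl exprVn ler_pdivrMr ?exprn_gt0// -exprD addnC.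
by rewrite -natrX ler_nat.
Qed.

End Counting.

(** * Rounding the entries of a matrix to finitely many codes *)

Section Rounding.
Context (R : realType) (k : nat).
Local Notation C := R[i].
Local Open Scope sesquilinear_scope.
Local Notation part := ('I_k * 'I_k * (bool * bool))%type.

Definition pospart (x : R) : R := Num.max x 0.

Definition entry_part (V : 'M[C]_k) (t : part) : R :=
  let z := V t.1.1 t.1.2 in
  let x := if t.2.1 then complex.Re z else complex.Im z in
  pospart (if t.2.2 then x else - x).

Lemma sum_bool2 (f : bool * bool -> R) :
  \sum_b f b = f (true, true) + f (true, false) + f (false, true) + f (false, false).
Proof.
rewrite (eq_bigr (fun p => f (p.1, p.2))); last by case.
rewrite -(pair_bigA _ (fun x y => f (x, y))) /= big_bool !big_bool /=.
by rewrite !addrA.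
Qed.

Lemma entry_part_ge0 V t : 0 <= entry_part V t.
Proof. by rewrite /entry_part /pospart le_max lexx orbT. Qed.

Lemma sum_entry_part V i j : \sum_b entry_part V (i, j, b) ^+ 2 = normc (V i j) ^+ 2.
Proof.
rewrite sum_bool2 normcE2 /entry_part /pospart /=.
move: (complex.Re _) (complex.Im _) => x y.
have e (u : R) : Num.max u 0 ^+ 2 + Num.max (- u) 0 ^+ 2 = u ^+ 2.
  have [u0|u0] := leP 0 u.
    have -> : Num.max (- u) 0 = 0 by apply/max_idPr; lra.
    by rewrite expr0n addr0.
  have -> : Num.max (- u) 0 = - u by apply/max_idPl; lra.
  by rewrite sqrrN expr0n add0r.
by rewrite e -addrA e.
Qed.

Lemma entry_part_close V V' i j s : 
  (forall b, `|entry_part V (i, j, b) - entry_part V' (i, j, b)| <= s) ->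
  normc (V i j - V' i j) ^+ 2 <= 8 * s ^+ 2.
Proof.
move=> h; rewrite normcE2 ReD ImD ReN ImN.
have := h (true, true); have := h (true, false); have := h (false, true); have := h (false, false).
rewrite /entry_part /pospart /=.
move: (complex.Re _) (complex.Im _) (complex.Re _) (complex.Im _) => x y x' y'.
have e (u v : R) : `|Num.max u 0 - Num.max v 0| <= s ->
    `|Num.max (- u) 0 - Num.max (- v) 0| <= s -> (u - v) ^+ 2 <= 4 * s ^+ 2.
  move=> h1 h2.
  have -> : u - v = (Num.max u 0 - Num.max v 0) - (Num.max (- u) 0 - Num.max (- v) 0).
    have p (w : R) : w = Num.max w 0 - Num.max (- w) 0.
      have [w0|w0] := leP 0 w.
        have -> : Num.max (- w) 0 = 0 by apply/max_idPr; lra.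
        by rewrite subr0.
      have -> : Num.max (- w) 0 = - w by apply/max_idPl; lra.
      by rewrite sub0r opprK.
    by rewrite {1}(p u) {1}(p v); ring.
  move: h1 h2; rewrite !ler_norml; move: (_ - _) (_ - _) => a b /andP[? ?] /andP[? ?].
  by nra.
by move=> h4 h3 h2 h1; have := e _ _ h1 h2; have := e _ _ h3 h4; lra.
Qed.

(** Each of the four nonnegative parts of an entry is replaced by its integer part in units of [s].
    As [n <= n^2], these integers sum to at most [frob2 V / s^2 <= K], so [card_bounded_sum] counts
    the codes; positions outside [S] are coded by 0 and cost nothing. *)
Lemma matrix_rounding (S : pred ('I_k * 'I_k)) K (s : R) : 0 < s ->
  exists (U : finType) (code : 'M[C]_k -> U) (D : pred U),
    [/\ (#|D| <= 2 ^ (K + 4 * #|S|))%N,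
      forall V, frob2 V <= K%:R * s ^+ 2 -> D (code V) &
      forall V V', frob2 V <= K%:R * s ^+ 2 -> frob2 V' <= K%:R * s ^+ 2 ->
        code V = code V' ->
        \sum_(p | S p) normc ((V - V') p.1 p.2) ^+ 2 <= 8 * s ^+ 2 * #|S|%:R].
Proof.
move=> s0.
pose tr (V : 'M[C]_k) t := if S t.1 then Num.truncn (entry_part V t / s) else 0%N.
pose code V : {ffun part -> 'I_K.+1} := [ffun t => inord (tr V t)].
have trK V : frob2 V <= K%:R * s ^+ 2 -> (\sum_t tr V t <= K)%N.
  move=> hV; rewrite -(ler_nat R) -(ler_pM2r (exprn_gt0 2 s0)); apply: le_trans hV.
  rewrite natr_sum mulr_suml /frob2 pair_bigA /=.
  rewrite (eq_bigr (fun p => (tr V (p.1, p.2))%:R * s ^+ 2)); last by case.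
  rewrite -(pair_bigA _ (fun p b => (tr V (p, b))%:R * s ^+ 2)) /=.
  apply: ler_sum => -[i j] _ /=; rewrite -sum_entry_part; apply: ler_sum => b _.
  rewrite /tr /=; case: ifP => _; last by rewrite mul0r sqr_ge0.
  set x := entry_part _ _; have x0 : 0 <= x / s by rewrite divr_ge0 ?entry_part_ge0// ltW.
  have /andP[h1 _] := truncn_itv x0.
  have -> : x ^+ 2 = (x / s) ^+ 2 * s ^+ 2 by rewrite -exprMn divfK// gt_eqF.
  rewrite ler_wpM2r ?sqr_ge0//.
  apply: (@le_trans _ _ ((Num.truncn (x / s))%:R ^+ 2)).
    by rewrite -natrX ler_nat; case: (Num.truncn _) => // n; rewrite expnS expn1 leq_pmulr.
  by apply: lerXn2r; rewrite ?nnegrE.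
have codeE V t : frob2 V <= K%:R * s ^+ 2 -> code V t = tr V t :> nat.
  move=> hV; rewrite ffunE inordK// ltnS; apply: leq_trans (trK _ hV).
  by rewrite (bigD1 t)//= leq_addr.
pose S' : pred part := [pred t | S t.1].
exists _, code, [pred f : {ffun part -> 'I_K.+1} |
   (\sum_t f t <= K)%N && [forall t, S' t || (f t == ord0)]]; split.
- apply: leq_trans (card_bounded_sum _ _) _; rewrite leq_exp2l// leq_add2l.
  have -> : #|S'| = #|[predX S & predT : pred (bool * bool)]|.
    by apply: eq_card => -[p b]; rewrite !inE /= andbT.
  by rewrite cardX card_prod !card_bool mulnC.
- move=> V hV /=; apply/andP; split.
    by under eq_bigr do rewrite codeE//; exact: trK.
  apply/forallP => t; case: (boolP (S' t)) => //= St; apply/eqP/val_inj.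
  by rewrite /= codeE// /tr; move: St; rewrite /S' /= => /negPf ->.
- move=> V V' hV hV' e.
  rewrite [leRHS]mulr_natr -sumr_const; apply: ler_sum => -[i j] Sp /=; rewrite !mxE.
  apply: entry_part_close => b.
  have : tr V (i, j, b) = tr V' (i, j, b) by rewrite -!codeE// e.
  rewrite /tr /= Sp.
  have := entry_part_ge0 V (i, j, b); have := entry_part_ge0 V' (i, j, b).
  move: (entry_part _ _) (entry_part _ _) => x' x x'0 x0 exx.
  have h (y : R) : 0 <= y -> (Num.truncn (y / s))%:R * s <= y < ((Num.truncn (y / s))%:R + 1) * s.
    move=> y0; have /truncn_itv/andP[h1 h2] : 0 <= y / s by rewrite divr_ge0// ltW.
    by rewrite -ler_pdivlMr// h1 -ltr_pdivrMr// natr1.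
  have := h _ x0; have := h _ x'0; rewrite exx; move: (_%:R) => n /andP[? ?] /andP[? ?].
  by rewrite ler_norml; apply/andP; split; lra.
Qed.

End Rounding.

(** * Conjugating unitaries and approximate commutants *)

Section Conjugation.
Context (R : realType) (k : nat).
Local Notation C := R[i].
Local Open Scope sesquilinear_scope.
Implicit Types A B U V W P : 'M[C]_k.

Lemma unitary_adj U : U \is unitarymx -> U^t* \is unitarymx.
Proof. by rewrite trmxC_unitary. Qed.

Lemma frob2_unitaryB P W A B : P \is unitarymx -> W \is unitarymx ->
  frob2 (P *m A *m W - P *m B *m W) = frob2 (A - B).
Proof.
move=> uP uW; rewrite -mulmxBl -mulmxBr (frob2_unitaryr _ uW).
exact: frob2_unitaryl.
Qed.

Lemma frob2B_split (S : pred ('I_k * 'I_k)) A B (c d : R) :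
  \sum_(p | S p) normc ((A - B) p.1 p.2) ^+ 2 <= c ->
  \sum_(p | ~~ S p) normc (A p.1 p.2) ^+ 2 <= d ->
  \sum_(p | ~~ S p) normc (B p.1 p.2) ^+ 2 <= d -> frob2 (A - B) <= c + 4 * d.
Proof.
move=> hc hA hB; rewrite /frob2 pair_bigA /= (bigID S) /= lerD//.
have := lerD hA hB; rewrite -big_split /= => h.
apply: le_trans (_ : 2 * (d + d) <= _); last by apply: eq_ler; ring.
apply: le_trans (ler_wpM2l _ h) => //; rewrite mulr_sumr; apply: ler_sum => p _.
by rewrite [(A - B) _ _]mxE [(- B) _ _]mxE mulrDr -[normc (B _ _)]normcN; exact: normcDsq.
Qed.

(** The unknown centre [B] is eliminated by comparison with a reference point [A0] of the same
    orbit-ball. *)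
Lemma conj_transfer A A0 B W W0 (e : R) : W \is unitarymx -> W0 \is unitarymx ->
  frob2 (A - W *m B *m W^t*) <= e -> frob2 (A0 - W0 *m B *m W0^t*) <= e ->
  frob2 (A - (W *m W0^t*) *m A0 *m (W *m W0^t*)^t*) <= 4 * e.
Proof.
move=> uW uW0 h h0; set V := W *m W0^t*.
have uV : V \is unitarymx by exact: mul_unitarymx uW (unitary_adj uW0).
have -> : A - V *m A0 *m V^t* = (A - W *m B *m W^t*) - V *m (A0 - W0 *m B *m W0^t*) *m V^t*.
  rewrite mulmxBr mulmxBl.
  have -> : V *m (W0 *m B *m W0^t*) *m V^t* = W *m B *m W^t*.
    rewrite /V tmulmx trmxCK !mulmxA -(mulmxA W) (unitary_right uW0) mulmx1.
    by rewrite -(mulmxA _ _ W0) (unitary_right uW0) mulmx1.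
  by rewrite opprB addrA subrK.
apply: le_trans (frob2B _ _) _.
rewrite (frob2_unitaryr _ (unitary_adj uV)) (frob2_unitaryl _ uV).
by move: (frob2 _) (frob2 _) h h0; clear; move=> *; lra.
Qed.

Lemma conj_close A1 A2 A0 V1 V2 (e : R) : V1 \is unitarymx -> V2 \is unitarymx ->
  A0 \is unitarymx -> frob2 (A1 - V1 *m A0 *m V1^t*) <= e ->
  frob2 (A2 - V2 *m A0 *m V2^t*) <= e ->
  frob2 (A1 - A2) <= 8 * frob2 (V1 - V2) + 8 * e.
Proof.
move=> u1 u2 u0 h1 h2.
have -> : A1 - A2 = ((A1 - V1 *m A0 *m V1^t*) - (A2 - V2 *m A0 *m V2^t*)) +
    ((V1 - V2) *m A0 *m V1^t* + V2 *m A0 *m (V1 - V2)^t*).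
  rewrite taddmx toppmx mulmxDr mulmxN !mulmxBl.
  move: (V1 *m A0 *m V1^t*) (V2 *m A0 *m V2^t*) (V2 *m A0 *m V1^t*) => X Y Z.
  by apply/matrixP => i j; rewrite !mxE; ring.
apply: le_trans (frob2D _ _) _.
have := frob2B (A1 - V1 *m A0 *m V1^t*) (A2 - V2 *m A0 *m V2^t*).
have := frob2D ((V1 - V2) *m A0 *m V1^t*) (V2 *m A0 *m (V1 - V2)^t*).
rewrite (frob2_unitaryr _ (unitary_adj u1)) (frob2_unitaryr _ u0).
rewrite (frob2_unitaryl _ (mul_unitarymx u2 u0)) frob2_tr.
move: (frob2 (V1 - V2)) (frob2 (_ + _)) (frob2 (_ - _)) (frob2 _) (frob2 _) h1 h2; clear.
by move=> *; lra.
Qed.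

(** In an eigenbasis the commutator with [dmx P l] has entries [(l i - l j) V_ij], so a small
    commutator leaves [V] little mass on pairs of separated eigenvalues. *)
Lemma approx_commutant P (l : 'I_k -> C) V (e t : R) : P \is unitarymx -> 0 < t ->
  V \is unitarymx -> frob2 (dmx P l - V *m dmx P l *m V^t*) <= e ->
  \sum_(p : 'I_k * 'I_k | t <= normc (l p.1 - l p.2))
    normc ((P *m V *m P^t*) p.1 p.2) ^+ 2 <= e / t ^+ 2.
Proof.
move=> uP t0 uV h; rewrite ler_pdivlMr ?exprn_gt0//; apply: le_trans h.
set Vt := P *m V *m P^t*.
have e1 : P *m ((dmx P l - V *m dmx P l *m V^t*) *m V) *m P^t* =
    diag_mx (\row_i l i) *m Vt - Vt *m diag_mx (\row_i l i).
  rewrite -(diag_dmx l uP) /Vt; move: (dmx P l) => D; rewrite mulmxBl -(mulmxA _ (V^t*)) (unitary_right uV) mulmx1.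
  rewrite mulmxBr mulmxBl !mulmxA.
  rewrite -(mulmxA (P *m D) (P^t*) P) (unitary_right uP) mulmx1.
  by rewrite -(mulmxA (P *m V) (P^t*) P) (unitary_right uP) mulmx1.
rewrite -(frob2_unitaryr _ uV) -(frob2_unitaryl _ uP) -(frob2_unitaryr _ (unitary_adj uP)).
rewrite e1 /frob2 pair_bigA /= mulr_suml [leLHS]big_mkcond; apply: ler_sum => -[i j] _ /=.
case: ifP => [tl|_]; last exact: sqr_ge0.
have -> : (diag_mx (\row_i l i) *m Vt - Vt *m diag_mx (\row_i l i)) i j = (l i - l j) * Vt i j.
  by rewrite mxE mul_diag_mx mxE [X in _ + X]mxE mul_mx_diag !mxE; ring.
rewrite normcM exprMn mulrC ler_wpM2r ?sqr_ge0//.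
by apply: lerXn2r => //; rewrite nnegrE ?normc_ge0// ltW.
Qed.

Lemma mxtrace_dmx P (l : 'I_k -> C) : P \is unitarymx -> \tr (dmx P l) = \sum_i l i.
Proof.
move=> uP; rewrite /dmx mxtrace_mulC mulmxA (unitary_left uP) mul1mx mxtrace_diag.
by apply: eq_bigr => i _; rewrite mxE.
Qed.

Lemma unitary_dmx U : U \is unitarymx ->
  exists2 P, P \is unitarymx & exists2 l, U = dmx P l & forall i, normc (l i) = 1.
Proof.
move=> uU; have e : U *m U^t* = U^t* *m U by rewrite (unitary_left uU) (unitary_right uU).
have [P uP [l Ul]] := normal_dmx e; exists P => //; exists l => // i.
have := unitary_right uU; rewrite Ul dmx_tr (dmxM _ _ uP) -(dmx1 uP).
move=> /(dmx_inj uP)/(_ i); rewrite conjc_mul_normc => /complexI h.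
by apply/eqP; rewrite -(@eqrXn2 _ 2) ?normc_ge0// h expr1n.
Qed.

End Conjugation.

Definition orbit_close (R : realType) (k : nat) (omega : R) (A B W : 'M[R[i]]_k) : Prop :=
  frob2 (A - W *m B *m (W^t*)%sesqui) <= omega ^+ 2 * k%:R.

Section OrbitFibers.
Context (R : realType).
Local Notation C := R[i].
Local Open Scope sesquilinear_scope.

Lemma sqr_radius_le (x : R) : (2 ^+ 29 : R) <= x -> (2 ^+ 11 * x)^-1 ^+ 2 <= (2 ^+ 40)^-1.
Proof.
move=> hx; have x0 : 0 < x by apply: lt_le_trans hx; exact: exprn_gt0.
rewrite exprVn lef_pV2 ?posrE; last by exact: exprn_gt0.
  by move: hx; rewrite !exprS expr0; nra.
by apply/exprn_gt0/mulr_gt0 => //; exact: exprn_gt0.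
Qed.

(** The constants make [4 #|S| <= r] and bound by [2^-12 k] the squared distance
    of two elements of [D] whose conjugators have the same code. *)
Lemma card_orbit_fiber (N r L k : nat) (omega : R)
    (Q : {ffun 'I_N * 'I_N -> bool} -> 'M[C]_k) (D : pred {ffun 'I_N * 'I_N -> bool})
    (Aa Ba Bb Q1 Q2 : 'M[C]_k) :
  (0 < N)%N -> k = (N + N)%N -> (N * N = 16 * r)%N -> (2 ^+ 29 : R) <= L%:R ->
  omega = (2 ^+ 11 * L%:R)^-1 ->
  (forall X, Q X \is unitarymx) ->
  (forall X Y, D X -> D Y -> frob2 (Q X - Q Y) <= (2 ^+ 12)^-1 * k%:R ->
     (16 * hamming X Y <= N * N)%N) ->
  Aa \is unitarymx -> Q1 \is unitarymx -> Q2 \is unitarymx ->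
  (forall n, (0 < n < L)%N ->
     normc (\tr (iter n (mulmx Aa) 1%:M)) <= (2 ^+ 15)^-1 * k%:R) ->
  (forall X, D X -> exists2 W, W \is unitarymx &
     orbit_close omega Aa Ba W /\ orbit_close omega (Q1 *m Q X *m Q2) Bb W) ->
  (#|D| <= 2 ^ (8 * r))%N.
Proof.
move=> N0 kN Nr L29 omE uQ sepQ uA u1 u2 trA close.
case: (pickP D) => [X0 D0|D0]; last by rewrite eq_card0.
have k0 : 0 < k%:R :> R by rewrite ltr0n kN addn_gt0 N0.
have L0 : 0 < L%:R :> R by apply: lt_le_trans L29; rewrite exprn_gt0.
have kr : k%:R ^+ 2 = 64 * r%:R :> R.
  rewrite -natrX -natrM; congr _%:R.
  by have := Nr; have := kN; clear; lia.
have [P uP [l Al l1]] := unitary_dmx uA.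
have /choice[Wf hW] : forall X, exists W, D X -> W \is unitarymx /\
    (orbit_close omega Aa Ba W /\ orbit_close omega (Q1 *m Q X *m Q2) Bb W).
  move=> X; case: (boolP (D X)) => [DX|nDX]; last by exists 0.
  by have [W uW hW] := close _ DX; exists W.
pose V X := Wf X *m (Wf X0)^t*.
have uW0 : Wf X0 \is unitarymx by have [] := hW _ D0.
have uV X : D X -> V X \is unitarymx.
  move=> DX; have [uW _] := hW _ DX; exact: mul_unitarymx uW (unitary_adj uW0).
have hVa X : D X -> frob2 (Aa - V X *m Aa *m (V X)^t*) <= 4 * (omega ^+ 2 * k%:R).
  move=> DX; have [uW [ha _]] := hW _ DX; have [_ [ha0 _]] := hW _ D0.
  exact: conj_transfer uW uW0 ha ha0.
pose A0 := Q1 *m Q X0 *m Q2.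
have uA0 : A0 \is unitarymx by exact: mul_unitarymx (mul_unitarymx u1 (uQ X0)) u2.
have hVb X : D X ->
    frob2 (Q1 *m Q X *m Q2 - V X *m A0 *m (V X)^t*) <= 4 * (omega ^+ 2 * k%:R).
  move=> DX; have [uW [_ hb]] := hW _ DX; have [_ [_ hb0]] := hW _ D0.
  exact: conj_transfer uW uW0 hb hb0.
pose S : pred ('I_k * 'I_k) := [pred p | normc (l p.1 - l p.2) < L%:R^-1].
(* [card_close_pairs] gives [4 k^2 (1 / L + 2^-30)], where [1 / L <= 2^-29] keeps the second factor
   below [2^-28]. *)
have cardS : #|S|%:R <= (2 ^+ 26)^-1 * k%:R ^+ 2 :> R.
  have tol0 : 0 <= (2 ^+ 15)^-1 :> R by rewrite invr_ge0 exprn_ge0.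
  have L0' : (0 < L)%N by rewrite -(ltr0n R).
  have trl n : (0 < n < L)%N -> normc (\sum_i l i ^+ n) <= (2 ^+ 15)^-1 * k%:R.
    by move=> hn; have := trA n hn; rewrite Al (iter_dmx _ _ uP) (mxtrace_dmx _ uP).
  apply: le_trans (card_close_pairs L0' tol0 l1 trl) _.
  have : L%:R^-1 <= (2 ^+ 29)^-1 :> R by rewrite lef_pV2// posrE exprn_gt0.
  move: (L%:R^-1) (k%:R ^+ 2) (sqr_ge0 (k%:R : R)) => x y y0 hx.
  have : x + (2 ^+ 15)^-1 ^+ 2 <= (2 ^+ 28)^-1 :> R.
    by rewrite exprVn -exprM; apply: le_trans (lerD hx (lexx _)) _; clear; rewrite !exprS expr0; lra.
  move: (x + _) => z hz.
  have -> : (2 ^+ 26)^-1 * y = 4 * y * (2 ^+ 28)^-1 by rewrite !exprS expr0; field.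
  by rewrite ler_wpM2l// mulr_ge0.
have cardS4 : (4 * #|S| <= r)%N.
  rewrite -(ler_nat R) natrM; move: cardS; rewrite kr; have : 0 <= r%:R :> R by [].
  move: (#|S|%:R) (r%:R) => x y; clear; rewrite !exprS expr0; lra.
(* In this unit [r s^2 = k], the squared Frobenius norm of a unitary. So the rounding has budget
   [K = r], and with [4 #|S| <= r] at most [2^(2 r)] codes. *)
pose s : R := 8 / Num.sqrt k%:R.
have s0 : 0 < s by rewrite divr_gt0// sqrtr_gt0.
have s2 : s ^+ 2 = 64 / k%:R.
  by rewrite exprMn exprVn sqr_sqrtr ?ler0n//; congr (_ / _); ring.
have rs : r%:R * s ^+ 2 = k%:R.
  rewrite s2 mulrA [r%:R * 64]mulrC -kr expr2 mulfK//; exact: lt0r_neq0.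
have [U [code [cD [hcard hcode hclose]]]] := matrix_rounding S r s0.
pose Vt X := P *m V X *m P^t*.
have fVt X : D X -> frob2 (Vt X) <= r%:R * s ^+ 2.
  move=> DX; rewrite rs (frob2_unitaryr _ (unitary_adj uP)) (frob2_unitaryl _ uP).
  by rewrite (frob2_unitary (uV _ DX)).
have key X Y : D X -> D Y -> code (Vt X) = code (Vt Y) -> (hamming X Y <= r)%N.
  move=> DX DY e; have h16 : (0 < 16)%N by [].
  rewrite -(leq_pmul2l h16) -Nr; apply: (sepQ X Y DX DY).
  have := hclose _ _ (fVt _ DX) (fVt _ DY) e => hS.
  have off Z : D Z -> \sum_(p | ~~ S p) normc (Vt Z p.1 p.2) ^+ 2
      <= 4 * (omega ^+ 2 * k%:R) / L%:R^-1 ^+ 2.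
    move=> DZ; have Li : 0 < L%:R^-1 :> R by rewrite invr_gt0.
    have h : frob2 (dmx P l - V Z *m dmx P l *m (V Z)^t*) <= 4 * (omega ^+ 2 * k%:R).
      by rewrite -Al; exact: hVa.
    apply: le_trans (approx_commutant uP Li (uV _ DZ) h); apply: eq_ler.
    by apply: eq_bigl => p; rewrite /S /= leNgt.
  (* On [S] the rounding contributes at most [2^-17 k]; off [S] the mass bound contributes
     [2^-18 k], because [omega L = 2^-11]. *)
  have hV : frob2 (V X - V Y) <= (2 ^+ 16)^-1 * k%:R.
    rewrite -(frob2_unitaryB (V X) (V Y) uP (unitary_adj uP)) -/(Vt X) -/(Vt Y).
    apply: le_trans (frob2B_split hS (off _ DX) (off _ DY)) _.
    rewrite omE s2.
    have -> : 4 * (4 * ((2 ^+ 11 * L%:R)^-1 ^+ 2 * k%:R) / L%:R^-1 ^+ 2)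
        = 16 * (2 ^+ 22)^-1 * k%:R :> R.
      by rewrite !exprS expr0; field; exact: lt0r_neq0.
    have : 8 * (64 / k%:R) * #|S|%:R <= 512 * (2 ^+ 26)^-1 * k%:R :> R.
      rewrite -mulrA -mulrA -mulrA; apply: le_trans (_ : 8 * (64 * (k%:R^-1 * ((2 ^+ 26)^-1 * k%:R ^+ 2))) <= _).
        by rewrite !ler_wpM2l// invr_ge0 ltW.
      by apply: eq_ler; rewrite !exprS expr0; field; exact: lt0r_neq0.
    move: (8 * (64 / _) * _) k0; move: (k%:R) => x y; clear; rewrite !exprS expr0; lra.
  have := conj_close (uV _ DX) (uV _ DY) uA0 (hVb _ DX) (hVb _ DY).
  have -> : frob2 (Q1 *m Q X *m Q2 - Q1 *m Q Y *m Q2) = frob2 (Q X - Q Y).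
    exact: frob2_unitaryB.
  have om2 : omega ^+ 2 <= (2 ^+ 40)^-1 by rewrite omE; exact: sqr_radius_le.
  have : omega ^+ 2 * k%:R <= (2 ^+ 40)^-1 * k%:R by apply: ler_wpM2r om2; exact: ltW.
  move: (omega ^+ 2 * _) (frob2 _) (frob2 _) hV k0; move: (k%:R : R) => a b c d.
  by clear; rewrite !exprS expr0; lra.
have cD_sub X : D X -> cD (code (Vt X)) by move=> DX; exact: hcode (fVt _ DX).
have fib y : (#|[pred X | D X && (code (Vt X) == y)]| <= 2 ^ (6 * r))%N.
  case: (pickP [pred X | D X && (code (Vt X) == y)]) => [Y /andP[DY /eqP eY]|h0]; last first.
    by rewrite eq_card0.
  apply: leq_trans (card_hamming_ball R Y Nr); apply: subset_leq_card.
  apply/fintype.subsetP => X; rewrite !inE => /andP[DX /eqP eX].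
  exact: key DY DX (etrans eY (esym eX)).
apply: leq_trans (card_le_fibers cD_sub fib) _.
apply: leq_trans (_ : 2 ^ (r + 4 * #|S|) * 2 ^ (6 * r) <= _)%N; first by rewrite leq_mul2r hcard orbT.
rewrite -expnD leq_exp2l//.
by move: cardS4; move: (4 * _)%N; clear; lia.
Qed.

End OrbitFibers.

Section CoverBound.
Context (R : realType).
Local Notation C := R[i].
Local Open Scope sesquilinear_scope.

Definition signed_flat k (h : 'M[R]_k) (e : nat -> {ffun 'I_k -> bool}) j (U : 'M[C]_k) :=
  signmx R (e j) *m (cmx h *m signmx R (e j.+1) *m U) *m signmx R (e j.+2).

Lemma signed_flat_unitary k (h : 'M[R]_k) e j (U : 'M[C]_k) :
  flat h -> U \is unitarymx -> signed_flat h e j U \is unitarymx.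
Proof.
move=> hh uU; apply: mul_unitarymx; last exact: signmx_unitary.
apply: mul_unitarymx; first exact: signmx_unitary.
apply: mul_unitarymx uU; apply: mul_unitarymx; last exact: signmx_unitary.
exact: cmx_unitary (proj1 hh).
Qed.

(** Pigeonhole on the six sign vectors and the ball assigned to each tame [X]:
    [2^(16 r - 1) <= 2^(6 k) n 2^(8 r)]. With [k = 2 N] and [16 r = N^2], the requirement
    [6 k + 1 <= 2 r] reads [96 N + 8 <= N^2], which holds from [N = 97] on. *)
Lemma card_cover_ge (N r L k n : nat) (omega : R) (h : 'M[R]_k)
    (Q : {ffun 'I_N * 'I_N -> bool} -> 'M[C]_k)
    (e : {ffun 'I_N * 'I_N -> bool} -> nat -> {ffun 'I_k -> bool})
    (Ba Bb : 'I_n -> 'M[C]_k) (c : {ffun 'I_N * 'I_N -> bool} -> 'I_n) :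
  (97 <= N)%N -> k = (N + N)%N -> (N * N = 16 * r)%N -> (2 ^+ 29 : R) <= L%:R ->
  omega = (2 ^+ 11 * L%:R)^-1 -> flat h ->
  (forall X, Q X \is unitarymx) ->
  (forall X Y, tame R X -> tame R Y -> frob2 (Q X - Q Y) <= (2 ^+ 12)^-1 * k%:R ->
     (16 * hamming X Y <= N * N)%N) ->
  (forall X q, tame R X -> (0 < q < L)%N ->
     normc (\tr (iter q (mulmx (signed_flat h (e X) 3 1%:M)) 1%:M)) <= (2 ^+ 15)^-1 * k%:R) ->
  (forall X, tame R X -> exists2 W, W \is unitarymx &
     orbit_close omega (signed_flat h (e X) 3 1%:M) (Ba (c X)) W /\
     orbit_close omega (signed_flat h (e X) 0 (Q X)) (Bb (c X)) W) ->
  (2 ^ (6 * r) <= n)%N.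
Proof.
move=> N97 kN Nr L29 omE hh uQ sepQ trA close.
have N0 : (0 < N)%N by exact: leq_trans N97.
pose f X := ([ffun j : 'I_6 => e X j], c X).
have fib y : (#|[pred X | tame R X && (f X == y)]| <= 2 ^ (8 * r))%N.
  case: (pickP [pred X | tame R X && (f X == y)]) => [X0 /andP[t0 /eqP f0]|h0]; last first.
    by rewrite eq_card0.
  have eE X j : f X == y -> (j < 6)%N -> e X j = e X0 j.
    move=> /eqP; rewrite -f0 => -[/ffunP fe _] j6.
    by have := fe (Ordinal j6); rewrite !ffunE.
  have cE X : f X == y -> c X = c X0 by move=> /eqP; rewrite -f0 => -[].
  pose D : pred {ffun 'I_N * 'I_N -> bool} := [pred X | tame R X && (f X == y)].
  have uA := signed_flat_unitary (e X0) 3 hh (unitary1 R k).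
  have u1 : signmx R (e X0 0) *m (cmx h *m signmx R (e X0 1)) \is unitarymx.
    apply: mul_unitarymx; first exact: signmx_unitary.
    apply: mul_unitarymx; [exact: cmx_unitary (proj1 hh)|exact: signmx_unitary].
  have u2 := signmx_unitary R (e X0 2).
  have sepD X Y : D X -> D Y -> frob2 (Q X - Q Y) <= (2 ^+ 12)^-1 * k%:R ->
     (16 * hamming X Y <= N * N)%N by move=> /andP[tX _] /andP[tY _]; exact: sepQ.
  have trD q (hq : (0 < q < L)%N) := trA X0 q t0 hq.
  apply: (card_orbit_fiber N0 kN Nr L29 omE uQ sepD uA u1 u2 trD
    (Ba := Ba (c X0)) (Bb := Bb (c X0))).
  move=> X /andP[tX fX]; have [W uW [ha hb]] := close X tX.
  have eX j (hj : (j < 6)%N) := eE X j fX hj.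
  rewrite /signed_flat (cE X fX) in ha hb.
  exists W; first exact: uW.
  split; first by rewrite /signed_flat -(eX 3 isT) -(eX 4 isT) -(eX 5 isT); exact: ha.
  by rewrite !mulmxA -(eX 0 isT) -(eX 1 isT) -(eX 2 isT); rewrite !mulmxA in hb; exact: hb.
have := card_le_fibers (fun _ _ => erefl : predT (f _)) fib => hc.
have h2 := card_tame R N0.
have : (2 ^ (16 * r) <= 2 ^ ((2 * r) + 8 * r) * n)%N.
  have e1 : #|{: {ffun 'I_N * 'I_N -> bool}}| = (2 ^ (16 * r))%N.
    by rewrite card_ffun card_bool card_prod !card_ord Nr.
  rewrite -e1; apply: leq_trans h2 _; apply: leq_trans (leq_mul (leqnn 2) hc) _.
  rewrite cardT -cardE card_prod card_ffun card_ffun card_bool !card_ord kN -expnM.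
  rewrite -mulnA mulnA -expnS expnD -[leqRHS]mulnA [(2 ^ (8 * r) * n)%N]mulnC leq_mul2r.
  by rewrite leq_exp2l//; apply/orP; right; move: N97 Nr; clear; nia.
have -> : (16 * r = (2 * r + 8 * r) + 6 * r)%N by rewrite -!mulnDl.
by rewrite expnD leq_pmul2l ?expn_gt0.
Qed.

End CoverBound.

(** * Relative microstates of free generators *)

Section Microstates.
Context (R : realType) (F : groupType).
Local Notation C := R[i].
Local Open Scope sesquilinear_scope.

Lemma free_approx_reps (G : set F) (a b : F) :
  free_generating_set G -> a \in G -> b \in G -> a != b -> approx_reps R F.
Proof.
move=> hG aG bG ab S tol t0.
have [k0 hk] := approximately_free_urep S 0 hG aG bG ab t0.
have [N [kN _ [h hh]]] := exists_flat R k0.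
have k0N : (k0 < N + N)%N by exact: leq_trans (leq_addr _ _).
have [_ [pi up [_ _ hS _]]] := hk _ h 1%:M k0N hh (unitary1 R _).
by exists (N + N)%N, pi; split=> //; exact: leq_ltn_trans k0N.
Qed.

Lemma urepX k (pi : F -> 'M[C]_k) g n : urep pi ->
  pi (g ^+ n)%g = iter n (mulmx (pi g)) 1%:M.
Proof.
move=> up; elim: n => [|n IH]; first by rewrite expg0 (urep1 up).
by rewrite expgS (proj1 up) IH.
Qed.

Definition words (J : finType) m : seq (seq J) :=
  flatten [seq [seq tval t | t : q.-tuple J] | q <- iota 0 m.+1].

Lemma mem_words (J : finType) m (w : seq J) : (size w <= m)%N -> w \in words J m.
Proof.
move=> wm; apply/flatten_mapP; exists (size w); first by rewrite mem_iota.
by apply/fintype.imageP; exists (in_tuple w).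
Qed.

(** The order of the quantifiers is the point. The accuracy [d] depends only on [N], [m] and [eps],
    so the approximants can be chosen for it; the trace tolerance comes last, because it depends on
    their l1-norms. Each of the two errors receives half of [eps]. *)
Lemma mxev_Gamma (J : finType) (z : J -> bop R F) (N : R) (m : nat) (eps : R) :
  approx_reps R F -> 1 <= N -> 0 < eps ->
  (forall j, right_invariant (z j)) -> (forall j, bounded_by (z j) N) ->
  exists2 d, 0 < d & forall s : J -> seq (C * F),
    (forall j, ubound (s j) (N ^+ 2)) ->
    (forall j, l2norm (op (z j) (delta 1%g) - lev (s j) (delta 1%g)) <= d) ->
    exists S : seq F, exists2 tol, 0 < tol & forall k (pi : F -> 'M[C]_k),
      (0 < k)%N -> urep pi ->
      (forall g, g \in S -> g != 1%g -> normc (ntr (pi g)) < tol) ->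
      Gamma (group_trace R F) N z m eps (fun j => mxev pi (s j)).
Proof.
move=> AR N1 e0 zinv zbd; have N0 : 0 <= N by apply: le_trans N1.
pose M := m%:R * N ^+ m; have M0 : 0 <= M by rewrite mulr_ge0 ?exprn_ge0.
exists (eps / 2 / (M + 1)); first by rewrite !divr_gt0// ltr_wpDl.
set d := _ / (M + 1); move=> s sbd zs.
have d0 : 0 <= d by rewrite !divr_ge0 ?addr_ge0// ltW.
pose ws := words (J * bool)%type m.
pose T : R := \sum_(w <- ws) l1norm (galg_word s w).
have T0 : 0 <= T by apply: sumr_ge0 => w _; exact: l1norm_ge0.
exists (flatten [seq [seq x.2 | x <- galg_word s w] | w <- ws]).
exists (eps / 2 / (T + 1)); first by rewrite !divr_gt0// ltr_wpDl.
set tol := _ / (T + 1) => k pi k0 up hS; split.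
  by move=> j; apply: opnorm_le => //; exact: sbd.
move=> w /andP[_ wm]; have ww : w \in ws := mem_words wm.
rewrite -(mxev_word s w up).
set X := ntr _; set Y := group_trace _ _ _.
have tol0 : 0 < tol by rewrite !divr_gt0// ltr_wpDl.
have h1 : normc (X - gcoef (galg_word s w) 1%g) <= eps / 2.
  apply: le_trans (ntr_mxev k0 up tol0 _) _.
    by move=> g gw; apply: hS; apply/flatten_mapP; exists w.
  apply: (@le_trans _ _ (tol * (T + 1))); last by rewrite divfK// gt_eqF// ltr_wpDl.
  apply: ler_wpM2l; first exact: ltW.
  apply: le_trans (_ : T <= _); last by rewrite lerDl.
  by rewrite /T (big_rem w)//= lerDl sumr_ge0// => v _; exact: l1norm_ge0.
have h2 : normc (Y - gcoef (galg_word s w) 1%g) < eps / 2.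
  apply: le_lt_trans (trace_word_approx AR N1 d0 zinv zbd sbd zs w) _.
  apply: (@le_lt_trans _ _ (M * d)).
    rewrite ler_wpM2r//; apply: ler_pM => //; first exact: exprn_ge0.
      by rewrite ler_nat.
    exact: ler_weXn2l.
  rewrite /d mulrCA mulrC -[ltRHS]mul1r ltr_pM2r ?divr_gt0//.
  by rewrite ltr_pdivrMr ?ltr_wpDl// mul1r ltrDl.
have -> : X - Y = (X - gcoef (galg_word s w) 1%g) + - (Y - gcoef (galg_word s w) 1%g) by ring.
by apply: le_lt_trans (normc_triangle _ _) _; rewrite normcN; lra.
Qed.

(** The bound [N / 2] on the [y l] leaves room for the factor 2 of [kaplansky_density]; the [x j]
    are group elements and need no approximation. The approximants are chosen before [U], so one
    [k0] serves all unitaries. *)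
Lemma free_microstates (G : set F) (a b : F) (J H : finType) (x : J -> bop R F)
    (y : H -> bop R F) (gx : J -> F) (N : R) (m q : nat) (eps tol : R) :
  free_generating_set G -> a \in G -> b \in G -> a != b ->
  (forall j, x j = regrep R (gx j)) ->
  1 <= N -> 0 < eps -> 0 < tol ->
  (forall l, right_invariant (y l)) -> (forall l, bounded_by (y l) (N / 2)) ->
  exists k0, forall k (h : 'M[R]_k) (U : 'M[C]_k), (k0 < k)%N -> flat h ->
    U \is unitarymx ->
    exists (e : nat -> {ffun 'I_k -> bool}) (A : J -> 'M[C]_k),
    [/\ Gamma_rel (group_trace R F) x y N m eps A,
        forall j, gx j = b -> A j = signed_flat h e 0 U,
        forall j, gx j = a -> A j = signed_flat h e 3 1%:M &
        forall n, (0 < n <= q)%N ->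
          normc (ntr (iter n (mulmx (signed_flat h e 3 1%:M)) 1%:M)) < tol].
Proof.
move=> hG aG bG ab xE N1 e0 t0 yinv ybd.
have AR := free_approx_reps hG aG bG ab.
have zinv j : right_invariant (join_family x y j).
  by case: j => [j|l] /=; [rewrite xE; exact: right_invariant_regrep|exact: yinv].
have N2 : 0 < N / 2 by rewrite divr_gt0// (lt_le_trans _ N1).
have zbd j : bounded_by (join_family x y j) N.
  case: j => [j|l] /=.
    rewrite xE; split=> f /=; rewrite {1}/l2norm sqnorm_translate; apply: ler_peMl => //;
      exact: l2norm_ge0.
  by have [h1 h2] := ybd l; split=> f; [apply: le_trans (h1 f) _ | apply: le_trans (h2 f) _];
    rewrite ler_wpM2r ?l2norm_ge0//; lra.
have [d d0 hd] := mxev_Gamma m AR N1 e0 zinv zbd.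
have /choice[sy hsy] : forall l, exists s : seq (C * F), ubound s (N ^+ 2) /\
    l2norm (op (y l) (delta 1%g) - lev s (delta 1%g)) <= d.
  move=> l; have [s hs1 hs2] := kaplansky_density AR (yinv l) N2 (ybd l) d0.
  by exists s; split=> //; have -> : N = 2 * (N / 2) by field.
pose s (j : J + H) := match j with inl j => [:: (1 : C, gx j)] | inr l => sy l end.
have [] := hd s.
- case=> [j|l] /=; last exact: (hsy l).1.
  move=> k pi up; rewrite /mxev big_seq1 scale1r => v.
  by rewrite frob2_unitaryl ?(proj2 up)// ler_peMl ?frob2_ge0// exprn_ege1.
- case=> [j|l] /=; last exact: (hsy l).2.
  by rewrite xE /lev big_seq1 scale1r subrr l2norm0 ltW.
move=> S [tol' t0' hS].
have tt0 : 0 < Num.min tol tol' by rewrite lt_min t0.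
have [k0 hk] := approximately_free_urep S q hG aG bG ab tt0.
exists k0 => k h U kk hh uU; have [e [pi up [pb pa hpS hpa]]] := hk k h U kk hh uU.
have k1 : (0 < k)%N by exact: leq_ltn_trans kk.
exists e, (fun j => pi (gx j)); split.
- exists (fun l => mxev pi (sy l)).
  have -> : join_family (fun j => pi (gx j)) (fun l => mxev pi (sy l)) = fun j => mxev pi (s j).
    by apply/funext => -[j|l] //=; rewrite /mxev big_seq1 scale1r.
  apply: hS k1 up _ => g gS g1; apply: lt_le_trans (hpS g gS g1) _.
  by rewrite ge_min lexx orbT.
- by move=> j ->.
- by move=> j ->.
- move=> n hn; rewrite -[signed_flat _ _ _ _]pa -urepX//.
  by apply: lt_le_trans (hpa n hn) _; rewrite ge_min lexx.
Qed.

End Microstates.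

(** * Lower bounds for covering numbers and for the entropy *)

Section EntropyBound.
Context (R : realType) (F : groupType).
Local Notation C := R[i].
Local Open Scope sesquilinear_scope.

Lemma norm2_coord k (J : finType) (D : J -> 'M[C]_k) (omega : R) j : (0 < k)%N ->
  norm2 D < omega -> frob2 (D j) <= omega ^+ 2 * k%:R.
Proof.
move=> k0 h; have kR : 0 < k%:R :> R by rewrite ltr0n.
have e : complex.Re (\sum_j ntr ((D j)^t* *m D j)) = \sum_j frob2 (D j) / k%:R.
  by rewrite Re_sum; apply: eq_bigr => i _; rewrite ntr_frob2.
have S0 : 0 <= \sum_j frob2 (D j) / k%:R.
  by apply: sumr_ge0 => i _; rewrite divr_ge0 ?frob2_ge0.
rewrite -ler_pdivrMr//; apply: (@le_trans _ _ (\sum_j frob2 (D j) / k%:R)).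
  by rewrite (bigD1 j)//= lerDl; apply: sumr_ge0 => i _; rewrite divr_ge0 ?frob2_ge0.
move: h; rewrite /norm2 e => h; rewrite -[leLHS]sqr_sqrtr//.
by apply: lerXn2r; rewrite ?nnegrE ?sqrtr_ge0//; [apply: le_trans (ltW h); exact: sqrtr_ge0|exact: ltW].
Qed.

Lemma free_cover_num_ge (G : set F) (a b : F) (J H : finType) (x : J -> bop R F)
    (y : H -> bop R F) (gx : J -> F) (N : R) (m L n0 : nat) (eps omega : R) (ja jb : J) :
  free_generating_set G -> a \in G -> b \in G -> a != b ->
  (forall j, x j = regrep R (gx j)) -> gx ja = a -> gx jb = b ->
  1 <= N -> 0 < eps ->
  (forall l, right_invariant (y l)) -> (forall l, bounded_by (y l) (N / 2)) ->
  (2 ^+ 29 : R) <= L%:R -> omega = (2 ^+ 11 * L%:R)^-1 ->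
  exists k r : nat, [/\ (n0 <= k)%N, (0 < r)%N, (k ^ 2 = 64 * r)%N &
    (((2 ^ (6 * r))%N%:R : R)%:E <=
       cover_num (@Gamma_rel R F (group_trace R F) J H x y N m k eps) omega)%E].
Proof.
move=> hG aG bG ab xE gja gjb N1 e0 yinv ybd L29 omE.
have tol0 : 0 < (2 ^+ 15)^-1 :> R by rewrite invr_gt0 exprn_gt0.
have [k0 hk] := free_microstates m L hG aG bG ab xE N1 e0 tol0 yinv ybd.
have [M [Mn /dvdnP[M' M4] [h hh]]] := exists_flat R (k0 + n0 + 97)%N.
exists (M + M)%N, (M' ^ 2)%N.
have M97 : (97 <= M)%N by move: Mn; clear; lia.
have Mr : (M * M = 16 * M' ^ 2)%N by rewrite M4 -mulnn; clear; lia.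
have M0 : (0 < M)%N by exact: leq_trans M97.
have MM0 : (0 < M + M)%N by rewrite addn_gt0 M0.
have kM : (k0 < M + M)%N by move: Mn; clear; lia.
split.
- by move: Mn; clear; lia.
- by rewrite expn_gt0; move: M0; rewrite M4; case: (M').
- by move: Mr; rewrite -!mulnn; clear; lia.
have [Q [uQ sepQ]] := exists_clipped_unitaries R M0.
apply: le_ereal_inf_tmp => _ [n [Bc [_ cov]] <-]; rewrite lee_fin ler_nat.
have /choice[c hc] : forall X, exists c : (nat -> {ffun 'I_(M + M) -> bool}) * 'I_n,
    (forall q, (0 < q <= L)%N ->
      normc (ntr (iter q (mulmx (signed_flat h c.1 3 1%:M)) 1%:M)) < (2 ^+ 15)^-1) /\
    exists2 W, W \is unitarymx & orbit_close omega (signed_flat h c.1 3 1%:M) (Bc c.2 ja) W /\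
      orbit_close omega (signed_flat h c.1 0 (Q X)) (Bc c.2 jb) W.
  move=> X; have [e [A [AG Ab Aa Atr]]] := hk _ h (Q X) kM hh (uQ X).
  have [i _ [W uW hW]] := cov A AG; exists (e, i); split=> //; exists W; first exact: uW.
  rewrite /orbit_close /= -(Aa ja gja) -(Ab jb gjb).
  by split; [exact: norm2_coord ja MM0 hW|exact: norm2_coord jb MM0 hW].
apply: (card_cover_ge (e := fun X => (c X).1) (c := fun X => (c X).2) (Q := Q) (h := h)
  (Ba := fun i => Bc i ja) (Bb := fun i => Bc i jb) M97 erefl Mr L29 omE hh uQ sepQ).
  move=> X q _ /andP[q0 qL]; have [htr _] := hc X.
  have := htr q; rewrite q0 (ltnW qL) => /(_ isT) /ltW; rewrite /ntr normcM.
  have kR : 0 < (M + M)%:R :> R by rewrite ltr0n.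
  rewrite natrC -fmorphV normc_real ger0_norm ?invr_ge0 ?ler0n//.
  by rewrite mulrC ler_pdivrMr.
by move=> X _; exact: (hc X).2.
Qed.

(** A limsup needs only infinitely many [k], which suits flat matrices, constructed for special
    sizes only. *)
Lemma limn_esup_ge (u : (\bar R)^nat) (c : \bar R) :
  (forall n, exists2 k, (n <= k)%N & (c <= u k)%E) -> (c <= limn_esup u)%E.
Proof.
move=> hu; apply: le_ereal_inf_tmp => _ [V [n _ hV] <-].
have [k nk ck] := hu n; apply: le_trans ck _; apply: ereal_sup_ubound.
by exists k => //; exact: hV.
Qed.

(** Microstates are indexed by the operators in [E]; injectivity recovers the group elements and
    keeps the indices of [a] and [b] apart. *)
Lemma regrep_inj : injective (@regrep R F).
Proof.
move=> a b e; have E g : op (regrep R g) (delta 1%g) a = (delta 1%g : l2 R F) (g^-1 * a)%g by [].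
have := E a; rewrite e E !deltaE mulVg eqxx; case: eqP => [h _|_ /esym/eqP].
  by rewrite -[a](mulVKg b) h mulg1.
by rewrite oner_eq0.
Qed.

Lemma group_vN_regrep a : group_vN R F (regrep R a).
Proof. by move=> S hS f; rewrite (hS (regrep R a))//; exists a. Qed.

Lemma card_ge2 (G : set F) : (`I_2 #<= G)%card -> exists a b, [/\ a \in G, b \in G & a != b].
Proof.
case/card_leP => f.
have h0 : (0%N : nat) \in `I_2 by rewrite inE.
have h1 : (1%N : nat) \in `I_2 by rewrite inE.
exists (val (f (exist _ 0%N h0))), (val (f (exist _ 1%N h1))); split; rewrite ?(valP (f _))//.
apply/eqP => /val_inj e.
have := @inj _ _ _ f (exist _ 0%N h0) (exist _ 1%N h1).
by move=> /(_ (in_setT _) (in_setT _) e) [].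
Qed.

Lemma frakK2_gt0 (G : set F) (a b : F) (J H : finType) (x : J -> bop R F)
    (y : H -> bop R F) (gx : J -> F) (ja jb : J) :
  free_generating_set G -> a \in G -> b \in G -> a != b ->
  (forall j, x j = regrep R (gx j)) -> gx ja = a -> gx jb = b ->
  (forall l, right_invariant (y l)) ->
  (0 < frakK2 (group_trace R F) x y)%E.
Proof.
move=> hG aG bG ab xE gja gjb yinv.
have [L L29] : exists L : nat, (2 ^+ 29 : R) <= L%:R.
  by exists (Num.bound (2 ^+ 29 : R)); apply/ltW/archi_boundP; exact: exprn_ge0.
have LR : 1 < L%:R :> R by apply: lt_le_trans L29; rewrite exprn_egt1// ltr1n.
pose omega : R := (2 ^+ 11 * L%:R)^-1.
have o0 : 0 < omega by rewrite invr_gt0 mulr_gt0 ?exprn_gt0// (lt_trans _ LR).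
have o1 : omega < 1.
  rewrite invf_lt1; last by rewrite mulr_gt0 ?exprn_gt0// (lt_trans _ LR).
  by rewrite mulr_egt1// exprn_egt1// ltr1n.
have lo : 0 < - ln omega by rewrite oppr_gt0 ln_lt0// o0.
pose Nb l := projT1 (cid2 (bounded_by_exists (y l))).
have hNb l : 0 < Nb l /\ bounded_by (y l) (Nb l) by rewrite /Nb; case: cid2.
(* One cutoff for all [y l], fixed before [m] and [eps]; the factor 2 matches the bound [N / 2] in
   [free_microstates]. *)
pose N : R := 1 + \sum_l 2 * Nb l.
have Ns l : 2 * Nb l <= N.
  rewrite /N (bigD1 l)//= addrCA lerDl addr_ge0// sumr_ge0// => i _.
  by rewrite mulr_ge0// ltW// (hNb i).1.
have N1 : 1 <= N by rewrite lerDl sumr_ge0// => i _; rewrite mulr_ge0// ltW// (hNb i).1.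
have ybd l : bounded_by (y l) (N / 2).
  have [n0 [h1 h2]] := hNb l; split=> f; [apply: le_trans (h1 f) _|apply: le_trans (h2 f) _];
    by rewrite ler_wpM2r ?l2norm_ge0// ler_pdivlMr// mulrC.
(* The logarithm of [2^(6 r)] over [k^2 = 64 r]: the quotient is free of [k], [m] and [eps]. *)
pose c : R := 6 / 64 * ln 2 / (- ln omega).
have c0 : 0 < c by rewrite !(divr_gt0, mulr_gt0)// ln_gt0// ltr1n.
have o01 : 0 < omega < 1 by rewrite o0.
apply: lt_le_trans (_ : c%:E <= _)%E; first by rewrite lte_fin.
apply: le_trans (ereal_sup_ubound (ex_intro2 _ _ omega o01 erefl)).
have N0 : 0 < N by apply: lt_le_trans N1.
apply: le_trans (ereal_sup_ubound (ex_intro2 _ _ N N0 erefl)).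
apply: le_ereal_inf_tmp => _ [[m eps] /= [m0 e0] <-].
apply: limn_esup_ge => n0.
have [k [r [nk r0 kr hcov]]] := free_cover_num_ge m n0 hG aG bG ab xE gja gjb N1 e0 yinv ybd
  L29 erefl.
exists k => //.
have p0 : 0 < (2 ^ (6 * r))%N%:R :> R by rewrite ltr0n expn_gt0.
have kR : k%:R ^+ 2 = 64 * r%:R :> R by rewrite -natrX kr natrM.
have rR : 0 < r%:R :> R by rewrite ltr0n.
have ce : c%:E = ((ln (2 ^ (6 * r))%N%:R)%:E * (- (k%:R ^+ 2 * ln omega))^-1%:E)%E.
  rewrite -EFinM; congr _%:E; rewrite natrX lnXn// kR /c -[ln 2 *+ _]mulr_natr natrM.
  have lo' : ln omega != 0 by rewrite -oppr_eq0 gt_eqF.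
  have r' : r%:R != 0 :> R by rewrite gt_eqF.
  by field; rewrite ?lo' ?r'.
rewrite ce lee_wpmul2r//.
  rewrite lee_fin invr_ge0 -mulrN mulr_ge0 ?exprn_ge0//; exact: ltW.
rewrite -lne_EFin//; move: hcov.
(* The covering number may be infinite, and then so is its logarithm; the lower bound excludes
   [-oo]. *)
set v := cover_num _ _; case: v => [v|_|//].
  rewrite lee_fin => hv; have v0 := lt_le_trans p0 hv.
  by rewrite (lne_EFin p0) (lne_EFin v0) lee_fin ler_ln.
by rewrite (lne_EFin p0) leey.
Qed.

End EntropyBound.

Local Open Scope card_scope.

Theorem theorem4p5 (R : realType) (F : groupType) (G : set F)
  (hG : free_generating_set G) (hG2 : `I_2 #<= G) :
  frakK3 (group_trace R F) (group_vN R F) = +oo%E.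
Proof.
have [a [b [aG bG ab]]] := card_ge2 hG2.
apply/eqP; rewrite -leye_eq; pose E := [fset regrep R a; regrep R b]%fset.
have EvN : [set` E] `<=` group_vN R F.
  by move=> T /=; rewrite !inE => /orP[] /eqP ->; exact: group_vN_regrep.
apply: le_trans (ereal_sup_ubound (ex_intro2 _ _ E EvN erefl)).
apply: le_ereal_inf_tmp => _ [H HvN <-].
have aE : regrep R a \in E by rewrite !inE eqxx.
have bE : regrep R b \in E by rewrite !inE eqxx orbT.
pose gx (e : E) := if val e == regrep R a then a else b.
have xE (e : E) : val e = regrep R (gx e).
  rewrite /gx; case: eqP => [->//|/eqP ea]; have := valP e.
  by rewrite !inE (negPf ea) /= => /eqP.
have gb : gx [` bE]%fset = b.
  by rewrite /gx /=; case: eqP => // /(@regrep_inj R) ba; rewrite -ba.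
have ga : gx [` aE]%fset = a by rewrite /gx /= eqxx.
have yinv (l : H) : right_invariant (val l).
  by apply: group_vN_right_invariant; apply: HvN; exact: valP.
by rewrite gt0_mulye// (frakK2_gt0 hG aG bG ab xE ga gb yinv).
Qed.
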